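(* Suppose there are constants $c,c',c''>0$ such that $c|F|^p-c'\le W_{\rm cell}(F)\le c''(|F|^p+1)$ for every $F\in V_0$, and suppose $\Omega$ is connected. If $y_\varepsilon$ is a sequence (indexed by $\varepsilon$ ranging over a sequence of positive numbers tending to $0$) with equibounded energies $F_\varepsilon(y_\varepsilon,\Omega)$, then there exist a (sub)sequence $\varepsilon_k\to0$ and $y\in W^{1,p}(\Omega;\mathbb R^d)$ such that $y_{\varepsilon_k}\to y$ in $L^p_{loc}(\Omega;\mathbb R^d)/\mathbb R$.
   Context: Let $d\in\mathbb N$, $1<p<\infty$, and let $\Omega\subset\mathbb R^d$ be bounded and open with Lipschitz boundary. Let $A\in\mathbb R^{d\times d}$ be invertible, $\mathcal L=A\mathbb Z^d$, $\mathcal L_\varepsilon=\varepsilon\mathcal L$ for $\varepsilon>0$. The $\varepsilon$-cells $z+A[0,\varepsilon)^d$, $z\in\mathcal L_\varepsilon$, partition $\mathbb R^d$; $Q_\varepsilon(x)$ is the cell containing $x$, and $\mathcal L_\varepsilon'=\mathcal L_\varepsilon+\varepsilon A(\frac12,\dots,\frac12)^T$ is the set of all cell centers. Let $z_1,\dots,z_{2^d}$ be the points of $A\{-\frac12,\frac12\}^d$. For open $U\subset\mathbb R^d$: $\mathcal L_\varepsilon'(U)=\{x\in\mathcal L'_\varepsilon:\overline{Q_\varepsilon(x)}\cap U\ne\emptyset\}$, $(\mathcal L_\varepsilon'(U))^\circ=\{x\in\mathcal L'_\varepsilon:\overline{Q_\varepsilon(x)}\subset U\}$. $\mathcal B_\varepsilon(U)$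 is the set of functions with values in $\mathbb R^d$ that on $U$ are constant on every cell $Q_\varepsilon(x)$ (intersected with $U$), $x\in\mathcal L'_\varepsilon(U)$. For $y\in\mathcal B_\varepsilon(U)$ and $x\in(\mathcal L'_\varepsilon(U))^\circ$ put $y_i=y(x+\varepsilon z_i)$, $\bar y=2^{-d}\sum_{i=1}^{2^d}y_i$ and $\bar\nabla y(x)=\frac1\varepsilon(y_1-\bar y,\dots,y_{2^d}-\bar y)\in\mathbb R^{d\times 2^d}$. Put $V_0=\{F=(a_{ij})\in\mathbb R^{d\times2^d}:\sum_{j=1}^{2^d}a_{ij}=0\ \text{for } i=1,\dots,d\}$. Given $W_{\rm cell}\colon\mathbb R^{d\times2^d}\to[0,\infty)$, set $F_\varepsilon(y,U)=\varepsilon^d\sum_{x\in(\mathcal L'_\varepsilon(U))^\circ}W_{\rm cell}(\bar\nabla y(x))$ if $y\in\mathcal B_\varepsilon(U)$, and $F_\varepsilon(y,U)=\infty$ otherwise. Equibounded energies means $\sup_\varepsilon F_\varepsilon(y_\varepsilon,\Omega)<\infty$. Convergence $y_n\to y$ in $L^p_{loc}(\Omega;\mathbb R^d)/\mathbb R$ means that there are constant vectors $c_n\in\mathbb R^d$ with $y_n-c_n\to y$ in $L^p(U;\mathbb R^d)$ for every open $U\subset\subset\Omega$. *)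

(* Defs.v *)
From HB Require Import structures.
From mathcomp Require Import all_boot all_order all_algebra.
From mathcomp Require Import all_classical all_reals all_analysis.

Set Implicit Arguments.
Unset Strict Implicit.
Unset Printing Implicit Defensive.

Import Order.TTheory GRing.Theory Num.Theory.
Import numFieldNormedType.Exports.

Local Open Scope classical_set_scope.
Local Open Scope ring_scope.


(* The product sigma-algebra: generated by the entries.  For T = R this is the
   Borel sigma-algebra. *)
Definition mx_cylinders d (T : measurableType d) m n : set (set 'M[T]_(m, n)) :=
  [set A | exists (i : 'I_m) (j : 'I_n),
    exists2 B : set T, measurable B & A = [set M : 'M[T]_(m, n) | B (M i j)]].

Definition mx_display : measure_display -> measure_display.
Proof. exact. Qed.

Section mx_measurable.
Context d (T : measurableType d) (m n : nat).

HB.instance Definition _ := @isMeasurable.Build (mx_display d)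
  'M[T]_(m, n) <<s mx_cylinders (T := T) (m := m) (n := n) >>
  (@sigma_algebra0 _ _ _) (@sigma_algebraC _ _) (@sigma_algebra_bigcup _ _ _).

Lemma measurable_coord i j :
  measurable_fun [set: 'M[T]_(m, n)] (fun M => M i j).
Proof.
by move=> _ B mB; rewrite setTI; apply: sub_sigma_algebra; exists i, j, B.
Qed.

Lemma measurable_fun_mx d' (S : measurableType d') (D : set S)
    (f : S -> 'M[T]_(m, n)) : measurable D ->
  (forall i j, measurable_fun D (fun x => f x i j)) -> measurable_fun D f.
Proof.
move=> mD mf.
apply: (@measurability _ _ _ _ D f (mx_cylinders (T := T) (m := m) (n := n))).
  by [].
by move=> _ [_ [i [j [B mB ->]]] <-]; exact: mf.
Qed.

End mx_measurable.

Section lebesgue_cV.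
Context {R : realType}.

Definition cV_cons n (xv : measurableTypeR R * 'cV[R]_n) : 'cV[R]_n.+1 :=
  col_mx (const_mx xv.1 : 'cV_1) xv.2.

Definition cV_uncons n (w : 'cV[R]_n.+1) : measurableTypeR R * 'cV[R]_n :=
  (w ord0 ord0, dsubmx (w : 'cV_(1 + n))).

Lemma cV_cons0 n xv j : @cV_cons n xv ord0 j = xv.1.
Proof.
transitivity (@cV_cons n xv (lshift n (ord0 : 'I_1)) j); last first.
  by rewrite (@col_mxEu R 1 n 1) mxE.
by congr (cV_cons _ _ _); exact/val_inj.
Qed.

Lemma cV_consS n xv i j : @cV_cons n xv (lift ord0 i) j = xv.2 i j.
Proof.
transitivity (@cV_cons n xv (rshift 1 i) j); last first.
  by rewrite (@col_mxEd R 1 n 1).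
by congr (cV_cons _ _ _); exact/val_inj.
Qed.

Lemma cV_consK n : cancel (@cV_cons n) (@cV_uncons n).
Proof.
move=> [x v]; rewrite /cV_uncons cV_cons0; congr pair.
exact: (@col_mxKd R 1 n 1).
Qed.

Lemma cV_unconsK n : cancel (@cV_uncons n) (@cV_cons n).
Proof.
move=> w; rewrite /cV_uncons /cV_cons /= -[RHS](@vsubmxK _ 1 n 1 w).
suff -> : const_mx (w ord0 ord0) = usubmx (w : 'cV_(1 + n)) by [].
apply/matrixP => i j; rewrite !mxE !ord1.
by congr (w _ _); exact/val_inj.
Qed.

Lemma measurable_cV_cons n : measurable_fun setT (@cV_cons n).
Proof.
apply: measurable_fun_mx => // i j.
have [k ->|->] := unliftP ord0 i.
  have mk : measurable_fun setT (fun xv : measurableTypeR R * 'cV[R]_n => xv.2 k j).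
    exact: (measurableT_comp (measurable_coord k j) measurable_snd).
  by apply: eq_measurable_fun mk => xv _; rewrite cV_consS.
have m1 : measurable_fun setT (fun xv : measurableTypeR R * 'cV[R]_n => xv.1).
  exact: measurable_fst.
by apply: eq_measurable_fun m1 => xv _; rewrite cV_cons0.
Qed.

Lemma measurable_cV_uncons n : measurable_fun setT (@cV_uncons n).
Proof.
apply: measurable_fun_pair; first exact: measurable_coord.
apply: measurable_fun_mx => // i j.
have mw : measurable_fun setT (fun w : 'cV[R]_n.+1 => w (rshift 1 i) j).
  exact: measurable_coord.
by apply: eq_measurable_fun mw => w _; rewrite mxE.
Qed.

Section step.
Context (n : nat) (mu : {sigma_finite_measure set 'cV[R]_n -> \bar R}).

Let leb1 : {sigma_finite_measure set (measurableTypeR R) -> \bar R} :=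
  lebesgue_measure.

Definition lebesgue_cons : set 'cV[R]_n.+1 -> \bar R :=
  pushforward (leb1 \x mu)%E (@cV_cons n).

Let lebesgue_cons0 : lebesgue_cons set0 = 0%E.
Proof. by rewrite /lebesgue_cons /pushforward preimage_set0 measure0. Qed.

Let lebesgue_cons_ge0 A : (0 <= lebesgue_cons A)%E.
Proof. exact: (measure_ge0 (leb1 \x mu)%E). Qed.

Let lebesgue_cons_sigma_additive : semi_sigma_additive lebesgue_cons.
Proof.
move=> F mF tF mUF.
have mcons A : measurable A -> measurable (@cV_cons n @^-1` A).
  by move=> mA; rewrite -[X in measurable X]setTI; exact: measurable_cV_cons.
rewrite /lebesgue_cons /pushforward preimage_bigcup.
apply: (@measure_semi_sigma_additive _ _ _ (leb1 \x mu)%E).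
- by move=> k; exact: mcons.
- apply/trivIsetP => /= i j _ _ ij; rewrite -preimage_setI.
  by move/trivIsetP : tF => /(_ _ _ _ _ ij) ->//; rewrite preimage_set0.
- by rewrite -preimage_bigcup; exact: mcons.
Qed.

HB.instance Definition _ := isMeasure.Build _ _ _ lebesgue_cons
  lebesgue_cons0 lebesgue_cons_ge0 lebesgue_cons_sigma_additive.

Let lebesgue_cons_sigma_finite : sigma_finite setT lebesgue_cons.
Proof.
(* The library's sigma-finiteness instance for products is shadowed by the
   one for subprobabilities, whence this direct proof. *)
have /sigma_finiteP[F [TF ndF Foo]] := sigma_finiteT leb1.
have /sigma_finiteP[G [TG ndG Goo]] := sigma_finiteT mu.
pose H k := F k `*` G k.
have TH : setT = \bigcup_k H k.
  apply/esym; rewrite -subTset => -[x v] _.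
  have [i _ Fix] : (\bigcup_i F i) x by rewrite -TF.
  have [j _ Gjv] : (\bigcup_j G j) v by rewrite -TG.
  exists (maxn i j) => //; split => /=.
    by move: x Fix; exact/subsetPset/ndF/leq_maxl.
  by move: v Gjv; exact/subsetPset/ndG/leq_maxr.
have mH k : measurable (H k) /\ ((leb1 \x mu)%E (H k) < +oo)%E.
  have [? ?] := Foo k; have [? ?] := Goo k.
  split; first exact: measurableX.
  by rewrite product_measure1E// lte_mul_pinfty// ge0_fin_numE.
exists (fun k => @cV_uncons n @^-1` H k).
  by rewrite -preimage_bigcup -TH preimage_setT.
move=> k; have [mHk Hkoo] := mH k; split.
  by rewrite -[X in measurable X]setTI; exact: measurable_cV_uncons.
rewrite /lebesgue_cons /pushforward -comp_preimage.
suff -> : @cV_uncons n \o @cV_cons n = id by [].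
by apply/funext => xv /=; rewrite cV_consK.
Qed.

HB.instance Definition _ :=
  @Measure_isSigmaFinite.Build _ _ _ lebesgue_cons lebesgue_cons_sigma_finite.

End step.

Fixpoint lebesgue_cV n : {sigma_finite_measure set 'cV[R]_n -> \bar R} :=
  match n with
  | 0 => (\d_(0 : 'cV[R]_0))%R
  | n'.+1 => lebesgue_cons (lebesgue_cV n')
  end.

Lemma measurable_box n (B : 'I_n -> set R) : (forall i, measurable (B i)) ->
  measurable [set v : 'cV[R]_n | forall i, B i (v i ord0)].
Proof.
move=> mB.
have -> : [set v : 'cV[R]_n | forall i, B i (v i ord0)] =
    \big[setI/setT]_(i <- index_enum 'I_n)
      ((fun v : 'cV[R]_n => v i ord0) @^-1` B i).
  rewrite -bigcap_seq; apply/seteqP; split => v /= vB i => [_|]; first exact: vB.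
  by apply: vB => /=; rewrite mem_index_enum.
apply: bigsetI_measurable => i _.
rewrite -[X in measurable X]setTI.
exact: (measurable_coord i ord0 measurableT (mB i)).
Qed.

Lemma lebesgue_cV_box n (B : 'I_n -> set R) : (forall i, measurable (B i)) ->
  lebesgue_cV n [set v : 'cV[R]_n | forall i, B i (v i ord0)] =
  (\prod_i lebesgue_measure (B i))%E.
Proof.
elim: n B => [|n IH] B mB.
  rewrite big_ord0 /= /dirac indicE mem_set//= => -[].
  by case.
rewrite big_ord_recl -IH//= /lebesgue_cons /pushforward.
have mB' : measurable [set v : 'cV[R]_n | forall i, B (lift ord0 i) (v i ord0)].
  exact: (measurable_box (fun i => mB (lift ord0 i))).
rewrite -(product_measure1E lebesgue_measure (lebesgue_cV n) (mB ord0) mB').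
congr (_ _); apply/seteqP; split => -[x v] /=.
  move=> H; split => [|i] /=; first by have := H ord0; rewrite cV_cons0.
  by have := H (lift ord0 i); rewrite cV_consS.
move=> [/= Bx Bv] i; have [j ->|->] := unliftP ord0 i.
  by rewrite cV_consS.
by rewrite cV_cons0.
Qed.

End lebesgue_cV.
Arguments lebesgue_cV {R} n.


Section function_spaces.
Context {R : realType}.

(* Euclidean (Frobenius) norm; the library norm on matrices is the sup norm. *)
Definition enorm m n (F : 'M[R]_(m, n)) : R :=
  Num.sqrt (\sum_i \sum_j F i j ^+ 2).

Context (d : nat).
Implicit Types U Omega : set 'cV[R]_d.

(* L^p(U) norm, by extending |f| by zero outside U. *)
Definition Lp_norm (p : R) U m n (f : 'cV[R]_d -> 'M[R]_(m, n)) : \bar R :=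
  'N[lebesgue_cV d]_p%:E[(fun x => (enorm (f x))%:E) \_ U].

Definition memLp (p : R) U m n (f : 'cV[R]_d -> 'M[R]_(m, n)) : Prop :=
  measurable_fun U f /\ (Lp_norm p U f < +oo)%E.

Definition basis_cV (j : 'I_d) : 'cV[R]_d := delta_mx j ord0.

Fixpoint Ck (k : nat) (f : 'cV[R]_d -> R) : Prop :=
  if k is k'.+1 then
    continuous f /\
    forall j, (forall x, derivable f x (basis_cV j)) /\
              Ck k' ('D_(basis_cV j) f)
  else continuous f.

Definition test_function Omega (phi : 'cV[R]_d -> R) : Prop :=
  let supp := closure [set x | phi x != 0] in
  [/\ forall k, Ck k phi, compact supp & supp `<=` Omega].

Definition weak_gradient Omega m (u : 'cV[R]_d -> 'cV[R]_m)
    (G : 'cV[R]_d -> 'M[R]_(m, d)) : Prop :=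
  forall phi, test_function Omega phi -> forall i j,
    \int[lebesgue_cV d]_(x in Omega) (u x i ord0 * 'D_(basis_cV j) phi x) =
    - \int[lebesgue_cV d]_(x in Omega) (G x i j * phi x).

Definition memW1p (p : R) Omega m (u : 'cV[R]_d -> 'cV[R]_m) : Prop :=
  memLp p Omega u /\
  exists G : 'cV[R]_d -> 'M[R]_(m, d),
    memLp p Omega G /\ weak_gradient Omega u G.

Definition Lp_cvg (p : R) U m (f : nat -> 'cV[R]_d -> 'cV[R]_m)
    (g : 'cV[R]_d -> 'cV[R]_m) : Prop :=
  [/\ forall n, memLp p U (f n), memLp p U g &
      Lp_norm p U (fun x => f n x - g x) @[n --> \oo] --> 0%E].

Definition compactly_contained U Omega : Prop :=
  compact (closure U) /\ closure U `<=` Omega.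

Definition Lploc_cvg_mod_cst (p : R) Omega m
    (f : nat -> 'cV[R]_d -> 'cV[R]_m) (g : 'cV[R]_d -> 'cV[R]_m) : Prop :=
  exists c : nat -> 'cV[R]_m,
    forall U, open U -> compactly_contained U Omega ->
      Lp_cvg p U (fun n x => f n x - c n) g.

(* Near each boundary point, in suitable orthonormal coordinates O w, Omega is
   the strict epigraph of a Lipschitz function of the d - 1 coordinates other
   than the i-th. *)
Definition lipschitz_boundary Omega : Prop :=
  forall x, (closure Omega `\` Omega°) x ->
    exists (O : 'M[R]_d) (i : 'I_d) (gamma : 'cV[R]_d.-1 -> R),
      [/\ O *m O^T = 1%:M, lipschitz gamma &
          \forall w \near x,
            Omega w <-> gamma (row' i (O *m w)) < (O *m w) i ord0].

End function_spaces.


Section lattice.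
Context {R : realType} (d : nat).
Variables (A : 'M[R]_d) (eps : R).
Implicit Types U : set 'cV[R]_d.

Definition lattice : set 'cV[R]_d :=
  range (fun k : 'cV[int]_d => eps *: (A *m map_mx intr k)).

Definition cell_at (z : 'cV[R]_d) : set 'cV[R]_d :=
  [set z + A *m t | t in [set t : 'cV[R]_d | forall i, 0 <= t i ord0 < eps]].

(* Q_eps(x) *)
Definition cell (x : 'cV[R]_d) : set 'cV[R]_d :=
  \bigcup_(z in [set z | lattice z /\ cell_at z x]) cell_at z.

(* L'_eps *)
Definition centers : set 'cV[R]_d :=
  [set z + eps *: (A *m const_mx 2^-1) | z in lattice].

(* L'_eps(U) *)
Definition centers_meeting U : set 'cV[R]_d :=
  [set x | centers x /\ closure (cell x) `&` U !=set0].

(* (L'_eps(U))^o *)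
Definition centers_inside U : set 'cV[R]_d :=
  [set x | centers x /\ closure (cell x) `<=` U].

(* B_eps(U) *)
Definition cellwise_constant U (y : 'cV[R]_d -> 'cV[R]_d) : Prop :=
  forall x, centers_meeting U x ->
    forall a b, (cell x `&` U) a -> (cell x `&` U) b -> y a = y b.

(* z_1, ..., z_{2^d} enumerate A {-1/2, 1/2}^d. *)
Definition enumerates_corners (z : 'I_(2 ^ d) -> 'cV[R]_d) : Prop :=
  injective z /\
  range z = [set A *m s | s in
    [set s : 'cV[R]_d | forall i, s i ord0 = - 2^-1 \/ s i ord0 = 2^-1]].

Variable z : 'I_(2 ^ d) -> 'cV[R]_d.

Definition discrete_gradient (y : 'cV[R]_d -> 'cV[R]_d) (x : 'cV[R]_d) :
    'M[R]_(d, 2 ^ d) :=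
  let ybar := 2 ^- d *: \sum_j y (x + eps *: z j) in
  \matrix_(i, j) (eps^-1 *: (y (x + eps *: z j) - ybar)) i ord0.

(* F_eps(y, U) *)
Definition energy (Wcell : 'M[R]_(d, 2 ^ d) -> R)
    (y : 'cV[R]_d -> 'cV[R]_d) U : \bar R :=
  if `[< cellwise_constant U y >] then
    ((eps ^+ d)%:E *
     \esum_(x in centers_inside U) (Wcell (discrete_gradient y x))%:E)%E
  else +oo%E.

End lattice.

(* V_0 *)
Definition zero_row_sums {R : realType} (d : nat) (F : 'M[R]_(d, 2 ^ d)) : Prop :=
  forall i, \sum_j F i j = 0.

(* Main.v *)
(* Away from the boundary of Omega the growth condition bounds the L^p norm of
   the discrete gradients.  A cellwise constant function jumps only across cell
   faces, so its translate by h differs from it in L^p by at most C(|h| + eps).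
   Averaging this bound over small h yields constants c_n for which y_n - c_n is
   locally bounded in L^p (connectedness carries the same c_n from ball to ball)
   and close to step functions with bounded values.  Along an ultrafilter the
   step functions converge, so y_n - c_n is Cauchy in L^p on compact subsets, and
   a subsequence converges to some u with |u(. + h) - u|_p <= C|h|.  Near a
   boundary point, u is compared with its translate into Omega along the axis of
   the Lipschitz chart, whence u is in L^p(Omega).  Its difference quotients are
   bounded in L^p; convex sets of functions that nearly act as the derivative
   on test functions shrink to the weak derivative, which is found by minimizing
   the strictly convex functional given by the integral of sqrt(1 + g^2). *)

From HB Require Import structures.
Require Import Defs.
From mathcomp Require Import all_boot all_order all_algebra.
From mathcomp Require Import all_classical all_reals all_analysis.
From mathcomp Require Import measurable_realfun lra ring zify.
Set Implicit Arguments.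
Unset Strict Implicit.
Unset Printing Implicit Defensive.
Import Order.TTheory GRing.Theory Num.Theory.
Import numFieldNormedType.Exports.
Local Open Scope classical_set_scope.
Local Open Scope ring_scope.

(** * Lebesgue measure on column vectors *)

Section lebesgue_cV_theory.
Context {R : realType}.

(** Cells that meet the boundary carry no energy. Every estimate on the discrete functions therefore
    lives on points that keep a distance from the complement of the domain, and a translation by h
    uses up a multiple of |h| + eps of that distance. This is why integrability up to the boundary
    is proved for the limit and not for the sequence.

    The energy controls differences and never values. The constant c_n is the value of y_n at a
    point found by averaging; on two components such values could drift apart.

    A single ultrafilter serves all balls and all accuracies at once, so no diagonal extraction is
    needed; the subsequence is chosen from its members at the end.

    For the derivative, [p > 1] prevents concentration: bounded difference quotients in L^1 could
    converge to a measure. Here it says that large values contribute little in L^1 once the p-th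
    powers are bounded.

    The sup norm is used on R^d, so that balls are cubes of known measure; all changes of norm cost
    constants only. *)

Lemma mx_norm_leP m n (M : 'M[R]_(m, n)) (r : R) : 0 <= r ->
  reflect (forall i j, `|M i j| <= r) (`|M| <= r).
Proof.
move=> r0; rewrite [`|M|]mx_normrE; apply: (iffP idP).
  by move=> /bigmax_leP[_ H] i j; exact: (H (i, j)).
by move=> H; apply/bigmax_leP; split.
Qed.

Lemma mx_norm_ltP m n (M : 'M[R]_(m, n)) (r : R) : 0 < r ->
  reflect (forall i j, `|M i j| < r) (`|M| < r).
Proof.
move=> r0; rewrite [`|M|]mx_normrE; apply: (iffP idP).
  by move=> /bigmax_ltP[_ H] i j; exact: (H (i, j)).
by move=> H; apply/bigmax_ltP; split.
Qed.

Lemma ler_mx_norm m n (M : 'M[R]_(m, n)) i j : `|M i j| <= `|M|.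
Proof. exact: (mx_norm_leP M (normr_ge0 M) (lexx _)). Qed.

Lemma ball_cVE d (x : 'cV[R]_d) (r : R) : 0 < r ->
  ball x r = [set v : 'cV[R]_d | forall i, ball (x i ord0) r (v i ord0)].
Proof.
move=> r0; apply/seteqP; split => v /=.
  by move=> [_ H] i; exact: H.
by move=> H; split => // i j; rewrite !ord1.
Qed.

Lemma measurable_ball_cV d (x : 'cV[R]_d) (r : R) : measurable (ball x r).
Proof.
have [r0|r0] := ltP 0 r; last first.
  suff -> : ball x r = set0 by [].
  by apply/seteqP; split => // v /= [r0']; rewrite ltNge r0 in r0'.
rewrite ball_cVE//; apply: (measurable_box (B := fun i => ball (x i ord0) r)).
by move=> i; by apply: open_measurable; exact: ball_open.
Qed.

(** The sigma-algebra is generated by the entries, so an open set has to be written as a countable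
    union of boxes: the balls with rational centre and radius [1 / (k + 1)] that it contains. *)
Lemma open_measurable_cV d (U : set 'cV[R]_d) : open U -> measurable U.
Proof.
move=> oU.
pose F (qk : 'cV[rat]_d * nat) : set 'cV[R]_d :=
  if `[< ball (map_mx ratr qk.1 : 'cV[R]_d) (qk.2.+1%:R^-1 : R) `<=` U >]
  then ball (map_mx ratr qk.1 : 'cV[R]_d) (qk.2.+1%:R^-1 : R) else set0.
suff -> : U = \bigcup_qk F qk.
  apply: countable_bigcupT_measurable => [|qk]; [exact: countableP|rewrite /F; case: ifP => // _; exact: measurable_ball_cV].
apply/seteqP; split => [x Ux|x [qk _]]; last by rewrite /F; case: ifPn => // /asboolP H /H.
have /nbhs_ballP[e /= e0 xeU] : nbhs x U by exact: open_nbhs_nbhs.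
(* With a radius below half of [e], a ball whose rational centre is closer to [x] than that radius
   stays inside [ball x e]. *)
have [k kE] : exists k, (k.+1%:R^-1 : R) < e / 2.
  have [k _ H] := near_infty_natSinv_lt (PosNum (divr_gt0 e0 (ltr0n R 2))).
  by exists k; apply: H => /=.
move sE : (k.+1%:R^-1 : R) kE => s ks.
have s0 : 0 < s by rewrite -sE invr_gt0.
have qP i : exists q : rat, ratr q \in `](x i ord0 - s), (x i ord0 + s)[.
  by apply: rat_in_itvoo; lra.
pose q : 'cV[rat]_d := \col_i projT1 (cid (qP i)).
have qx i : `|x i ord0 - ratr (q i ord0)| < s.
  rewrite mxE; case: cid => /= r; rewrite in_itv/= => /andP[? ?].
  by rewrite ltr_norml; apply/andP; split; lra.
exists (q, k) => //; rewrite /F /= sE ifT.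
  rewrite ball_cVE// => i /=; rewrite mxE /ball/= distrC; exact: qx.
apply/asboolP => v /= qv; apply: xeU => /=.
rewrite ball_cVE// => i; rewrite /ball/=.
move: qv; rewrite ball_cVE//= => /(_ i); rewrite mxE /ball/= => qv.
apply: (@le_lt_trans _ _ (`|x i ord0 - ratr (q i ord0)| + `|ratr (q i ord0) - v i ord0|)).
  by rewrite (le_trans _ (ler_normD _ _))// addrA subrK.
by have := qx i; lra.
Qed.

Lemma closed_measurable_cV d (U : set 'cV[R]_d) : closed U -> measurable U.
Proof.
by move=> cU; rewrite -(setCK U); apply: measurableC; apply: open_measurable_cV; exact: closed_openC.
Qed.

Lemma continuous_measurable_cV d (f : 'cV[R]_d -> R) : continuous f ->
  measurable_fun setT f.
Proof.
move=> cf; apply: (measurability _ (RGenOpens.measurableE R)).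
move=> _ [_ [a [b ->]] <-]; rewrite setTI; apply: open_measurable_cV.
by move/continuousP : cf; apply; exact: interval_open.
Qed.

(** Heine-Borel for row vectors, carried over by the transpose, which is continuous in both
    directions and preserves the sup norm. *)
Lemma compact_cV d (K : set 'cV[R]_d) : bounded_set K -> closed K -> compact K.
Proof.
move=> bK cK.
have -> : K = trmx @` (trmx @^-1` K).
  by apply/seteqP; split => [x Kx|_ [x /= Kx <-]//]; exists x^T; rewrite /= ?trmxK.
have ctr m n : continuous (trmx : 'M[R]_(m, n) -> 'M[R]_(n, m)).
  move=> x; have FF := nbhs_filter x; apply/cvg_ballP => e e0.
  apply: filterS (nbhsx_ballx x _ e0) => y [_ H].
  by split => // i j; rewrite !mxE; exact: H.
apply: continuous_compact; first by exact/continuous_subspaceT/ctr.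
apply: bounded_closed_compact; last by apply: closed_comp => // x _; exact: ctr.
case: bK => M [Mr H]; exists M; split => // t Mt x /= Kx.
have := H _ Mt _ Kx; rewrite !/(`|_|) /=.
have t0 : 0 <= t by rewrite (le_trans _ (H _ Mt _ Kx)).
move=> Hx; apply/mx_norm_leP => // i j.
by move/mx_norm_leP : Hx => /(_ t0 j i); rewrite mxE.
Qed.

End lebesgue_cV_theory.

Section translation.
Context {R : realType} (d : nat).
Notation mu := (@lebesgue_cV R d).

Lemma measurable_addr_cV (h : 'cV[R]_d) : measurable_fun setT (fun x : 'cV[R]_d => x + h).
Proof.
apply: measurable_fun_mx => // i j.
under [X in measurable_fun _ X]eq_fun do rewrite mxE.
by apply: measurable_funD => //; exact: measurable_coord.
Qed.

Lemma measurable_add_cV :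
  measurable_fun setT (fun xh : 'cV[R]_d * 'cV[R]_d => xh.1 + xh.2).
Proof.
apply: measurable_fun_mx => // i j.
under [X in measurable_fun _ X]eq_fun do rewrite mxE.
apply: measurable_funD.
  exact: (measurableT_comp (measurable_coord i j) measurable_fst).
exact: (measurableT_comp (measurable_coord i j) measurable_snd).
Qed.

Lemma measurable_norm_cV : measurable_fun setT (fun x : 'cV[R]_d => `|x|).
Proof. by apply: continuous_measurable_cV => x; exact: norm_continuous. Qed.

Lemma lebesgue_measure_shift (a : R) (B : set (measurableTypeR R)) : measurable B ->
  lebesgue_measure ((fun x => x + a) @^-1` B) = lebesgue_measure B.
Proof.
move=> mB.
have mf : measurable_fun setT (fun x : measurableTypeR R => (x + a : measurableTypeR R)).
  by apply: measurable_funD.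
pose f : {mfun measurableTypeR R >-> measurableTypeR R} :=
  HB.pack (fun x : measurableTypeR R => (x + a : measurableTypeR R)) (isMeasurableFun.Build _ _ _ _ _ mf).
symmetry; apply: (@lebesgue_measure_unique R (pushforward lebesgue_measure f)) => //.
move=> _ [[b c]] _ <-; rewrite /pushforward.
rewrite [X in _ = lebesgue_measure X](_ : _ = `]b - a, c - a]%classic).
  rewrite !lebesgue_measure_itv/= !lte_fin ltrD2r.
  by case: ifP => // _; rewrite !EFinB; congr (_%:E); ring.
by apply/seteqP; split => x /=; rewrite !in_itv/= => /andP[? ?]; apply/andP; split; lra.
Qed.

(** Boxes generate the sigma-algebra and are stable under intersection, and the cubes [g k] exhaust
    the space with finite measure. Measures that agree on boxes are therefore equal, and on a box a
    translation acts factor by factor. *)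
Lemma lebesgue_cV_shift (h : 'cV[R]_d) (A : set 'cV[R]_d) : measurable A ->
  mu ((fun x => x + h) @^-1` A) = mu A.
Proof.
move=> mA.
pose G : set (set 'cV[R]_d) := [set A | exists2 B : 'I_d -> set (measurableTypeR R),
  forall i, measurable (B i) & A = [set v : 'cV[R]_d | forall i, B i (v i ord0)]].
pose g k : set 'cV[R]_d := [set v : 'cV[R]_d | forall i, `]- (k%:R : R), k%:R[%classic (v i ord0)].
have mG : @measurable _ 'cV[R]_d = <<s G >>.
  apply/seteqP; split => [B mB|B].
    apply: (@smallest_sub _ (sigma_algebra setT) (mx_cylinders (T := measurableTypeR R) (m := d) (n := 1)) <<s G>>) mB => //.
    move=> _ [i [j [B0 mB0 ->]]]; have -> : j = ord0 by exact: ord1.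
    apply: sub_sigma_algebra.
    exists (fun k => if k == i then B0 else setT) => [k|]; first by case: ifP.
    apply/seteqP; split => M /=.
      by move=> B0M k; case: eqP => // ->.
    by move=> /(_ i); rewrite eqxx.
  apply: smallest_sub; first exact: sigma_algebra_measurable.
  by move=> _ [B0 mB0 ->]; exact: measurable_box.
pose f : {mfun 'cV[R]_d >-> 'cV[R]_d} :=
  HB.pack (fun x : 'cV[R]_d => x + h) (isMeasurableFun.Build _ _ _ _ _ (measurable_addr_cV h)).
symmetry; apply: (@measure_unique _ R _ G g mG _ _ _ mu (pushforward mu f)) => //.
- move=> _ _ [B1 m1 ->] [B2 m2 ->]; exists (fun i => B1 i `&` B2 i).
    by move=> i; exact: measurableI.
  by apply/seteqP; split => v /=; [move=> [H1 H2] i; split|move=> H; split=> i; have [] := H i].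
- by move=> k; exists (fun=> `]- (k%:R : R), k%:R[%classic).
- apply/seteqP; split => // v _; exists (Num.truncn `|v|).+1 => //= i.
  suff : v i ord0 \in `]- ((Num.truncn `|v|).+1%:R : R), (Num.truncn `|v|).+1%:R[ by [].
  rewrite in_itv/= -ltr_norml (le_lt_trans (ler_mx_norm _ _ _))//.
  exact: truncnS_gt.
- move=> _ [B mB ->]; rewrite /pushforward; etransitivity; first exact: lebesgue_cV_box.
  have E : [set v : 'cV[R]_d | forall i, ((fun x => x + h i ord0) @^-1` B i) (v i ord0)] =
      f @^-1` [set v | forall i, B i (v i ord0)].
    by apply/seteqP; split => v /= H i; have := H i; rewrite mxE.
  etransitivity; last exact: (congr1 (@lebesgue_cV R d) E).
  rewrite (lebesgue_cV_box (B := fun i => (fun x => x + h i ord0) @^-1` B i)) => [|i].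
    by apply: eq_bigr => i _; rewrite lebesgue_measure_shift.
  rewrite -[X in measurable X]setTI.
  have mf : measurable_fun setT (fun x : measurableTypeR R => x + h i ord0) by exact: measurable_funD.
  exact: (mf measurableT _ (mB i)).
- move=> k; pose J : set (measurableTypeR R) := `]- (k%:R : R), k%:R[%classic.
  have E : mu (g k) = (\prod_(i < d) lebesgue_measure J)%E.
    by apply: (lebesgue_cV_box (B := fun=> J)) => i; exact: measurable_itv.
  apply: (@eq_ind_r _ _ (fun x => (x < +oo)%E) _ _ E).
  suff : (\prod_(i < d) lebesgue_measure J)%E \is a fin_num.
    by rewrite fin_numElt => /andP[].
  apply: (big_ind (fun x => x \is a fin_num)) => //; first exact: fin_numM.
  by move=> i _; rewrite /J lebesgue_measure_itv/=; case: ifP.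
Qed.

End translation.

Section integral_translation.
Context {R : realType} (d : nat).
Notation mu := (@lebesgue_cV R d).

Lemma ge0_integral_shift (h : 'cV[R]_d) (D : set 'cV[R]_d) (f : 'cV[R]_d -> \bar R) :
  measurable D -> measurable_fun setT f -> (forall x, 0 <= f x)%E ->
  (\int[mu]_(x in (fun x => (x + h)%R) @^-1` D) f (x + h)%R = \int[mu]_(x in D) f x)%E.
Proof.
move=> mD mf f0; symmetry.
rewrite -[RHS](@ge0_integral_pushforward _ _ _ _ _ _ (measurable_addr_cV h) mu D f)//.
- pose g : {mfun 'cV[R]_d >-> 'cV[R]_d} :=
    HB.pack (fun x : 'cV[R]_d => x + h) (isMeasurableFun.Build _ _ _ _ _ (measurable_addr_cV h)).
  apply: (@eq_measure_integral _ _ _ D (pushforward mu g) mu f) => A mA _.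
  symmetry; exact: lebesgue_cV_shift.
- exact: measurable_funTS.
Qed.

Lemma lebesgue_cV_ball (x : 'cV[R]_d) (r : R) : 0 < r ->
  mu (ball x r) = ((2 * r) ^+ d)%:E.
Proof.
move=> r0; rewrite ball_cVE// (lebesgue_cV_box (B := fun i => ball (x i ord0) r)).
  under eq_bigr do rewrite lebesgue_measure_ball ?ltW//.
  rewrite prodEFin prodr_const card_ord; congr (_ ^+ _)%:E.
  by rewrite mulr_natl.
by move=> i; apply: open_measurable; exact: ball_open.
Qed.

Lemma lebesgue_cV_bounded (D : set 'cV[R]_d) : measurable D -> bounded_set D ->
  (mu D < +oo)%E.
Proof.
move=> mD [M [Mr H]].
have M1 : 0 < `|M| + 1 by rewrite ltr_wpDl.
apply: (@le_lt_trans _ _ (mu (ball 0 (`|M| + 2)))).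
  apply: le_measure; rewrite ?inE//; first exact: measurable_ball_cV.
  move=> v Dv; rewrite -ball_normE /ball_/= sub0r normrN.
  apply: (@le_lt_trans _ _ (`|M| + 1)); last by rewrite ltrD2l ltr1n.
  by apply: H => //; rewrite (le_lt_trans (ler_norm M))// ltrDl.
by rewrite lebesgue_cV_ball ?ltry// ltr_wpDl.
Qed.

End integral_translation.

(** * Integral bounds and completeness of L^p *)

Section Lp_bounds.
Context d (T : measurableType d) {R : realType} (mu : {measure set T -> \bar R}).
Variables (p : R) (p_ge1 : 1 <= p).
Implicit Types (V W : set T) (f g h : T -> R) (a b : R).

Let p_gt0 : 0 < p. Proof. exact: lt_le_trans p_ge1. Qed.

(* The L^p(V) norm of g is at most a, for a >= 0 (see NleP). *)
Definition Nle V g a := (\int[mu]_(x in V) (`|g x| `^ p)%:E <= (a `^ p)%:E)%E.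

Lemma measurable_normpow g : measurable_fun setT g ->
  measurable_fun setT (fun x => (`|g x| `^ p)%:E).
Proof.
move=> mg; apply/measurable_EFinP.
apply: (measurableT_comp (measurable_powR p)).
exact: (measurableT_comp (@normr_measurable R setT)).
Qed.

Lemma measurable_normpowS V g : measurable_fun setT g ->
  measurable_fun V (fun x => (`|g x| `^ p)%:E).
Proof. by move=> /measurable_normpow; apply: measurable_funS. Qed.

(** Three monotonicities (smaller set, smaller modulus, larger bound) in one statement, because they
    are often needed together. *)
Lemma Nle_mono V W h f a b : measurable V -> measurable W ->
  measurable_fun setT h -> measurable_fun setT f -> V `<=` W ->
  (forall x, V x -> `|h x| <= `|f x|) -> 0 <= a <= b -> Nle W f a -> Nle V h b.
Proof.
move=> mV mW mh mf VW hf /andP[a0 ab]; rewrite /Nle => H.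
apply: (@le_trans _ _ (\int[mu]_(x in V) (`|f x| `^ p)%:E)%E).
  apply: ge0_le_integral => //.
  - exact: measurable_normpowS.
  - exact: measurable_normpowS.
  - by move=> x Vx; rewrite lee_fin; apply: ge0_ler_powR (hf _ Vx); rewrite ?nnegrE// ltW.
apply: (@le_trans _ _ (a `^ p)%:E).
  apply: le_trans H; apply: ge0_subset_integral => //.
  - exact: measurable_normpowS.
have b0 : 0 <= b by exact: le_trans ab.
by rewrite lee_fin; apply: ge0_ler_powR ab => //; exact: ltW.
Qed.

Let powK a : 0 <= a -> ((a `^ p) `^ p^-1 = a)%R.
Proof. by move=> a0; rewrite -powRrM mulfV ?powRr1// gt_eqF. Qed.

Lemma NleP V g a : measurable V -> measurable_fun setT g -> 0 <= a ->
  Nle V g a <-> ('N[mu]_(p%:E)[EFin \o (g \_ V)] <= a%:E)%E.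
Proof.
move=> mV mg a0; rewrite /Nle unlock.
have -> : (\int[mu]_x (`|(EFin \o g \_ V) x| `^ p))%E = (\int[mu]_(x in V) (`|g x| `^ p)%:E)%E.
  rewrite [RHS]integral_mkcond; apply: eq_integral => x _ /=.
  rewrite !patchE; case: ifPn => _; first by rewrite -poweR_EFin -abse_EFin.
  by rewrite -[point]/(0 : R) normr0 powR0 ?gt_eqF.
have I0 : (0 <= \int[mu]_(x in V) (`|g x| `^ p)%:E)%E.
  by apply: integral_ge0 => x _; rewrite lee_fin powR_ge0.
split => H.
  rewrite -(powK a0) -poweR_EFin.
  by apply: gt0_ler_poweR; rewrite ?invr_ge0 ?(ltW p_gt0) ?in_itv/= ?I0 ?leey ?lee_fin ?powR_ge0.
rewrite -poweR_EFin -[leLHS]poweRe1//.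
rewrite -(@mulVf _ p) ?gt_eqF// poweRrM.
apply: (gt0_ler_poweR (ltW p_gt0)); last exact: H.
  by rewrite in_itv/= poweR_ge0 leey.
by rewrite in_itv/= lee_fin a0 leey.
Qed.

Lemma NleD V f g h a b : measurable V ->
  measurable_fun setT f -> measurable_fun setT g -> measurable_fun setT h ->
  (forall x, V x -> `|h x| <= `|f x| + `|g x|) -> 0 <= a -> 0 <= b ->
  Nle V f a -> Nle V g b -> Nle V h (a + b).
Proof.
move=> mV mf mg mh hfg a0 b0 Hf Hg.
pose f' x := `|f x|; pose g' x := `|g x|.
have mf' : measurable_fun setT f' by exact: (measurableT_comp (@normr_measurable R setT)).
have mg' : measurable_fun setT g' by exact: (measurableT_comp (@normr_measurable R setT)).
have mfg : measurable_fun setT (fun x => f' x + g' x) by exact: measurable_funD.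
apply: (@Nle_mono V V h (fun x => f' x + g' x) (a + b)) => //.
- by move=> x Vx; rewrite (le_trans (hfg _ Vx))// ler_norm.
- by rewrite lexx addr_ge0.
have {}Hf : Nle V f' a by rewrite /Nle; under eq_integral do rewrite normr_id.
have {}Hg : Nle V g' b by rewrite /Nle; under eq_integral do rewrite normr_id.
apply/NleP; rewrite ?addr_ge0//.
move/NleP : Hf => /(_ mV mf' a0) Hf; move/NleP : Hg => /(_ mV mg' b0) Hg.
rewrite EFinD; apply: le_trans (leeD Hf Hg).
have -> : (fun x => f' x + g' x) \_ V = (f' \_ V) \+ (g' \_ V).
  by apply/funext => x /=; rewrite !patchE; case: ifP; rewrite ?addr0.
apply: minkowski_EFin => //; apply/(measurable_restrictT _ _).1 => //; exact: measurable_funTS.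
Qed.

Lemma NleZ V f k a : measurable V -> measurable_fun setT f -> 0 <= a ->
  Nle V f a -> Nle V (fun x => k * f x) (`|k| * a).
Proof.
move=> mV mf a0 H; rewrite /Nle.
under eq_integral do rewrite normrM powRM// EFinM.
rewrite ge0_integralZl_EFin ?powR_ge0//.
- by rewrite powRM// EFinM lee_wpmul2l// lee_fin powR_ge0.
- exact: measurable_normpowS.
Qed.

Lemma Nle_cst V (k m : R) : measurable V -> (mu V <= m%:E)%E ->
  (\int[mu]_(x in V) (`|k| `^ p)%:E <= (`|k| `^ p * m)%:E)%E.
Proof.
by move=> mV Vm; rewrite integral_cst// EFinM lee_wpmul2l// lee_fin powR_ge0.
Qed.

(** Fatou's lemma in the form needed for passages to the limit: a bound that holds from some index
    on survives almost everywhere convergence, without domination. *)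
Lemma fatou_ae V (g : nat -> T -> \bar R) (f : T -> \bar R) (C : \bar R) :
  measurable V -> (forall n, measurable_fun setT (g n)) -> measurable_fun setT f ->
  (forall n x, 0 <= g n x)%E -> (forall x, 0 <= f x)%E ->
  {ae mu, forall x, V x -> g ^~ x @ \oo --> f x} ->
  (\forall n \near \oo, \int[mu]_(x in V) g n x <= C)%E ->
  (\int[mu]_(x in V) f x <= C)%E.
Proof.
move=> mV mg mf g0 f0 gf gC.
have mgV n : measurable_fun V (g n) by exact: measurable_funTS.
apply: (@le_trans _ _ (\int[mu]_(x in V) limn_einf (g ^~ x))%E).
  apply: ae_ge0_le_integral => //.
  - exact: measurable_funTS.
  - move=> x _; rewrite limn_einf_lim; apply: lime_ge; first exact: is_cvg_einfs.
    by apply: nearW => n; apply: le_ereal_inf_tmp => _ [m _ <-].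
  - rewrite /limn_einf; apply: (measurableT_comp (@oppe_measurable R setT)).
    apply: measurable_fun_limn_esup => n; apply: (measurableT_comp (@oppe_measurable R setT)).
    exact: mgV.
  - by apply: filterS gf => x H Vx; have /cvg_limn_einf_sup[-> _] := H Vx.
apply: le_trans (fatou mu mV mgV (fun n x _ => g0 n x)) _.
case: gC => N _ HN.
rewrite limn_einf_lim; apply: lime_le; first exact: is_cvg_einfs.
apply: nearW => n; apply: le_trans (HN (maxn n N) _); last exact: leq_maxr.
by apply: ereal_inf_lbound; exists (maxn n N) => //=; exact: leq_maxl.
Qed.

End Lp_bounds.

(** If [P K] fails, the sets [B] with [P (K \ B)] form a proper filter containing [K]. At a cluster
    point of it the hypothesis gives a neighbourhood [A] with [P A], so the complement of [A]
    belongs to the filter, which is absurd. *)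
Lemma compact_ind (T : topologicalType) (K : set T) (P : set T -> Prop) :
  compact K -> P set0 -> (forall A B, P A -> P B -> P (A `|` B)) ->
  (forall A B, B `<=` A -> P A -> P B) ->
  (forall x, K x -> exists2 A, nbhs x A & P A) -> P K.
Proof.
move=> cK P0 PU PS Pnbhs; apply: contrapT => nPK.
pose F : set (set T) := [set B | P (K `\` B)].
have FF : ProperFilter F.
  split; first by rewrite /F/= setD0.
  split; first by rewrite /F/= setDT.
  - by move=> A B PA PB; rewrite /F/= setDIr; exact: PU.
  - by move=> A B AB; apply: PS => x [Kx nBx]; split => // /AB.
have FK : F K by rewrite /F/= setDv.
have [x [Kx Fx]] := cK F FF FK.
have [A nA PA] := Pnbhs _ Kx.
have FA : F (~` A) by rewrite /F/= setDE setCK; apply: PS PA => y [].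
by have [y []] := Fx _ _ FA nA.
Qed.

Section vector_convergence.
Context {R : realType}.

Lemma cvg_cV (m : nat) (a : nat -> 'cV[R]_m) (l : 'cV[R]_m) :
  (forall i, (fun n => a n i ord0) @ \oo --> l i ord0) -> a @ \oo --> l.
Proof.
move=> H; apply/cvgrPdist_lt => e e0.
have : \forall n \near \oo, forall i, `|l i ord0 - a n i ord0| < e.
  by apply: filter_forall => i; move/cvgrPdist_lt : (H i); apply.
apply: filterS => n Hn; apply/mx_norm_ltP => // i j.
by rewrite ord1 !mxE.
Qed.

Lemma geometric_cvg (a : nat -> R) (M : R) :
  (forall n, `|a n.+1 - a n| <= M / 2 ^+ n) -> cvgn a.
Proof.
move=> H; have M0 : 0 <= M by have := H 0%N; rewrite expr0 divr1; exact: le_trans.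
suff : cvgn (series (telescope a)).
  move=> ct; have -> : a = (fun n => a 0%N + series (telescope a) n).
    by apply/funext => n; rewrite [LHS]eq_sum_telescope.
  by apply: is_cvgD => //; exact: is_cvg_cst.
apply: normed_cvg.
apply: (@series_le_cvg _ _ (geometric M 2^-1)) => [n|n|n|].
- by rewrite /= normr_ge0.
- by rewrite /= mulr_ge0// exprn_ge0// invr_ge0.
- by rewrite /= exprVn; exact: H.
- by apply: is_cvg_geometric_series; rewrite ger0_norm ?invr_ge0// invf_lt1// ltr1n.
Qed.

Lemma cvg_powR (p : R) (a : nat -> R) (l : R) : 1 <= p -> (forall n, 0 <= a n) ->
  a @ \oo --> l -> (fun n => a n `^ p) @ \oo --> l `^ p.
Proof.
move=> p1 a0 al; have p0 : 0 < p by exact: lt_le_trans p1.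
have [l0|l0] := ltP 0 l.
  have cl : {for l, continuous (fun x => x `^ p)}.
    apply: differentiable_continuous; apply/derivable1_diffP.
    by apply: derivable_powR; rewrite in_itv/= l0.
  exact: (cvg_comp _ _ al cl).
have {}l0 : l = 0.
  apply/eqP; rewrite eq_le l0/=; have <- : limn a = l by exact/cvg_lim.
  by apply: limr_ge; [apply/cvg_ex; exists l|exact: nearW].
rewrite l0 powR0 ?gt_eqF//; move: al; rewrite l0 => al.
(* The differentiability used above requires a positive point. At 0, once [a n < 1], the power lies
   between 0 and [a n] because [p >= 1]. *)
have : \forall n \near \oo, a n < 1.
  by move/cvgrPdist_lt : al => /(_ 1 ltr01); apply: filterS => n; rewrite sub0r normrN ger0_norm.
move=> al1; apply: (@squeeze_cvgr _ _ _ _ (cst 0) a) => //; last exact: cvg_cst.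
apply: filterS al1 => n an1; rewrite powR_ge0/=.
have [->|an0] := eqVneq (a n) 0; first by rewrite powR0// gt_eqF.
by apply: ge1r_powR => //; rewrite lt_neqAle eq_sym an0 a0 ltW.
Qed.

Context d (T : measurableType d).

Lemma measurable_funD_cV m (f g : T -> 'cV[R]_m) : measurable_fun setT f ->
  measurable_fun setT g -> measurable_fun setT (fun x => f x + g x).
Proof.
move=> mf mg.
exact: (measurableT_comp (@measurable_add_cV R m) (measurable_fun_pair mf mg)).
Qed.

Lemma measurable_funN_cV m (f : T -> 'cV[R]_m) : measurable_fun setT f ->
  measurable_fun setT (fun x => - f x).
Proof.
move=> mf; apply: measurable_fun_mx => // i j.
under [X in measurable_fun _ X]eq_fun do rewrite mxE.
apply: measurable_funN.
exact: (measurableT_comp (measurable_coord i j) mf).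
Qed.

Lemma measurable_funB_cV m (f g : T -> 'cV[R]_m) : measurable_fun setT f ->
  measurable_fun setT g -> measurable_fun setT (fun x => f x - g x).
Proof. by move=> mf mg; apply: measurable_funD_cV => //; exact: measurable_funN_cV. Qed.

Lemma measurable_norm_funB m (f g : T -> 'cV[R]_m) : measurable_fun setT f ->
  measurable_fun setT g -> measurable_fun setT (fun x => `|f x - g x|).
Proof.
move=> mf mg.
exact: (measurableT_comp (@measurable_norm_cV R m) (measurable_funB_cV mf mg)).
Qed.

End vector_convergence.

Section completion.
Context d (T : measurableType d) {R : realType} (mu : {measure set T -> \bar R}).
Variables (p : R) (p_ge1 : 1 <= p) (m : nat).
Variables (f : nat -> T -> 'cV[R]_m) (K : nat -> set T).
Hypothesis mf : forall n, measurable_fun setT (f n).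
Hypothesis mK : forall j, measurable (K j).
Hypothesis ndK : forall i j, (i <= j)%N -> K i `<=` K j.
Hypothesis fcauchy : forall j i n, (j <= i)%N -> (j <= n)%N ->
  Nle mu p (K j) (fun x => `|f n x - f i x|) ((4^-1) ^+ j).

Let p0 : 0 < p. Proof. exact: lt_le_trans p_ge1. Qed.

(** The integral of [g j] is at most [(2 ^ j / 4 ^ j) ^ p <= 2 ^- j], so the sum of the [g j] is
    finite almost everywhere and its terms are bounded there. The rate [4 ^- j] is split: one factor
    [2 ^- j] makes the series converge, the other remains as decay of the increments. *)
Let ae_bound J : {ae mu, forall x, K J x ->
  exists M, forall j, `|f (J + j).+1 x - f (J + j) x| <= M / 2 ^+ j}.
Proof.
pose g j x := ((2 ^+ j * `|f (J + j).+1 x - f (J + j) x|) `^ p)%:E.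
have mg j : measurable_fun setT (g j).
  apply/measurable_EFinP; apply: (measurableT_comp (measurable_powR p)).
  by apply: measurable_funM => //; exact: measurable_norm_funB.
have mgJ j : measurable_fun (K J) (g j) by exact: measurable_funTS.
have g0 j x : (0 <= g j x)%E by rewrite lee_fin powR_ge0.
have Ig : (\int[mu]_(x in K J) (\sum_(j <oo) g j x) < +oo)%E.
  rewrite integral_nneseries//.
  apply: (@le_lt_trans _ _ (2 / 2 ^+ 0)%:E); last exact: ltry.
  rewrite -(cvg_lim _ (@cvg_geometric_eseries_half R 2 0))//.
  apply: lee_nneseries => [j _ _|j _]; first exact: integral_ge0.
  have := @NleZ _ _ _ mu p (K J) (fun x => `|f (J + j).+1 x - f (J + j) x|) (2 ^+ j) (4^-1 ^+ j).
  have H : Nle mu p (K J) (fun x => `|f (J + j).+1 x - f (J + j) x|) (4^-1 ^+ j).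
    apply: (@Nle_mono _ _ _ mu p p_ge1 (K J) (K (J + j)) _ _ ((4^-1) ^+ (J + j))) (fcauchy _ _) => //.
    + exact: measurable_norm_funB.
    + exact: measurable_norm_funB.
    + by apply: ndK; exact: leq_addr.
    + rewrite exprn_ge0 ?invr_ge0//= exprD ler_piMl ?exprn_ge0 ?invr_ge0//.
      by rewrite exprn_ile1 ?invr_ge0// invf_le1// ler1n.
  move=> /(_ (mK J) (measurable_norm_funB (mf _) (mf _))).
  have a0 : 0 <= 4^-1 ^+ j :> R by rewrite exprn_ge0// invr_ge0.
  move=> /(_ a0 H); rewrite /Nle => HZ.
  apply: le_trans (le_trans _ HZ) _.
    rewrite le_eqVlt; apply/orP; left; apply/eqP; apply: eq_integral => x _.
    by rewrite /g [in RHS]ger0_norm// mulr_ge0// exprn_ge0.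
  rewrite lee_fin ger0_norm ?exprn_ge0// -exprMn.
  have -> : 2 * 4^-1 = 2^-1 :> R by lra.
  rewrite addn1 natrX exprS invfM mulrA divff// mul1r -exprVn.
  apply: ge1r_powR => //; rewrite exprn_gt0 ?invr_gt0//= exprn_ile1 ?invr_ge0//.
  by rewrite invf_le1// ler1n.
have : {ae mu, forall x, K J x -> (\sum_(j <oo) g j x)%E \is a fin_num}.
  apply: integrable_ae => //; apply/integrableP; split.
    by apply: ge0_emeasurable_sum => // j x _ _; exact: g0.
  under eq_integral do rewrite gee0_abs ?nneseries_ge0//.
  exact: Ig.
apply: filterS => x Hx KJx; have {}Hx := Hx KJx.
exists (1 + fine (\sum_(j <oo) g j x)%E) => j.
have gS : (g j x <= \sum_(j <oo) g j x)%E.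
  rewrite (nneseriesD1 (n := j))//; first by rewrite leeDl// nneseries_ge0.
have S0 : 0 <= fine (\sum_(j <oo) g j x)%E by apply: fine_ge0; exact: nneseries_ge0.
rewrite ler_pdivlMr ?exprn_gt0// mulrC.
set t := 2 ^+ j * _.
have t0 : 0 <= t by rewrite mulr_ge0// exprn_ge0.
have tS : t `^ p <= fine (\sum_(j <oo) g j x)%E by rewrite -lee_fin fineK.
have [t1|/ltW t1] := leP t 1; first by rewrite (le_trans t1)// lerDl.
by rewrite (le_trans (le1r_powR t1 p_ge1))// (le_trans tS)// lerDr.
Qed.

(** Taking the upper limit of each coordinate gives a function measurable everywhere, whatever
    happens on the exceptional null set; it is the limit wherever the increments decay
    geometrically. Fatou's lemma in the second index turns the Cauchy bound into a bound against
    [u]. *)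
Lemma Lp_completion : exists2 u : T -> 'cV[R]_m, measurable_fun setT u &
  {ae mu, forall x, (\bigcup_j K j) x -> f ^~ x @ \oo --> u x} /\
  (forall j n, (j <= n)%N -> Nle mu p (K j) (fun x => `|f n x - u x|) ((4^-1) ^+ j)).
Proof.
pose u x : 'cV[R]_m := \col_i fine (limn_esup (fun n => (f n x i ord0)%:E)).
have mu_ : measurable_fun setT u.
  apply: measurable_fun_mx => // i j.
  under [X in measurable_fun _ X]eq_fun do rewrite mxE.
  apply: (@measurableT_comp _ _ _ _ _ _ fine) => //.
  apply: measurable_fun_limn_esup => n; apply/measurable_EFinP.
  exact: (measurableT_comp (measurable_coord i ord0) (mf n)).
have ucvg x : (exists J M, forall j, `|f (J + j).+1 x - f (J + j) x| <= M / 2 ^+ j) ->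
    f ^~ x @ \oo --> u x.
  move=> [J [M H]]; apply: cvg_cV => i; rewrite mxE.
  have : cvgn (fun j => f (j + J)%N x i ord0).
    apply: (@geometric_cvg _ _ M) => n.
    rewrite addSn addnC (le_trans _ (H n))//.
    by have := ler_mx_norm (f (J + n).+1 x - f (J + n) x) i ord0; rewrite !mxE.
  move=> /cvg_ex[l Hl].
  have {}Hl : (fun n => f n x i ord0) @ \oo --> l by rewrite -(cvg_shiftn J).
  have /cvg_limn_einf_sup[_ ->]// : (fun n => (f n x i ord0)%:E) @ \oo --> l%:E.
  by apply: cvg_EFin => //; exact: nearW.
have uae : {ae mu, forall x, (\bigcup_j K j) x -> f ^~ x @ \oo --> u x}.
  have : {ae mu, forall x, forall J, K J x ->
      exists M, forall j, `|f (J + j).+1 x - f (J + j) x| <= M / 2 ^+ j}.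
    exact: ae_foralln ae_bound.
  by apply: filterS => x H [J _ KJx]; apply: ucvg; exists J; exact: H.
exists u => //; split => // j n jn; rewrite /Nle.
apply: (@fatou_ae _ _ _ mu (K j) (fun i x => (`|(`|f n x - f i x|)| `^ p)%:E)) => //.
- by move=> i; apply: measurable_normpow; exact: measurable_norm_funB.
- by apply: measurable_normpow; exact: measurable_norm_funB.
- apply: filterS uae => x H KJx; have {}H := H (ex_intro2 _ _ j I KJx).
  apply: cvg_EFin; first exact: nearW.
  apply: cvg_powR => //.
  by apply: cvg_norm; apply: cvg_norm; apply: cvgB => //; exact: cvg_cst.
- exists j => // i /= ji; exact: fcauchy.
Qed.

End completion.

(** * Weak limits in L^p *)

Section convexity_gap.
Context {R : realType}.
Implicit Types (a b : R).

(** The Japanese bracket. It is strictly convex and grows linearly, so its integral over a set of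
    finite measure stays bounded on a ball of L^p. *)
Definition japan (a : R) : R := Num.sqrt (1 + a ^+ 2).

(** The defect in the midpoint convexity inequality for the bracket. *)
Definition japan_gap a b : R := (japan a + japan b) / 2 - japan ((a + b) / 2).

Let sq a : japan a ^+ 2 = 1 + a ^+ 2.
Proof. by rewrite sqr_sqrtr// addr_ge0// sqr_ge0. Qed.

Lemma japan_ge1 a : 1 <= japan a.
Proof. by rewrite -[leLHS]sqrtr1 ler_sqrt ?lerDl ?sqr_ge0// addr_ge0// sqr_ge0. Qed.

Let japan_mono a M : `|a| <= M -> japan a <= japan M.
Proof.
move=> aM; rewrite ler_sqrt ?lerD2l; last by rewrite addr_ge0// sqr_ge0.
by rewrite -(real_normK (num_real a)) lerXn2r// nnegrE (le_trans (normr_ge0 a)).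
Qed.

Lemma japan_le a : japan a <= 1 + `|a|.
Proof.
have a1 : 0 <= 1 + `|a| by rewrite addr_ge0.
rewrite -(ger0_norm a1) -sqrtr_sqr ler_sqrt ?sqr_ge0// -(real_normK (num_real a)).
by have := normr_ge0 a; nra.
Qed.

Let prod_ge a b : `|1 + a * b| <= japan a * japan b.
Proof.
have x0 : 0 <= japan a * japan b by rewrite mulr_ge0// (le_trans ler01 (japan_ge1 _)).
rewrite -(ger0_norm x0) -ler_sqr ?nnegrE// !real_normK ?num_real// exprMn !sq.
by have := sqr_ge0 (a - b); nra.
Qed.

(** The defect is rationalized twice. With brackets [x], [y] of [a], [b], its product with the first
    sum equals [(x * y - 1 - a * b) / 2], and [(x * y) ^ 2 - (1 + a * b) ^ 2 = (a - b) ^ 2]. *)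
Let gapE a b : (a - b) ^+ 2 = 2 * japan_gap a b *
  ((japan a + japan b) / 2 + japan ((a + b) / 2)) * (japan a * japan b + 1 + a * b).
Proof.
have ha := sq a; have hb := sq b; have hm := sq ((a + b) / 2).
rewrite /japan_gap; move: (japan a) (japan b) (japan ((a + b) / 2)) ha hb hm => x y w ha hb hm.
transitivity ((x ^+ 2 + y ^+ 2 + 2 * x * y - 4 * w ^+ 2) / 2 * (x * y + 1 + a * b)).
  by rewrite ha hb hm; transitivity ((x * y) ^+ 2 - (1 + a * b) ^+ 2); [rewrite exprMn ha hb; ring|field].
by field.
Qed.

(** The sign can be read off [gapE] unless its last factor vanishes, and then [gapE] forces
    [a = b]. *)
Lemma japan_gap_ge0 a b : 0 <= japan_gap a b.
Proof.
have h1 := prod_ge a b; have := japan_ge1 a; have := japan_ge1 b.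
have := japan_ge1 ((a + b) / 2) => hw hy hx.
have q0 : 0 <= japan a * japan b + 1 + a * b by move: h1; rewrite ler_norml; lra.
move: q0; rewrite le_eqVlt => /orP[/eqP q0|q0].
  have ab : a = b by apply/eqP; rewrite -subr_eq0 -sqrf_eq0 gapE -q0 mulr0.
  rewrite /japan_gap ab; have -> : (b + b) / 2 = b by field.
  by have -> : (japan b + japan b) / 2 - japan b = 0 by field.
have := sqr_ge0 (a - b); rewrite gapE pmulr_lge0// pmulr_lge0; last by lra.
by rewrite pmulr_rge0.
Qed.

Lemma japan_gap_lower a b M : `|a| <= M -> `|b| <= M ->
  (a - b) ^+ 2 <= 8 * japan M ^+ 3 * japan_gap a b.
Proof.
move=> aM bM.
have g0 := japan_gap_ge0 a b; rewrite gapE.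
have mM : `|(a + b) / 2| <= M.
  rewrite normrM (ger0_norm (_ : 0 <= 2^-1)) ?invr_ge0// ler_pdivrMr//.
  by rewrite (le_trans (ler_normD _ _))// mulr_natr mulr2n lerD.
have hx := japan_mono aM; have hy := japan_mono bM; have hw := japan_mono mM.
have x1 := japan_ge1 a; have y1 := japan_ge1 b; have w1 := japan_ge1 ((a + b) / 2).
have h1 := prod_ge a b.
have q0 : 0 <= japan a * japan b + 1 + a * b by move: h1; rewrite ler_norml; lra.
have q1 : japan a * japan b + 1 + a * b <= 2 * japan M ^+ 2.
  have : japan a * japan b <= japan M ^+ 2 by rewrite expr2 ler_pM//; lra.
  by move: h1; rewrite ler_norml; lra.
rewrite (_ : 8 * _ * _ = 2 * japan_gap a b * (2 * japan M) * (2 * japan M ^+ 2)); last by ring.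
by apply: ler_pM => //; rewrite ?mulr_ge0// ?ler_wpM2l ?mulr_ge0//; lra.
Qed.

(* Makes near-minimizers of the integral of japan Cauchy in L^1, given a bound in
   L^p with p > 1. *)
Lemma dist_le_gap (p eta : R) : 1 < p -> 0 < eta -> exists2 L, 0 < L &
  forall a b, `|a - b| <= eta * (1 + `|a| `^ p + `|b| `^ p) + L * japan_gap a b.
Proof.
(* Beyond [M] the power absorbs linear growth: [2 * t <= eta * t ^ p]. This is where [p > 1] is
   used. *)
move=> p1 eta0; pose M := Num.max 1 ((2 / eta) `^ (p - 1)^-1).
have M1 : 1 <= M by rewrite le_max lexx.
have p10 : 0 < p - 1 by rewrite subr_gt0.
have big t : M <= t -> 2 * t <= eta * t `^ p.
  move=> Mt; have t0 : 0 <= t by lra.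
  rewrite -(mulr_powRB1 t0) ?(lt_trans ltr01)// mulrCA [2 * t]mulrC ler_wpM2l//.
  rewrite -ler_pdivrMl// mulrC.
  have -> : 2 / eta = ((2 / eta) `^ (p - 1)^-1) `^ (p - 1).
    by rewrite -powRrM mulVf ?gt_eqF// powRr1// divr_ge0// ltW.
  apply: ge0_ler_powR; rewrite ?nnegrE ?powR_ge0 ?(ltW p10)//.
  by apply: le_trans Mt; rewrite le_max lexx orbT.
exists (8 * japan M ^+ 3 / eta).
  by rewrite divr_gt0// mulr_gt0// exprn_gt0// (lt_le_trans ltr01 (japan_ge1 _)).
move=> a b.
have g0 := japan_gap_ge0 a b.
have J0 : 0 < 8 * japan M ^+ 3 by rewrite mulr_gt0// exprn_gt0// (lt_le_trans ltr01 (japan_ge1 _)).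
have L0 : 0 <= 8 * japan M ^+ 3 / eta * japan_gap a b by rewrite mulr_ge0// divr_ge0// ltW.
have ab : `|a - b| <= `|a| + `|b| by exact: ler_normB.
have pa : 0 <= eta * `|a| `^ p by rewrite mulr_ge0 ?powR_ge0// ltW.
have pb : 0 <= eta * `|b| `^ p by rewrite mulr_ge0 ?powR_ge0// ltW.
set G := 8 * _ / _ * _ in L0 *; rewrite !mulrDr mulr1.
have [aM|/ltW aM] := leP M `|a|.
  have ha := big _ aM; have [bM|/ltW bM] := leP M `|b|; first by have hb := big _ bM; lra.
  lra.
have [bM|/ltW bM] := leP M `|b|; first by have hb := big _ bM; lra.
have [ae|/ltW ae] := leP `|a - b| eta; first by lra.
(* Both arguments are now at most [M] in modulus and [|a - b| >= eta], so
   [eta * |a - b| <= (a - b) ^ 2], which [japan_gap_lower] bounds by the defect. *)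
suff : `|a - b| <= G by lra.
rewrite /G mulrAC ler_pdivlMr// (le_trans _ (japan_gap_lower aM bM))//.
by rewrite -real_normK ?num_real// expr2 ler_wpM2l.
Qed.

End convexity_gap.

Section weak_limit.
Context d (T : measurableType d) {R : realType} (mu : {measure set T -> \bar R}).
Variables (p : R) (p_gt1 : 1 < p) (D : set T) (mD : measurable D).
Hypothesis muD : (mu D < +oo)%E.
Variables (K : nat -> set (T -> R)) (C : R).
Hypothesis Kne : forall n, K n !=set0.
Hypothesis Kd : forall m n, (m <= n)%N -> K n `<=` K m.
Hypothesis mK : forall n g, K n g -> measurable_fun setT g.
Hypothesis KC : forall n g, K n g -> Nle mu p D g C.
Hypothesis Kmid : forall n g h, K n g -> K n h -> K n (fun x => (g x + h x) / 2).

Let p0 : 0 < p. Proof. exact: lt_trans p_gt1. Qed.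

Let mjapan : measurable_fun setT (@japan R).
Proof.
apply: continuous_measurable_fun => x; rewrite /japan.
apply: (@continuous_comp _ _ _ (fun x : R => 1 + x ^+ 2) (@Num.sqrt R)); last exact: sqrt_continuous.
by apply: cvgD; [exact: cvg_cst|exact: exprn_continuous].
Qed.

Let I (g : T -> R) : \bar R := (\int[mu]_(x in D) (japan (g x))%:E)%E.

Let japan_ge0 (a : R) : 0 <= japan a. Proof. exact: le_trans (japan_ge1 a). Qed.

Let mj (g : T -> R) : measurable_fun setT g -> measurable_fun D (fun x => (japan (g x))%:E).
Proof.
by move=> mg; apply/measurable_EFinP/measurable_funTS; exact: (measurableT_comp mjapan).
Qed.

Let muDE : mu D = (fine (mu D))%:E.
Proof. by rewrite fineK// ge0_fin_numE. Qed.

Let Ibound n g : K n g -> (I g <= (2 * fine (mu D) + C `^ p)%:E)%E.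
Proof.
move=> Kg; rewrite /I.
apply: (@le_trans _ _ (\int[mu]_(x in D) (2%:E + (`|g x| `^ p)%:E))%E).
  apply: ge0_le_integral => //.
  - by move=> x _; rewrite lee_fin.
  - by apply: mj; exact: mK Kg.
  - by apply: emeasurable_funD => //; apply: measurable_normpowS; exact: mK Kg.
  - move=> x _; rewrite -EFinD lee_fin (le_trans (japan_le _))//.
    suff : `|g x| <= 1 + `|g x| `^ p by lra.
    have [g1|/ltW g1] := leP `|g x| 1; first by rewrite (le_trans g1)// lerDl powR_ge0.
    by rewrite (le_trans (le1r_powR g1 (ltW p_gt1)))// lerDr.
rewrite ge0_integralD//; last by apply: measurable_normpowS; exact: mK Kg.
rewrite integral_cst// (EFinD (2 * fine (mu D))); apply: leeD; last exact: KC Kg.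
by rewrite EFinM -muDE.
Qed.

(** The infimum of [I] over [K n] increases with [n], since the sets decrease; [r] is the limit of
    these infima. *)
Let A : set R := [set x | exists n, forall g, K n g -> (x%:E <= I g)%E].
Let r := sup A.

Let hsA : has_sup A.
Proof.
split.
  by exists 0; exists 0%N => g _; apply: integral_ge0 => x _; rewrite lee_fin.
exists (2 * fine (mu D) + C `^ p) => x [n Hn].
have [g Kg] := Kne n.
by rewrite -lee_fin (le_trans (Hn _ Kg))// (Ibound Kg).
Qed.

Let low e : 0 < e -> exists N, forall g, K N g -> ((r - e)%:E <= I g)%E.
Proof.
move=> e0; have [x [N HN] xr] := sup_adherent e0 hsA.
by exists N => g Kg; rewrite (le_trans _ (HN _ Kg))// lee_fin ltW.
Qed.

Let up n e : 0 < e -> exists2 g, K n g & (I g <= (r + e)%:E)%E.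
Proof.
move=> e0; apply: contrapT => H.
have : A (r + e).
  exists n => g Kg; apply: contrapT => nI; apply: H; exists g => //.
  by rewrite leNgt; apply/negP => /ltW.
move=> /(ub_le_sup (proj2 hsA)); rewrite -/r; lra.
Qed.

(** The midpoint of [a] and [b] is again in [K N], so its integral is at least [r - e], while the
    mean of [I a] and [I b] is at most [r + e]. The difference is the integral of the defect. *)
Let gap_small N a b e : 0 < e -> (forall g, K N g -> ((r - e)%:E <= I g)%E) ->
  K N a -> K N b -> (I a <= (r + e)%:E)%E -> (I b <= (r + e)%:E)%E ->
  (\int[mu]_(x in D) (japan_gap (a x) (b x))%:E <= (2 * e)%:E)%E.
Proof.
move=> e0 lowN Ka Kb Ia Ib; set G := (X in (X <= _)%E).
have ma := mK Ka; have mb := mK Kb; have Km := Kmid Ka Kb; have mm := mK Km.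
have mgap : measurable_fun D (fun x => (japan_gap (a x) (b x))%:E).
  apply/measurable_EFinP/measurable_funTS; apply: measurable_funB.
    apply: measurable_funM => //; apply: measurable_funD.
      exact: (measurableT_comp mjapan).
    exact: (measurableT_comp mjapan).
  exact: (measurableT_comp mjapan mm).
have : (G + I (fun x => ((a x + b x) / 2)%R) <= (r + e)%:E)%E.
  rewrite /G /I -ge0_integralD//; first last.
  - exact: (mj mm).
  - by move=> x _; rewrite lee_fin.
  - by move=> x _; rewrite lee_fin japan_gap_ge0.
  under eq_integral => x _.
    rewrite -EFinD (_ : japan_gap _ _ + _ = 2^-1 * japan (a x) + 2^-1 * japan (b x))%R; last first.
      by rewrite /japan_gap subrK; ring.
    rewrite EFinD !EFinM; over.
  rewrite ge0_integralD//; first last.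
  - by apply: measurable_funeM; exact: mj.
  - by move=> x _; rewrite -EFinM lee_fin mulr_ge0// invr_ge0.
  - by apply: measurable_funeM; exact: mj.
  - by move=> x _; rewrite -EFinM lee_fin mulr_ge0// invr_ge0.
  rewrite !ge0_integralZl_EFin ?invr_ge0//; try exact: mj; try by move=> x _; rewrite lee_fin.
  have -> : (r + e)%:E = (2^-1%:E * (r + e)%:E + 2^-1%:E * (r + e)%:E)%E.
    by rewrite -!EFinM -EFinD; congr EFin; field.
  by apply: leeD; apply: lee_wpmul2l => //; rewrite lee_fin invr_ge0.
move=> H.
have := le_trans (leeD (lexx G) (lowN _ Km)) H.
have : (0 <= G)%E by apply: integral_ge0 => x _; rewrite lee_fin japan_gap_ge0.
case: G {H} => [g| |] // _; rewrite -EFinD !lee_fin; lra.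
Qed.

Let dist_small e : 0 < e -> exists N eps, 0 < eps /\ forall a b, K N a -> K N b ->
  (I a <= (r + eps)%:E)%E -> (I b <= (r + eps)%:E)%E -> Nle mu 1 D (fun x => a x - b x) e.
Proof.
move=> e0; pose m := fine (mu D).
have m0 : 0 <= m by exact: fine_ge0.
have B0 : 0 < m + C `^ p + C `^ p + 1 by rewrite ltr_wpDl// !addr_ge0 ?powR_ge0.
(* In the bound by [dist_le_gap], this [eta] makes the p-th powers contribute at most [e / 2], and
   [eps] below makes the defect, whose integral is at most [2 * eps], contribute [e / 2]. *)
pose eta := e / 2 / (m + C `^ p + C `^ p + 1).
have eta0 : 0 < eta by rewrite !divr_gt0.
have [L L0 HL] := dist_le_gap p_gt1 eta0.
pose eps := e / 4 / L.
have eps0 : 0 < eps by rewrite !divr_gt0.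
have [N HN] := low eps0.
exists N, eps; split => // a b Ka Kb Ia Ib.
have ma := mK Ka; have mb := mK Kb.
have mgap : measurable_fun D (fun x => (japan_gap (a x) (b x))%:E).
  apply/measurable_EFinP/measurable_funTS; apply: measurable_funB.
    apply: measurable_funM => //; apply: measurable_funD.
      exact: (measurableT_comp mjapan).
    exact: (measurableT_comp mjapan).
  apply: (measurableT_comp mjapan); apply: measurable_funM => //; exact: measurable_funD.
have gs := gap_small eps0 HN Ka Kb Ia Ib.
rewrite /Nle powRr1 ?(ltW e0)//.
under eq_integral do rewrite powRr1//.
apply: (@le_trans _ _ (\int[mu]_(x in D) (eta%:E * (1 + (`|a x| `^ p)%:E + (`|b x| `^ p)%:E)
    + L%:E * (japan_gap (a x) (b x))%:E))%E).
  apply: ge0_le_integral => //.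
  - apply/measurable_EFinP/measurable_funTS; apply: (measurableT_comp (@normr_measurable R setT)).
    exact: measurable_funB.
  - apply: emeasurable_funD; last exact: measurable_funeM.
    apply: measurable_funeM; apply: emeasurable_funD; last exact: measurable_normpowS.
    by apply: emeasurable_funD => //; exact: measurable_normpowS.
  - by move=> x _; rewrite -[leRHS]/((eta * (1 + `|a x| `^ p + `|b x| `^ p) + L * japan_gap (a x) (b x))%:E) lee_fin.
rewrite ge0_integralD//; first last.
- exact: measurable_funeM.
- by move=> x _; rewrite -EFinM lee_fin mulr_ge0 ?japan_gap_ge0// ltW.
- apply: measurable_funeM; apply: emeasurable_funD; last exact: measurable_normpowS.
  by apply: emeasurable_funD => //; exact: measurable_normpowS.
- by move=> x _; rewrite -[leRHS]/((eta * (1 + `|a x| `^ p + `|b x| `^ p))%:E) lee_fin mulr_ge0 ?addr_ge0 ?powR_ge0// ltW.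
have mnp : measurable_fun D (fun x => (1 + (`|a x| `^ p)%:E + (`|b x| `^ p)%:E)%E).
  apply: emeasurable_funD; last exact: measurable_normpowS.
  by apply: emeasurable_funD => //; exact: measurable_normpowS.
rewrite !ge0_integralZl_EFin ?(ltW L0) ?(ltW eta0)//;
  try (by move=> x _; rewrite lee_fin japan_gap_ge0);
  try by move=> x _; rewrite -[leRHS]/((1 + `|a x| `^ p + `|b x| `^ p)%:E) lee_fin !addr_ge0 ?powR_ge0.
rewrite ge0_integralD//; first last.
- exact: measurable_normpowS.
- by apply: emeasurable_funD => //; exact: measurable_normpowS.
- by move=> x _; rewrite -[leRHS]/((1 + `|a x| `^ p)%:E) lee_fin addr_ge0 ?powR_ge0.
rewrite ge0_integralD//; last exact: measurable_normpowS.
rewrite integral_cst// mul1e.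
apply: (@le_trans _ _ (eta%:E * (m%:E + (C `^ p)%:E + (C `^ p)%:E) + L%:E * (2 * eps)%:E)%E).
  apply: leeD; apply: lee_wpmul2l => //; rewrite ?lee_fin ?(ltW L0) ?(ltW eta0)//.
  by apply: leeD; [apply: leeD; [rewrite muDE|exact: KC Ka]|exact: KC Kb].
rewrite -[leLHS]/((eta * (m + C `^ p + C `^ p) + L * (2 * eps))%:E) lee_fin /eps /eta.
have -> : L * (2 * (e / 4 / L)) = e / 2 by field; rewrite gt_eqF.
rewrite -lerBrDr (_ : e - e / 2 = e / 2); last by field.
rewrite mulrAC ler_pdivrMr// ler_wpM2l ?divr_ge0 ?(ltW e0)// lerDl//.
Qed.

(* Stands in for weak compactness of balls in L^p; g n is a near-minimizer on K n
   of the integral of sqrt(1 + g^2). *)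
Lemma weak_limit : exists (g : nat -> T -> R) (l : T -> R),
  [/\ forall n, K n (g n), measurable_fun setT l, Nle mu p D l C &
      forall n, Nle mu 1 D (fun x => g n x - l x) ((4^-1) ^+ n)].
Proof.
have /choice[NE HNE] : forall n, exists Ne : nat * R, 0 < Ne.2 /\ forall a b, K Ne.1 a -> K Ne.1 b ->
    (I a <= (r + Ne.2)%:E)%E -> (I b <= (r + Ne.2)%:E)%E ->
    Nle mu 1 D (fun x => a x - b x) ((4^-1) ^+ n).
  move=> n; have e0 : 0 < (4^-1) ^+ n :> R by rewrite exprn_gt0 ?invr_gt0.
  by have [N [eps [? ?]]] := dist_small e0; exists (N, eps).
(* A tolerance that meets the requirements of all accuracies up to [n], so that [g i] and [g n] can
   be compared at the accuracy of the smaller index. *)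
have /choice[eps Heps] : forall n, exists e, 0 < e /\ forall i, (i <= n)%N -> e <= (NE i).2.
  elim => [|n [e [e0 He]]].
    by exists (NE 0%N).2; split; [exact: (HNE 0%N).1|case].
  exists (Num.min e (NE n.+1).2); split; first by rewrite lt_min e0 (HNE n.+1).1.
  move=> i; rewrite leq_eqVlt => /orP[/eqP ->|]; first by rewrite ge_min lexx orbT.
  by rewrite ltnS => /He ei; rewrite ge_min ei.
(* The sum dominates each single [(NE i).1] with [i <= n]; the summand [n] puts [g n] into [K n]. *)
pose k n := (n + \sum_(i < n.+1) (NE i).1)%N.
have kN i n : (i <= n)%N -> ((NE i).1 <= k n)%N.
  move=> i_n; rewrite /k (bigD1 (Ordinal (i_n : (i < n.+1)%N)))//=.
  by rewrite addnCA leq_addr.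
have /choice[g Hg] : forall n, exists g, K (k n) g /\ (I g <= (r + eps n)%:E)%E.
  by move=> n; have [g ? ?] := up (k n) (proj1 (Heps n)); exists g.
have Kg i n : (i <= n)%N -> K (NE i).1 (g n).
  by move=> i_n; apply: (Kd (kN _ _ i_n)); exact: (Hg n).1.
have Ig i n : (i <= n)%N -> (I (g n) <= (r + (NE i).2)%:E)%E.
  by move=> i_n; rewrite (le_trans (Hg n).2)// lee_fin lerD2l (Heps n).2.
have mg n : measurable_fun setT (g n) by exact: mK (Hg n).1.
(* Scalar functions are viewed as columns of length 1, to which [Lp_completion] applies with
   exponent 1 and the constant exhaustion [D]. *)
pose f n x : 'cV[R]_1 := const_mx (g n x).
have normc (c : R) : `|const_mx c : 'cV[R]_1| = `|c|.
  apply/eqP; rewrite eq_le; apply/andP; split.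
    by apply/mx_norm_leP => // i j; rewrite mxE.
  by have := ler_mx_norm (const_mx c : 'cV[R]_1) ord0 ord0; rewrite mxE.
have mf n : measurable_fun setT (f n).
  apply: measurable_fun_mx => // i j.
  by under [X in measurable_fun _ X]eq_fun do rewrite mxE; exact: mg.
have [u mu_u [uae ucvg]] : exists2 u : T -> 'cV[R]_1, measurable_fun setT u &
  {ae mu, forall x, (\bigcup_(j : nat) D) x -> f ^~ x @ \oo --> u x} /\
  (forall j n, (j <= n)%N -> Nle mu 1 D (fun x => `|f n x - u x|) ((4^-1) ^+ j)).
  apply: (@Lp_completion _ _ _ mu 1 (lexx 1) 1 f (fun=> D)) => //; move=> j i n ji jn; first by [].
  move: ji jn => ji jn.
  have := (HNE j).2 _ _ (Kg _ _ jn) (Kg _ _ ji) (Ig _ _ jn) (Ig _ _ ji).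
  rewrite /Nle => H; apply: le_trans H; rewrite le_eqVlt; apply/orP; left; apply/eqP.
  apply: eq_integral => x _; rewrite normr_id.
  have -> : f n x - f i x = const_mx (g n x - g i x) by apply/matrixP => ? ?; rewrite !mxE.
  by rewrite normc.
have gl : {ae mu, forall x, D x -> g ^~ x @ \oo --> u x ord0 ord0}.
  apply: filterS uae => x H Dx; have {}H := H (ex_intro2 _ _ 0%N Logic.I Dx).
  apply/cvgrPdist_lt => e e0; move/cvgrPdist_lt : H => /(_ e e0).
  apply: filterS => n; apply: le_lt_trans.
  by have := ler_mx_norm (u x - f n x) ord0 ord0; rewrite !mxE.
exists g, (fun x => u x ord0 ord0); split.
- by move=> n; apply: (Kd _ (Hg n).1); exact: leq_addr.
- exact: (measurableT_comp (measurable_coord ord0 ord0) mu_u).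
- rewrite /Nle.
  apply: (@fatou_ae _ _ _ mu D (fun i x => (`|g i x| `^ p)%:E)) => //.
  + by move=> i; exact: measurable_normpow.
  + by apply: measurable_normpow; exact: (measurableT_comp (measurable_coord ord0 ord0) mu_u).
  + apply: filterS gl => x H Dx; have {}H := H Dx.
    apply: cvg_EFin; first exact: nearW.
    by apply: cvg_powR => //; [exact: ltW|exact: cvg_norm].
  + by apply: nearW => n; exact: (KC (Hg n).1).
- move=> n; have := ucvg n n (leqnn n); rewrite /Nle => H; apply: le_trans H.
  rewrite le_eqVlt; apply/orP; left; apply/eqP.
  apply: eq_integral => x _; rewrite normr_id; congr ((_ `^ _)%:E).
  rewrite -(normc (g n x - u x ord0 ord0)); congr (`|_|).
  by apply/matrixP => i j; rewrite !mxE !ord1.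
Qed.

End weak_limit.

(** * Cells of the lattice and the discrete gradient *)

Lemma mulmx_norm_le {R : realType} m n (M : 'M[R]_(m, n)) (x : 'cV[R]_n) :
  `|M *m x| <= n%:R * `|M| * `|x|.
Proof.
apply/mx_norm_leP; first by rewrite !mulr_ge0.
move=> i j; rewrite mxE (le_trans (ler_norm_sum _ _ _))//.
apply: (@le_trans _ _ (\sum_(k < n) `|M| * `|x|)).
  by apply: ler_sum => k _; rewrite normrM ler_pM// ler_mx_norm.
by rewrite sumr_const card_ord -mulrA mulr_natl.
Qed.

Lemma measurable_mulmx {R : realType} m n (M : 'M[R]_(m, n)) :
  measurable_fun setT (fun x : 'cV[R]_n => M *m x).
Proof.
apply: measurable_fun_mx => // i j.
under [X in measurable_fun _ X]eq_fun do rewrite mxE.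
by apply: measurable_sum => k; apply: measurable_funM => //; exact: measurable_coord.
Qed.

Section cells.
Context {R : realType} (d : nat) (A : 'M[R]_d) (A_inv : A \in unitmx).
Variables (eps : R) (eps_gt0 : 0 < eps).
Implicit Types (x : 'cV[R]_d) (k : 'cV[int]_d).

(** Integer coordinates of the base point of the cell of [x]. They label the cells by a countable
    type, and cellwise constant functions become functions of the label. *)
Definition cell_index x : 'cV[int]_d := \col_i Num.floor ((invmx A *m x) i ord0 / eps).

Definition cell_base k : 'cV[R]_d := eps *: (A *m map_mx intr k).

Definition cell_center k : 'cV[R]_d := cell_base k + eps *: (A *m const_mx 2^-1).

Lemma cell_index_itv k x : cell_index x = k <->
  forall i, eps * (k i ord0)%:~R <= (invmx A *m x) i ord0 < eps * ((k i ord0)%:~R + 1).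
Proof.
have E i : (eps * (k i ord0)%:~R <= (invmx A *m x) i ord0 < eps * ((k i ord0)%:~R + 1)) =
    (Num.floor ((invmx A *m x) i ord0 / eps) == k i ord0).
  by rewrite floor_eq intrD ler_pdivlMr// ltr_pdivrMr// ![_ * eps]mulrC.
split => [ke i|H]; first by rewrite E -ke; apply/eqP; rewrite [RHS]mxE.
by apply/colP => i; rewrite [LHS]mxE; apply/eqP; rewrite -E.
Qed.

Lemma invmx_cell_base k (t : 'cV[R]_d) i :
  (invmx A *m (cell_base k + A *m t)) i ord0 = eps * (k i ord0)%:~R + t i ord0.
Proof. by rewrite mulmxDr mulKmx// /cell_base -scalemxAr mulKmx// !mxE. Qed.

Lemma cell_indexP k x : cell_at A eps (cell_base k) x <-> cell_index x = k.
Proof.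
split.
  move=> [t /= tE <-]; apply/cell_index_itv => i; rewrite invmx_cell_base.
  by have /andP[? ?] := tE i; apply/andP; split; lra.
move=> /cell_index_itv H; exists (invmx A *m x - eps *: map_mx intr k) => /=; last first.
  by rewrite mulmxBr mulKVmx// -scalemxAr addrC subrK.
move=> i; have /andP[? ?] := H i; have -> : (invmx A *m x - eps *: map_mx intr k) i ord0 =
  (invmx A *m x) i ord0 - eps * (k i ord0)%:~R by rewrite !mxE.
by apply/andP; split; lra.
Qed.

Lemma cellE x : cell A eps x = [set v | cell_index v = cell_index x].
Proof.
apply/seteqP; split => [v [_ [[k _ <-] /cell_indexP kx] /cell_indexP kv]|v /= vx].
  by rewrite /= kv kx.
exists (cell_base (cell_index x)); last exact/cell_indexP.
by split; [exists (cell_index x)|exact/cell_indexP].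
Qed.

Lemma cell_index_base_add k (t : 'cV[R]_d) : (forall i, 0 <= t i ord0 < eps) ->
  cell_index (cell_base k + A *m t) = k.
Proof. by move=> tE; apply/cell_indexP; exists t. Qed.

Lemma cell_index_base k : cell_index (cell_base k) = k.
Proof.
rewrite -[cell_base k]addr0 -(mulmx0 _ A) cell_index_base_add// => i.
by rewrite mxE lexx.
Qed.

Lemma cell_index_center k : cell_index (cell_center k) = k.
Proof.
rewrite /cell_center scalemxAr cell_index_base_add// => i; rewrite !mxE.
by have e0 := eps_gt0; apply/andP; split; lra.
Qed.

(** Shrinking [t] by a factor [1 - s] slightly below 1 turns [t <= eps] into a strict inequality,
    hence leads into the half-open cell. *)
Lemma closure_cell k (t : 'cV[R]_d) : (forall i, 0 <= t i ord0 <= eps) ->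
  closure (cell A eps (cell_center k)) (cell_base k + A *m t).
Proof.
move=> tE B /nbhs_ballP[r /= r0 rB].
pose m := `|A *m t| + 1; have m0 : 0 < m by rewrite ltr_wpDl.
pose s := Num.min (r / m) 1.
have s0 : 0 < s by rewrite lt_min divr_gt0/=.
exists (cell_base k + A *m ((1 - s) *: t)); split.
  rewrite cellE /= cell_index_center cell_index_base_add// => i; rewrite !mxE.
  have /andP[t0 t1] := tE i; have s1 : s <= 1 by rewrite ge_min lexx orbT.
  rewrite mulr_ge0 ?subr_ge0//= (@le_lt_trans _ _ ((1 - s) * eps))//.
    by rewrite ler_wpM2l ?subr_ge0.
  by rewrite mulrBl mul1r ltrBlDr ltrDl mulr_gt0.
apply: rB; rewrite -ball_normE /ball_/= -scalemxAr opprD addrACA subrr add0r.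
rewrite -[X in X - _]scale1r -scalerBl opprB addrCA subrr addr0 normrZ gtr0_norm//.
rewrite (@le_lt_trans _ _ (r / m * `|A *m t|))//.
  by rewrite ler_wpM2r// ge_min lexx.
by rewrite mulrAC ltr_pdivrMr// ltr_pM2l// ltrDl.
Qed.

Lemma measurable_cell_index k : measurable [set x | cell_index x = k].
Proof.
pose B (i : 'I_d) : set (measurableTypeR R) := `[eps * (k i ord0)%:~R, eps * ((k i ord0)%:~R + 1)[%classic.
have -> : [set x | cell_index x = k] = (fun x => invmx A *m x) @^-1`
    [set v : 'cV[R]_d | forall i, B i (v i ord0)].
  apply/seteqP; split => x /=.
    by move=> /cell_index_itv H i; have := H i; rewrite /B/= in_itv.
  by move=> H; apply/cell_index_itv => i; have := H i; rewrite /B/= in_itv.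
rewrite -[X in measurable X]setTI; apply: measurable_mulmx => //.
by apply: measurable_box => i; exact: measurable_itv.
Qed.

Lemma cell_index_ball k : [set x | cell_index x = k] `<=`
  ball (cell_base k) ((d%:R * `|A| + 1) * eps).
Proof.
move=> x /cell_indexP[t /= tE <-]; rewrite -ball_normE /ball_/= opprD addrA subrr sub0r normrN.
rewrite (le_lt_trans (mulmx_norm_le _ _))//.
rewrite (@le_lt_trans _ _ (d%:R * `|A| * eps))//; last by rewrite ltr_pM2r// ltrDl.
rewrite ler_wpM2l ?mulr_ge0//; apply/mx_norm_leP; first exact: ltW.
by move=> i j; rewrite ord1 ger0_norm; have /andP[? /ltW] := tE i.
Qed.

End cells.

Lemma enorm_ge0 {R : realType} m n (F : 'M[R]_(m, n)) : 0 <= enorm F.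
Proof. exact: sqrtr_ge0. Qed.

Lemma ler_enorm {R : realType} m n (F : 'M[R]_(m, n)) i j : `|F i j| <= enorm F.
Proof.
rewrite -sqrtr_sqr ler_sqrt; last by do 2!apply: sumr_ge0 => ? _; exact: sqr_ge0.
rewrite (bigD1 i)//= (bigD1 j)//= -addrA lerDl addr_ge0//.
  by apply: sumr_ge0 => ? _; exact: sqr_ge0.
by do 2!apply: sumr_ge0 => ? _; exact: sqr_ge0.
Qed.

Lemma enorm_le_norm {R : realType} m n (F : 'M[R]_(m, n)) :
  enorm F <= Num.sqrt (m * n)%:R * `|F|.
Proof.
rewrite -[X in _ <= _ * X]ger0_norm// -sqrtr_sqr -sqrtrM// ler_sqrt ?mulr_ge0 ?sqr_ge0//.
apply: (@le_trans _ _ (\sum_(i < m) \sum_(j < n) `|F| ^+ 2)).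
  do 2!apply: ler_sum => ? _.
  by rewrite -real_normK ?num_real// lerXn2r ?nnegrE// ler_mx_norm.
by rewrite !sumr_const !card_ord -mulrnA mulnC -[leLHS]mulr_natl.
Qed.

Section discrete_step.
Context {R : realType} (d : nat) (A : 'M[R]_d) (A_inv : A \in unitmx).
Variables (eps : R) (eps_gt0 : 0 < eps).
Variables (Omega : set 'cV[R]_d) (z : 'I_(2 ^ d) -> 'cV[R]_d).
Hypothesis z_corners : enumerates_corners A z.
Variable y : 'cV[R]_d -> 'cV[R]_d.
Hypothesis ycst : cellwise_constant A eps Omega y.

Notation q := (cell_index A eps).
Notation base := (cell_base A eps).
Notation center := (cell_center A eps).

Definition inside_cells : set 'cV[R]_d :=
  [set x | closure (cell A eps (center (q x))) `<=` Omega].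

Definition cell_gradient (x : 'cV[R]_d) : 'M[R]_(d, 2 ^ d) :=
  discrete_gradient eps z y (center (q x)).

Lemma cellwise_constantP a b : Omega a -> Omega b -> q a = q b -> y a = y b.
Proof.
move=> Oa Ob ab.
have ca : cell A eps (center (q a)) a by rewrite cellE//= cell_index_center.
apply: (ycst (x := center (q a))).
- split; first by exists (base (q a)) => //; exists (q a).
  by exists a; split => //; exact: subset_closure.
- by [].
- by split => //; rewrite cellE//= cell_index_center.
Qed.

(** Corners have coordinates -1/2, 1/2 when counted from the centre and 0, 1 when counted from the
    base point. *)
Lemma corner_base k (e : 'cV[R]_d) : (forall i, e i ord0 = 0 \/ e i ord0 = 1) ->
  exists j, center k + eps *: z j = base k + eps *: (A *m e).
Proof.
move=> e01.
have : range z (A *m (e - const_mx 2^-1)).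
  rewrite (proj2 z_corners) /=; exists (e - const_mx 2^-1) => // i.
  by rewrite !mxE; case: (e01 i) => ->; [left; rewrite sub0r|right; field].
move=> [j _ zj]; exists j; rewrite zj /cell_center -addrA -scalerDr -mulmxDr.
by congr (_ + eps *: (A *m _)); rewrite addrC subrK.
Qed.

(** The mean over the corners is common to all of them, so it cancels when two corners of one cell
    are compared and only entries of the gradient remain. *)
Lemma corner_value k (e : 'cV[R]_d) : (forall i, e i ord0 = 0 \/ e i ord0 = 1) ->
  exists j, forall i, y (base k + eps *: (A *m e)) i ord0 =
   (2 ^- d *: \sum_l y (center k + eps *: z l)) i ord0 +
   eps * discrete_gradient eps z y (center k) i j.
Proof.
move=> /(corner_base k)[j zj]; exists j => i; rewrite -zj /discrete_gradient.
rewrite [X in _ + eps * X]mxE [X in _ + eps * X]mxE mulVKf ?gt_eqF//.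
by rewrite [X in _ = _ + X]mxE [X in _ = _ + (_ + X)]mxE [RHS]addrC subrK.
Qed.

(** A step of at most one cell size along a lattice direction raises each coordinate of the index by
    0 or 1, so the base point of the new cell is a corner of the old one. *)
Lemma neighbour_index x i s : 0 <= s <= eps ->
  exists2 e : 'cV[R]_d, (forall l, e l ord0 = 0 \/ e l ord0 = 1) &
    base (q (x + s *: (A *m delta_mx i ord0))) = base (q x) + eps *: (A *m e).
Proof.
move=> /andP[s0 s1]; set x' := x + _.
pose t l : bool := q x' l ord0 != q x l ord0.
have tE l : (q x' l ord0)%:~R = (q x l ord0)%:~R + (t l)%:R :> R.
  have /(_ l) := proj1 (cell_index_itv A eps_gt0 (q x') x') erefl.
  have /(_ l) := proj1 (cell_index_itv A eps_gt0 (q x) x) erefl.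
  have -> : (invmx A *m x') l ord0 = (invmx A *m x) l ord0 + s * (l == i)%:R.
    by rewrite /x' mulmxDr -scalemxAr mulKmx// !mxE eqxx andbT.
  rewrite /t; move: (q x' l ord0) (q x l ord0) => a b.
  set X := (invmx A *m x) l ord0 => /andP[b0 b1] /andP[a0 a1].
  have : 0 <= s * (l == i)%:R <= eps by case: eqP; rewrite ?mulr1 ?mulr0 ?s0 ?s1 ?lexx ?ltW.
  move: (s * _) a0 a1 => w a0 a1 /andP[w0 w1].
  have e0 := eps_gt0.
  have ba : b%:~R < a%:~R + 1 :> R by rewrite -(ltr_pM2l e0); lra.
  have ab : a%:~R < b%:~R + 2 :> R by rewrite -(ltr_pM2l e0); lra.
  have {}ba : b < a + 1 by rewrite -(ltr_int R) intrD.
  have {}ab : a < b + 2 by rewrite -(ltr_int R) intrD.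
  case: eqP => [->|/eqP ne] /=; first by rewrite addr0.
  have -> : a = b + 1 by lia.
  by rewrite intrD.
exists (\col_l (t l)%:R).
  by move=> l; rewrite mxE; case: (t l); [right|left].
rewrite /cell_base -scalerDr -mulmxDr; congr (_ *: (_ *m _)).
by apply/colP => l; rewrite [LHS]mxE tE [RHS]mxE; congr (_ + _); symmetry; rewrite [LHS]mxE.
Qed.

(* The values of y at x and at x + s A e_i are attained at corners of the cell of x,
   hence enter the discrete gradient there. *)
Lemma discrete_step_le x i s : 0 <= s <= eps -> Omega x ->
  Omega (x + s *: (A *m delta_mx i ord0)) -> inside_cells x ->
  `|y (x + s *: (A *m delta_mx i ord0)) - y x| <= 2 * eps * enorm (cell_gradient x).
Proof.
move=> s01 Ox Ox' Ix; set x' := x + _ in Ox' *.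
have [e e01 eE] := neighbour_index x i s01.
have Obase (f : 'cV[R]_d) : (forall l, f l ord0 = 0 \/ f l ord0 = 1) ->
    Omega (base (q x) + eps *: (A *m f)).
  move=> f01; rewrite scalemxAr; apply: Ix; apply: closure_cell => // l; rewrite mxE.
  by case: (f01 l) => ->; rewrite ?mulr0 ?mulr1 ?lexx ltW.
have z01 l : (0 : 'cV[R]_d) l ord0 = 0 \/ (0 : 'cV[R]_d) l ord0 = 1 by left; rewrite mxE.
have -> : y x = y (base (q x) + eps *: (A *m 0)).
  apply: cellwise_constantP => //; first exact: Obase.
  by rewrite mulmx0 scaler0 addr0 cell_index_base.
have -> : y x' = y (base (q x) + eps *: (A *m e)).
  apply: cellwise_constantP => //; first exact: Obase.
  by rewrite -eE cell_index_base.
have [j Hj] := corner_value (q x) e01; have [j0 Hj0] := corner_value (q x) z01.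
apply/mx_norm_leP => [|l r]; first by rewrite !mulr_ge0 ?enorm_ge0// ltW.
rewrite ord1 !mxE Hj Hj0 opprD addrACA subrr add0r -mulrBr normrM gtr0_norm//.
have -> : 2 * eps * enorm (cell_gradient x) = eps * (enorm (cell_gradient x) + enorm (cell_gradient x)) by ring.
by rewrite ler_pM2l// (le_trans (ler_normB _ _))// lerD// ler_enorm.
Qed.

End discrete_step.

Section cell_integrals.
Context {R : realType} (d : nat) (A : 'M[R]_d) (A_inv : A \in unitmx).
Variables (eps : R) (eps_gt0 : 0 < eps).
Notation mu := (@lebesgue_cV R d).
Notation q := (cell_index A eps).
Notation base := (cell_base A eps).
Notation center := (cell_center A eps).

Lemma measurable_cell_fun d' (T' : measurableType d') (g : 'cV[int]_d -> T') :
  measurable_fun setT (fun x => g (q x)).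
Proof.
move=> _ B mB; rewrite setTI.
have -> : (fun x => g (q x)) @^-1` B = \bigcup_k (if g k \in B then [set x | q x = k] else set0).
  apply/seteqP; split => x /=.
    by move=> Bx; exists (q x) => //; rewrite mem_set.
  by move=> [k _]; case: ifPn => // /set_mem Bk xk; rewrite /= xk.
apply: countable_bigcupT_measurable => [|k]; first exact: countableP.
by case: ifP => // _; exact: measurable_cell_index.
Qed.

Lemma measurable_cell_set (S : set 'cV[int]_d) : measurable [set x | S (q x)].
Proof.
have := @measurable_cell_fun _ bool (fun k => k \in S) measurableT [set true] I.
by rewrite setTI; congr (measurable _); apply/seteqP; split => x /=; [move=> /set_mem|move=> ?; apply: mem_set].
Qed.

Lemma finite_cells (D : set 'cV[R]_d) : bounded_set D ->
  finite_set [set k | exists2 x, D x & q x = k].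
Proof.
move=> [M [Mr HM]]; pose B := d%:R * `|invmx A| * (`|M| + 1).
pose N := (Num.truncn (B / eps)).+2.
have HB x : D x -> forall i, `|(invmx A *m x) i ord0| <= B.
  move=> Dx i; rewrite (le_trans (ler_mx_norm _ _ _))// (le_trans (mulmx_norm_le _ _))//.
  by rewrite ler_wpM2l ?mulr_ge0// (HM (`|M| + 1))// (le_lt_trans (ler_norm M))// ltrDl.
apply: (@sub_finite_set _ _ ((fun f : {ffun 'I_d -> 'I_(N + N).+1} => (\col_i ((f i)%:Z - N%:Z)) : 'cV[int]_d) @` setT)).
  move=> _ [x Dx <-].
  have kN i : - N%:Z <= q x i ord0 <= N%:Z.
    have Hi := HB _ Dx i.
    have -> : q x i ord0 = Num.floor ((invmx A *m x) i ord0 / eps) by rewrite [LHS]mxE.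
    have hw : `|(invmx A *m x) i ord0 / eps| < N.-1%:R.
      rewrite normrM normfV (gtr0_norm eps_gt0) /=.
      apply: le_lt_trans (truncnS_gt (B / eps)).
      by apply: ler_wpM2r Hi; rewrite invr_ge0 ltW.
    move: hw; rewrite ltr_norml => /andP[w0 w1].
    have := floor_itv ((invmx A *m x) i ord0 / eps).
    move: (Num.floor _) => k /andP[k0 k1].
    have : k%:~R < (N.-1%:Z)%:~R :> R by exact: le_lt_trans w1.
    have : (- (N.-1%:Z))%:~R < (k + 1)%:~R :> R by rewrite intrN; exact: lt_trans k1.
    by rewrite !ltr_int /N /=; lia.
  have fP i : (`|(q x i ord0 + N%:Z)%R|%N < (N + N).+1)%N by have := kN i; lia.
  exists [ffun i => Ordinal (fP i)] => //.
  apply/colP => i; rewrite [LHS]mxE ffunE /= gez0_abs ?addrK//; by have := kN i; lia.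
exact/finite_image/finite_finset.
Qed.

(** Volume of a cube that contains a cell of size 1. It takes the place of |det A|, for which an
    upper bound is enough. *)
Definition cell_volume_bound : R := (2 * (d%:R * `|A| + 1)) ^+ d.

Lemma cell_volume k : (mu [set x | q x = k] <= (cell_volume_bound * eps ^+ d)%:E)%E.
Proof.
apply: (@le_trans _ _ (mu (ball (base k) ((d%:R * `|A| + 1) * eps)))).
  apply: le_measure; rewrite ?inE.
  - exact: measurable_cell_index.
  - exact: measurable_ball_cV.
  - exact: cell_index_ball.
rewrite lebesgue_cV_ball ?mulr_gt0 ?ltr_wpDl ?mulr_ge0//.
by rewrite -exprMn mulrA.
Qed.

Lemma cell_sum_ge (S : set 'cV[int]_d) (g : 'cV[int]_d -> R) : finite_set S ->
  (forall k, 0 <= g k) ->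
  (\int[mu]_(x in [set x | S (q x)]) (g (q x))%:E <=
   (cell_volume_bound * eps ^+ d)%:E * \esum_(k in S) (g k)%:E)%E.
Proof.
move=> finS g0; rewrite esum_fset//; last by move=> k _; rewrite lee_fin.
have [s SE] := proj1 (finite_seqP S) finS.
have {}SE : S = [set` undup s] by rewrite SE; apply/seteqP; split => k /=; rewrite mem_undup.
rewrite SE -(fsbig_seq _ _ (undup_uniq s)).
have -> : [set x | [set` undup s] (q x)] = \big[setU/set0]_(k <- undup s) [set x | q x = k].
  rewrite -bigcup_seq; apply/seteqP; split => x /=.
    by move=> qs; exists (q x).
  by move=> [k /= ks xk]; rewrite xk.
have mg : measurable_fun setT (fun x => (g (q x))%:E).
  by apply/measurable_EFinP; exact: (@measurable_cell_fun _ (measurableTypeR R) g).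
rewrite ge0_integral_bigsetU//=; first last.
- by move=> x _; rewrite lee_fin.
- exact: measurable_funTS.
- by apply/trivIsetP => k l _ _ kl; apply/seteqP; split => // x [/= ? ?]; move/eqP : kl; apply; congruence.
- exact: undup_uniq.
- by move=> k; exact: measurable_cell_index.
rewrite ge0_sume_distrr; last by move=> k _; rewrite lee_fin.
apply: lee_sum => k _.
rewrite (eq_integral (cst (g k)%:E)); last by move=> x /set_mem/= ->.
rewrite integral_cst; last exact: measurable_cell_index.
by rewrite muleC lee_wpmul2r ?lee_fin// cell_volume.
Qed.

(** On [Omega] the function [y] factors through the index: [w] evaluates it at a chosen
    representative, with default 0 for cells that miss [Omega]. A function of the index is
    measurable because there are countably many cells. *)
Lemma measurable_cell_ext m (Omega : set 'cV[R]_d) (y : 'cV[R]_d -> 'cV[R]_m) :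
  measurable Omega ->
  (forall a b, Omega a -> Omega b -> q a = q b -> y a = y b) ->
  measurable_fun setT (fun x => if x \in Omega then y x else 0).
Proof.
move=> mO ycst; pose w k : 'cV[R]_m := y (xget 0 [set x | Omega x /\ q x = k]).
have -> : (fun x => if x \in Omega then y x else 0) = (fun x => if x \in Omega then w (q x) else 0).
  apply/funext => x; case: ifPn => // /set_mem Ox; rewrite /w.
  have [Oz qz] : [set v | Omega v /\ q v = q x] (xget 0 [set v | Omega v /\ q v = q x]).
    by apply: xgetPex; exists x.
  exact: ycst.
apply: measurable_fun_ifT => //.
  apply: (measurable_fun_bool true); rewrite setTI (_ : _ @^-1` _ = Omega)//.
  by apply/seteqP; split => x /=; [move=> /set_mem|move=> ?; apply: mem_set].
exact: (@measurable_cell_fun _ _ w).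
Qed.

(** A bounded set meets finitely many cells. The bound depends on the function and on [eps], and
    serves to place each single function in L^p. *)
Lemma cell_fun_bounded m (Omega : set 'cV[R]_d) (y : 'cV[R]_d -> 'cV[R]_m) :
  bounded_set Omega ->
  (forall a b, Omega a -> Omega b -> q a = q b -> y a = y b) ->
  exists M, forall x, Omega x -> `|y x| <= M.
Proof.
move=> bO ycst; pose w k : 'cV[R]_m := y (xget 0 [set x | Omega x /\ q x = k]).
have [s sE] := proj1 (finite_seqP _) (finite_cells bO).
exists (\sum_(k <- s) `|w k|) => x Ox.
have ks : q x \in s.
  have : [set k | exists2 x, Omega x & q x = k] (q x) by exists x.
  by rewrite sE.
have -> : y x = w (q x).
  have [Oz qz] : [set v | Omega v /\ q v = q x] (xget 0 [set v | Omega v /\ q v = q x]).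
    by apply: xgetPex; exists x.
  exact: ycst.
by rewrite (big_rem (q x))//= lerDl sumr_ge0.
Qed.

End cell_integrals.

Section energy_bound.
Context {R : realType} (d : nat) (A : 'M[R]_d) (A_inv : A \in unitmx).
Variables (Omega : set 'cV[R]_d) (z : 'I_(2 ^ d) -> 'cV[R]_d).
Hypothesis Omega_bounded : bounded_set Omega.
Hypothesis Omega_open : open Omega.
Variables (p : R) (p_gt1 : 1 < p) (Wcell : 'M[R]_(d, 2 ^ d) -> R) (c c' E : R).
Hypothesis W0 : forall F, 0 <= Wcell F.
Hypotheses (c0 : 0 < c) (c'0 : 0 < c') (E0 : 0 <= E).
Hypothesis Wgrowth : forall F, zero_row_sums F -> c * enorm F `^ p - c' <= Wcell F.
Notation mu := (@lebesgue_cV R d).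

(** From [c * enorm F ^ p <= Wcell F + c'], integrated over the inside cells: the energy contributes
    at most [cell_volume_bound A * E], the constant at most [c'] times the measure of [Omega]. *)
Definition gradient_bound : R :=
  ((cell_volume_bound A * E + c' * fine (mu Omega)) / c) `^ p^-1.

(** Subtracting the mean puts the discrete gradient into V_0, where the growth condition is
    available. *)
Lemma discrete_gradient_zero_sums eps y x : zero_row_sums (discrete_gradient eps z y x).
Proof.
move=> i; under eq_bigr do rewrite !mxE.
rewrite -mulr_sumr; apply/eqP; rewrite mulf_eq0; apply/orP; right.
rewrite sumrB sumr_const card_ord summxE -[X in _ - X]mulr_natl natrX mulVKf ?expf_neq0//.
by rewrite subrr.
Qed.

Lemma inside_cells_sub eps : 0 < eps -> inside_cells A eps Omega `<=` Omega.
Proof.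
move=> e0 x; apply; apply: subset_closure; rewrite cellE//= cell_index_center//.
Qed.

Lemma energy_gradient_bound eps y : 0 < eps ->
  (energy A eps z Wcell y Omega <= E%:E)%E ->
  Nle mu p (inside_cells A eps Omega) (fun x => enorm (cell_gradient A eps z y x)) gradient_bound.
Proof.
move=> e0; rewrite /energy; case: ifPn => [/asboolP ycst|_]; last by rewrite leye_eq.
pose S : set 'cV[int]_d := [set k | closure (cell A eps (cell_center A eps k)) `<=` Omega].
pose G k := discrete_gradient eps z y (cell_center A eps k).
have IS : inside_cells A eps Omega = [set x | S (cell_index A eps x)] by [].
have mI : measurable (inside_cells A eps Omega) by rewrite IS; exact: measurable_cell_set.
have mO : measurable Omega by exact: open_measurable_cV.
have mOfin : (mu Omega < +oo)%E by exact: lebesgue_cV_bounded.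
have finS : finite_set S.
  apply: sub_finite_set (finite_cells A_inv e0 Omega_bounded) => k Sk.
  exists (cell_center A eps k); last exact: cell_index_center.
  by apply: Sk; apply: subset_closure; rewrite cellE//= cell_index_center.
(* The sum over centres becomes a sum over the finite set [S] of indices, matching the integral of a
   function of the index. *)
rewrite (@reindex_esum _ _ _ S _ (cell_center A eps)); last first.
  split.
  - by move=> k Sk; split => //; exists (cell_base A eps k) => //; exists k.
  - by move=> k l _ _ kl; rewrite -(cell_index_center A_inv e0 k) kl cell_index_center.
  - by move=> x [[_ [k _ <-] <-]] Sx; exists k.
move=> HE.
have HW : (\int[mu]_(x in inside_cells A eps Omega) (Wcell (cell_gradient A eps z y x))%:E
    <= (cell_volume_bound A * E)%:E)%E.
  apply: (le_trans (cell_sum_ge A_inv e0 finS (fun k => W0 (G k)))).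
  rewrite EFinM -muleA EFinM; apply: lee_wpmul2l => //.
  by rewrite lee_fin exprn_ge0// mulr_ge0// addr_ge0// mulr_ge0.
have mW : measurable_fun setT (fun x => (Wcell (cell_gradient A eps z y x))%:E).
  have m1 := @measurable_cell_fun _ _ A _ e0 _ (measurableTypeR R) (fun k => Wcell (G k)).
  by apply/measurable_EFinP; exact: m1.
have mg : measurable_fun setT (fun x => enorm (cell_gradient A eps z y x)).
  exact: (@measurable_cell_fun _ _ A _ e0 _ (measurableTypeR R) (fun k => enorm (G k))).
have H : (c%:E * \int[mu]_(x in inside_cells A eps Omega) (`|enorm (cell_gradient A eps z y x)| `^ p)%:E <=
    (cell_volume_bound A * E + c' * fine (mu Omega))%:E)%E.
  rewrite -ge0_integralZl_EFin//; first last.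
  - exact: ltW.
  - exact: measurable_normpowS.
  apply: (@le_trans _ _ (\int[mu]_(x in inside_cells A eps Omega) ((Wcell (cell_gradient A eps z y x))%:E + c'%:E))%E).
    apply: ge0_le_integral => //.
    - by move=> x _; rewrite -EFinM lee_fin mulr_ge0 ?powR_ge0// ltW.
    - by apply: measurable_funeM; exact: measurable_normpowS.
    - by apply: emeasurable_funD => //; exact: measurable_funTS.
    - move=> x _; rewrite -EFinM -EFinD lee_fin -lerBlDr ger0_norm ?enorm_ge0//.
      exact/Wgrowth/discrete_gradient_zero_sums.
  rewrite ge0_integralD//; first last.
  - by move=> x _; rewrite lee_fin ltW.
  - exact: measurable_funTS.
  - by move=> x _; rewrite lee_fin.
  rewrite EFinD; apply: leeD => //; rewrite integral_cst// EFinM.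
  apply: lee_wpmul2l; first by rewrite lee_fin ltW.
  rewrite fineK ?ge0_fin_numE//; apply: le_measure; rewrite ?inE//.
  exact: inside_cells_sub.
rewrite /Nle /gradient_bound -powRrM mulVf ?gt_eqF ?(lt_trans ltr01)// powRr1; last first.
  apply: divr_ge0 (ltW c0); rewrite addr_ge0 ?mulr_ge0 ?fine_ge0 ?(ltW c'0)//.
  by rewrite exprn_ge0// mulr_ge0// addr_ge0// mulr_ge0.
by rewrite mulrC EFinM lee_pdivlMl.
Qed.

End energy_bound.

(** * Translation estimates for cellwise constant functions *)

(** The points whose sup distance to the complement is at least [r]. For [r <= 0] the ball is empty
    and this is the whole space. *)
Definition inner_part {R : realType} d (Omega : set 'cV[R]_d) (r : R) : set 'cV[R]_d :=
  [set x | ball x r `<=` Omega].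

Section translations.
Context {R : realType} (d m : nat) (p : R) (p_ge1 : 1 <= p).
Notation mu := (@lebesgue_cV R d).
Implicit Types (V Omega : set 'cV[R]_d) (f : 'cV[R]_d -> 'cV[R]_m) (v w h : 'cV[R]_d).

Lemma inner_part_le Omega r s : s <= r -> inner_part Omega r `<=` inner_part Omega s.
Proof. by move=> sr x Hx v xv; apply: Hx; exact: (le_ball sr). Qed.

Lemma inner_part_shift Omega r s v : `|v| <= s ->
  (fun x => x + v) @` inner_part Omega r `<=` inner_part Omega (r - s).
Proof.
move=> vs _ [x Hx <-] w; rewrite -ball_normE /ball_/= => xw; apply: Hx.
rewrite -ball_normE /ball_/= -(subrK v x) -addrA.
have -> : x - v + (v - w) = (x + v - w) - v by rewrite addrA subrK [RHS]addrAC addrK.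
by rewrite (le_lt_trans (ler_normB _ _))//; lra.
Qed.

Lemma measurable_shift f v : measurable_fun setT f -> measurable_fun setT (fun x : 'cV[R]_d => f (x + v)).
Proof. by move=> mf; exact: (measurableT_comp mf (measurable_addr_cV v)). Qed.

Lemma measurable_shift_set V v : measurable V -> measurable ((fun x : 'cV[R]_d => x + v) @^-1` V).
Proof. by move=> mV; rewrite -[X in measurable X]setTI; exact: measurable_addr_cV. Qed.

Lemma measurable_diff f v w : measurable_fun setT f ->
  measurable_fun setT (fun x : 'cV[R]_d => `|f (x + v) - f (x + w)|).
Proof. by move=> mf; apply: measurable_norm_funB; exact: measurable_shift. Qed.

Lemma measurable_diff0 f v : measurable_fun setT f ->
  measurable_fun setT (fun x : 'cV[R]_d => `|f (x + v) - f x|).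
Proof. by move=> mf; apply: measurable_norm_funB => //; exact: measurable_shift. Qed.

Lemma Nle_shift V (g : 'cV[R]_d -> R) v a : measurable V -> measurable_fun setT g ->
  Nle mu p ((fun x => x - v) @^-1` V) g a -> Nle mu p V (fun x => g (x + v)) a.
Proof.
move=> mV mg; rewrite /Nle => H; apply: le_trans H; rewrite le_eqVlt; apply/orP; left; apply/eqP.
rewrite -(@ge0_integral_shift _ _ v ((fun x => x - v) @^-1` V) (fun x => (`|g x| `^ p)%:E)).
- congr (integral _ _ _); apply/seteqP; split => x /=; by rewrite addrK.
- exact: measurable_shift_set.
- exact: measurable_normpow.
- by move=> x; rewrite lee_fin powR_ge0.
Qed.

Lemma Nle_triangle V f v w a b : measurable V -> measurable_fun setT f -> 0 <= a -> 0 <= b ->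
  Nle mu p V (fun x => `|f (x + v) - f x|) a ->
  Nle mu p V (fun x => `|f (x + v + w) - f (x + v)|) b ->
  Nle mu p V (fun x => `|f (x + (v + w)) - f x|) (a + b).
Proof.
move=> mV mf a0 b0 Ha Hb.
have mvw : measurable_fun setT (fun x : 'cV[R]_d => `|f (x + v + w) - f (x + v)|).
  by under eq_fun do rewrite -addrA; exact: measurable_diff.
apply: (NleD p_ge1 mV _ mvw _ _ a0 b0 Ha Hb).
- exact: measurable_diff0.
- exact: measurable_diff0.
- move=> x _; rewrite !normr_id addrA.
  have -> : f (x + v + w) - f x = (f (x + v) - f x) + (f (x + v + w) - f (x + v)).
    by rewrite [RHS]addrC addrA subrK.
  exact: ler_normD.
Qed.

Lemma Nle_subdivide V f h n a : measurable V -> measurable_fun setT f -> 0 <= a ->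
  (forall i, (i < n)%N -> Nle mu p V (fun x => `|f (x + i%:R *: h + h) - f (x + i%:R *: h)|) a) ->
  Nle mu p V (fun x => `|f (x + n%:R *: h) - f x|) (n%:R * a).
Proof.
move=> mV mf a0; elim: n => [_|n IH H].
  rewrite /Nle (eq_integral (cst 0%E)); last first.
    by move=> x _; rewrite scale0r addr0 subrr !normr0 powR0// gt_eqF// (lt_le_trans ltr01).
  by rewrite integral0 lee_fin powR_ge0.
have -> : n.+1%:R *: h = n%:R *: h + h by rewrite mulrSr scalerDl scale1r.
rewrite mulrSr mulrDl mul1r; apply: Nle_triangle => //.
- by rewrite mulr_ge0.
- by apply: IH => i ni; apply: H; rewrite ltnW.
- exact: H.
Qed.

End translations.

Section discrete_translation.
Context {R : realType} (d : nat) (p : R) (p_ge1 : 1 <= p).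
Variables (A : 'M[R]_d) (A_inv : A \in unitmx).
Variables (eps : R) (eps_gt0 : 0 < eps).
Variables (Omega : set 'cV[R]_d) (z : 'I_(2 ^ d) -> 'cV[R]_d).
Hypothesis Omega_open : open Omega.
Hypothesis z_corners : enumerates_corners A z.
Variable y : 'cV[R]_d -> 'cV[R]_d.
Hypothesis ycst : cellwise_constant A eps Omega y.
Variable C : R.
Hypothesis C0 : 0 <= C.
Notation mu := (@lebesgue_cV R d).
Hypothesis gradC : Nle mu p (inside_cells A eps Omega)
  (fun x => enorm (cell_gradient A eps z y x)) C.

Let Y x : 'cV[R]_d := if x \in Omega then y x else 0.
(** [kap * eps] bounds the distance of the points of a cell from its base point, and also the length
    of [s *: dir i] for [|s| <= eps]. *)
Let kap : R := d%:R * `|A| + 1.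
Let dir i : 'cV[R]_d := A *m delta_mx i ord0.

Let kap_gt0 : 0 < kap. Proof. by rewrite ltr_wpDl// mulr_ge0. Qed.

Let mY : measurable_fun setT Y.
Proof.
have H : forall a b, Omega a -> Omega b -> cell_index A eps a = cell_index A eps b -> y a = y b.
  by move=> a b Oa Ob ab; exact: (cellwise_constantP A_inv eps_gt0 ycst).
exact: (measurable_cell_ext eps_gt0 (open_measurable_cV Omega_open) H).
Qed.

Let dir_le i s : `|s *: dir i| <= `|s| * kap.
Proof.
rewrite normrZ ler_wpM2l//; apply: le_trans (mulmx_norm_le _ _) _.
rewrite (@le_trans _ _ (d%:R * `|A| * 1)) ?mulr1 ?lerDl//.
rewrite ler_piMr ?mulr_ge0//; apply/mx_norm_leP => // a b.
by rewrite mxE; case: (_ && _); rewrite ?normr0 ?normr1.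
Qed.

(** The cell of [x] lies within [kap * eps] of its base point, as does [x], so its closure stays
    within [2 * kap * eps] of [x]. *)
Let inner_inside r : 2 * kap * eps < r -> inner_part Omega r `<=` inside_cells A eps Omega.
Proof.
move=> er x Hx v; rewrite cellE// cell_index_center// => clv.
apply: Hx; rewrite -ball_normE /ball_/=; apply: le_lt_trans er.
rewrite leNgt; apply/negP => xv.
pose e := `|x - v| - 2 * kap * eps; have e0 : 0 < e by rewrite /e; lra.
have [w [/= qw vw]] := clv _ (nbhsx_ballx v _ e0).
have := cell_index_ball A_inv eps_gt0 (k := cell_index A eps x) qw.
have := cell_index_ball A_inv eps_gt0 (k := cell_index A eps x) (erefl : [set _ | _] x).
move: vw; rewrite -!ball_normE /ball_/= -/kap.
set b := cell_base _ _ _ => vw bx bw.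
have : `|x - v| <= `|b - x| + `|b - w| + `|v - w|.
  have -> : x - v = - (b - x) + (b - w) - (v - w).
    by apply/matrixP => i j; rewrite !mxE; ring.
  by rewrite (le_trans (ler_normB _ _))// lerD2r (le_trans (ler_normD _ _))// normrN.
rewrite /e in vw; lra.
Qed.

Let step_pos V r i s : measurable V -> V `<=` inner_part Omega r -> 2 * kap * eps < r ->
  0 <= s <= eps -> Nle mu p V (fun x => `|Y (x + s *: dir i) - Y x|) (2 * eps * C).
Proof.
move=> mV Vr er s01.
have k0 := kap_gt0; have e0 := eps_gt0.
have r0 : 0 < r by apply: le_lt_trans er; rewrite !mulr_ge0// ltW.
have mg : measurable_fun setT (fun x : 'cV[R]_d => enorm (cell_gradient A eps z y x)).
  exact: (@measurable_cell_fun _ _ A _ e0 _ (measurableTypeR R) (fun k => enorm (discrete_gradient eps z y (cell_center A eps k)))).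
have mI : measurable (inside_cells A eps Omega).
  by apply: (measurable_cell_set A e0 [set k | closure (cell A eps (cell_center A eps k)) `<=` Omega]).
have := NleZ (p := p) (2 * eps) mI mg C0 gradC.
rewrite ger0_norm ?mulr_ge0 ?(ltW e0)//.
apply: Nle_mono => //.
- exact: measurable_diff0.
- exact: measurable_funM.
- exact: subset_trans (inner_inside er).
- move=> x Vx; rewrite normr_id ger0_norm ?mulr_ge0 ?enorm_ge0 ?(ltW e0)//.
  have Ox : Omega x by apply: (Vr _ Vx); exact: ballxx.
  have Ox' : Omega (x + s *: dir i).
    apply: (Vr _ Vx); rewrite -ball_normE /ball_/= opprD addrA subrr sub0r normrN.
    apply: le_lt_trans (dir_le _ _) _; apply: le_lt_trans er; move/andP : s01 => [s0 s1].
    by rewrite ger0_norm// [leRHS]mulrC ler_pM ?(ltW k0)//; lra.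
  rewrite /Y !mem_set//=; apply: (discrete_step_le A_inv eps_gt0 z_corners ycst) => //.
  exact: (inner_inside er (Vr _ Vx)).
- by rewrite lexx mulr_ge0// mulr_ge0// ltW.
Qed.

(** A backward step is a forward step seen from its end point. Moving the base to that end point
    costs one more [kap * eps], whence the factor 3. *)
Let step_le V r i s : measurable V -> V `<=` inner_part Omega r -> 3 * kap * eps < r ->
  `|s| <= eps -> Nle mu p V (fun x => `|Y (x + s *: dir i) - Y x|) (2 * eps * C).
Proof.
move=> mV Vr er s1; have k0 := kap_gt0; have e0 := eps_gt0.
have ke : 0 < kap * eps by exact: mulr_gt0.
have [s0|s0] := leP 0 s.
  by apply: (step_pos (r := r)) => //; [lra|rewrite s0 (le_trans (ler_norm s))].
rewrite (_ : (fun x => _) = (fun x => (fun x => `|Y (x + (- s) *: dir i) - Y x|) (x + s *: dir i))); last first.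
  by apply/funext => x; rewrite -addrA -scalerDl subrr scale0r addr0 distrC.
apply: (@Nle_shift _ _ p V (fun x => `|Y (x + (- s) *: dir i) - Y x|) (s *: dir i)) => //; first exact: measurable_diff0.
apply: (step_pos (r := r - kap * eps)) => //.
- exact: measurable_shift_set.
- move=> x /= Vx; rewrite -[x](subrK (s *: dir i)).
  apply: inner_part_shift; last by exists (x - s *: dir i) => //; exact: Vr.
  by rewrite (le_trans (dir_le _ _))// mulrC ler_wpM2l ?(ltW k0)// ltW.
- lra.
- by move: s1; rewrite ltr0_norm// => s1; rewrite s1 andbT; lra.
Qed.

Let line_le V r i s : measurable V -> V `<=` inner_part Omega r ->
  kap * (`|s| + 3 * eps) < r ->
  Nle mu p V (fun x => `|Y (x + s *: dir i) - Y x|) (2 * C * (`|s| + eps)).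
Proof.
move=> mV Vr er; have k0 := kap_gt0; have e0 := eps_gt0.
(* The number of steps of length at most [eps] is rounded up; this leaves the additive [eps] in the
   bound, since [n * eps <= |s| + eps]. *)
pose n := (Num.truncn (`|s| / eps)).+1; pose t := s / n%:R.
have n0 : 0 < n%:R :> R by rewrite ltr0n.
have sn : `|s| / eps < n%:R by exact: truncnS_gt.
have ns : n%:R <= `|s| / eps + 1.
  by rewrite /n mulrSr lerD2r truncn_le divr_ge0// ltW.
have tn : n%:R * t = s by rewrite /t mulrCA divff ?mulr1// gt_eqF.
have te : `|t| <= eps.
  rewrite /t normrM normfV (gtr0_norm n0) ler_pdivrMr// -ler_pdivrMl// mulrC.
  exact: ltW.
have := @Nle_subdivide _ d d p p_ge1 V Y (t *: dir i) n (2 * eps * C) mV mY.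
rewrite scalerA tn => H.
apply: (Nle_mono p_ge1 mV mV _ _ _ _ _ (H _ _)) => //.
- exact: measurable_diff0.
- exact: measurable_diff0.
- apply/andP; split; first by rewrite mulr_ge0 ?(ltW n0)// mulr_ge0// mulr_ge0// ltW.
  have -> : n%:R * (2 * eps * C) = 2 * C * (n%:R * eps) by ring.
  rewrite ler_wpM2l ?mulr_ge0//.
  by move: (ns) => {}ns; rewrite -(ler_pM2r e0) mulrDl divfK ?gt_eqF// mul1r in ns.
- by rewrite mulr_ge0// mulr_ge0// ltW.
move=> l ln.
pose v := l%:R *: (t *: dir i).
have vs : `|v| <= kap * `|s|.
  rewrite /v scalerA (le_trans (dir_le _ _))// mulrC ler_wpM2l ?(ltW k0)//.
  by rewrite -tn !normrM ler_wpM2r// !ger0_norm// ler_nat ltnW.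
apply: (@Nle_shift _ _ p V (fun x => `|Y (x + t *: dir i) - Y x|) v) => //.
  exact: measurable_diff0.
apply: (step_le (r := r - kap * `|s|)) => //.
- exact: measurable_shift_set.
- move=> x /= Vx; rewrite -[x](subrK v).
  by apply: (inner_part_shift vs); exists (x - v) => //; exact: Vr.
- by rewrite ltrBrDl; apply: le_lt_trans er; lra.
Qed.

(** The displacement is carried out one lattice coordinate at a time. The path drifts from [x] by up
    to [|s| * kap] per coordinate, which the factor [d.+1] in the hypothesis on [r] allows for. *)
Let coord_le V r (s : 'cV[R]_d) : measurable V -> V `<=` inner_part Omega r ->
  kap * (d.+1%:R * (`|s| + 3 * eps)) < r ->
  Nle mu p V (fun x => `|Y (x + A *m s) - Y x|) (d%:R * (2 * C * (`|s| + eps))).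
Proof.
move=> mV Vr er; have k0 := kap_gt0; have e0 := eps_gt0.
pose S n : 'cV[R]_d := \col_i (if (i < n)%N then s i ord0 else 0).
have -> : s = S d by apply/colP => i; rewrite mxE ltn_ord.
have Ss : `|S d| = `|s| by congr (`|_|); apply/colP => i; rewrite mxE ltn_ord.
rewrite Ss.
suff H n : (n <= d)%N -> `|A *m S n| <= n%:R * (`|s| * kap) /\
    Nle mu p V (fun x => `|Y (x + A *m S n) - Y x|) (n%:R * (2 * C * (`|s| + eps))).
  exact: (H d (leqnn d)).2.
elim: n => [_|n IH nd].
  have -> : S 0%N = 0 by apply/colP => i; rewrite !mxE.
  rewrite mulmx0 normr0 !mul0r; split=> //.
  rewrite /Nle (eq_integral (cst 0%E)); last first.
    by move=> x _; rewrite addr0 subrr !normr0 powR0// gt_eqF// (lt_le_trans ltr01).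
  by rewrite integral0 lee_fin powR_ge0.
have [I1 I2] := IH (ltnW nd).
pose i := Ordinal nd; pose t := s i ord0.
have ts : `|t| <= `|s| by exact: ler_mx_norm.
have SE : A *m S n.+1 = A *m S n + t *: dir i.
  rewrite /dir scalemxAr -mulmxDr; congr (_ *m _); apply/colP => l; rewrite !mxE eqxx andbT.
  rewrite ltnS leq_eqVlt -(inj_eq val_inj)/= orbC.
  case: ltngtP => //= ln; rewrite ?mulr0 ?mulr1 ?addr0 ?add0r//.
  by rewrite /t; congr (s _ _); apply: val_inj.
rewrite SE; split.
  rewrite (le_trans (ler_normD _ _))// mulrSr mulrDl mul1r lerD//.
  by rewrite (le_trans (dir_le _ _))// ler_wpM2r// ltW.
rewrite mulrSr mulrDl mul1r; apply: Nle_triangle => //.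
- by rewrite mulr_ge0// !mulr_ge0// addr_ge0// ltW.
- by rewrite !mulr_ge0// addr_ge0// ltW.
pose v := A *m S n.
apply: (@Nle_shift _ _ p V (fun x => `|Y (x + t *: dir i) - Y x|) v) => //.
  exact: measurable_diff0.
have : Nle mu p ((fun x => x - v) @^-1` V) (fun x => `|Y (x + t *: dir i) - Y x|) (2 * C * (`|t| + eps)).
  apply: (line_le (r := r - n%:R * (`|s| * kap))) => //.
  - exact: measurable_shift_set.
  - move=> x /= Vx; rewrite -[x](subrK v).
    by apply: (inner_part_shift I1); exists (x - v) => //; exact: Vr.
  - rewrite ltrBrDl; apply: le_lt_trans er.
    have -> : n%:R * (`|s| * kap) + kap * (`|t| + 3 * eps) = kap * (n%:R * `|s| + (`|t| + 3 * eps)) by ring.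
    rewrite ler_wpM2l ?(ltW k0)// mulrDr.
    have h1 : n.+1%:R * `|s| <= d.+1%:R * `|s| by rewrite ler_wpM2r// ler_nat ltnW.
    have h2 : 1 * (3 * eps) <= d.+1%:R * (3 * eps) by rewrite ler_wpM2r ?ler1n// mulr_ge0// ltW.
    by move: h1; rewrite [n.+1%:R]mulrSr mulrDl mul1r; lra.
apply: Nle_mono => //.
- exact: measurable_shift_set.
- exact: measurable_shift_set.
- exact: measurable_diff0.
- exact: measurable_diff0.
- rewrite mulr_ge0 ?mulr_ge0// ?addr_ge0 ?(ltW e0)//= ler_wpM2l ?mulr_ge0// lerD2r//.
Qed.

(** The lattice coordinates of [h] are at most [d * |invmx A| * |h|]. Inserted into the margin and
    the bound of [coord_le], this gives the reach, which measures the distance to be kept from the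
    complement, and the factor. *)
Definition translation_reach : R := kap * d.+1%:R * (d%:R * `|invmx A| + 3).
Definition translation_factor : R := d%:R * 2 * (d%:R * `|invmx A| + 1).

Lemma discrete_translation V r (h : 'cV[R]_d) : measurable V -> V `<=` inner_part Omega r ->
  translation_reach * (`|h| + eps) < r ->
  Nle mu p V (fun x => `|Y (x + h) - Y x|) (translation_factor * C * (`|h| + eps)).
Proof.
move=> mV Vr er; have k0 := kap_gt0; have e0 := eps_gt0.
pose s := invmx A *m h; have sh : `|s| <= d%:R * `|invmx A| * `|h| by exact: mulmx_norm_le.
set l := d%:R * `|invmx A| in sh.
have l0 : 0 <= l by rewrite mulr_ge0.
have lh : 0 <= l * `|h| by rewrite mulr_ge0.
have le : 0 <= l * eps by rewrite mulr_ge0// ltW.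
have := @coord_le V r s mV Vr.
rewrite /s mulKVmx// -/s => H.
apply: (Nle_mono p_ge1 mV mV _ _ _ _ _ (H _)) => //.
- exact: measurable_diff0.
- exact: measurable_diff0.
- apply/andP; split; first by rewrite mulr_ge0// mulr_ge0 ?mulr_ge0// addr_ge0// ltW.
  rewrite /translation_factor -/l.
  have -> : d%:R * 2 * (l + 1) * C * (`|h| + eps) = d%:R * (2 * C * ((l + 1) * (`|h| + eps))) by ring.
  rewrite ler_wpM2l// ler_wpM2l ?mulr_ge0//.
  have := normr_ge0 h; lra.
- apply: le_lt_trans er; rewrite /translation_reach -/l -!mulrA ler_wpM2l ?(ltW k0)// ler_wpM2l//.
  have := normr_ge0 h; lra.
Qed.

End discrete_translation.

(** * Compactness in L^p from translation estimates *)

Section averaging.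
Context d (T : measurableType d) {R : realType} (mu : {measure set T -> \bar R}).

(** Chebyshev's argument: if [G] exceeded twice the mean bound [a / b] on all of [B], its integral
    would be at least [2 * a]. *)
Lemma averaging (B : set T) (G : T -> \bar R) (a b : R) : measurable B ->
  measurable_fun setT G -> (forall x, 0 <= G x)%E -> 0 < a -> 0 < b -> mu B = b%:E ->
  (\int[mu]_(x in B) G x <= a%:E)%E -> exists2 t, B t & (G t <= (2 * a / b)%:E)%E.
Proof.
move=> mB mG G0 a0 b0 muB GB; apply: contrapT => H.
have HB t : B t -> ((2 * a / b)%:E <= G t)%E.
  move=> Bt; rewrite leNgt; apply/negP => /ltW Gt; apply: H; by exists t.
have : (\int[mu]_(x in B) (2 * a / b)%:E <= a%:E)%E.
  apply: le_trans GB; apply: ge0_le_integral => //.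
  - by move=> x _; rewrite lee_fin divr_ge0 ?mulr_ge0// ltW.
  - exact: measurable_funTS.
rewrite integral_cst// muB -EFinM lee_fin divfK ?gt_eqF//; lra.
Qed.

End averaging.

Section oscillation.
Context {R : realType} (d m : nat) (p : R) (p_ge1 : 1 <= p).
Notation mu := (@lebesgue_cV R d).
Variables (f : 'cV[R]_d -> 'cV[R]_m).
Hypothesis mf : measurable_fun setT f.

Let p0 : 0 < p. Proof. exact: lt_le_trans p_ge1. Qed.

(** This links two kinds of information: integrated in [s] it is controlled by translation bounds
    ([osc_le]), while for fixed [s] it dominates the p-th power distance from [f s] to the nearby
    values ([osc_ball]). *)
Definition osc (r : R) (s : 'cV[R]_d) : \bar R :=
  (\int[mu]_(h in ball 0%R r) (`|f (s + h)%R - f s| `^ p)%:E)%E.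

Let g (sh : 'cV[R]_d * 'cV[R]_d) : R := `|f (sh.1 + sh.2) - f sh.1| `^ p.

Let mg : measurable_fun setT g.
Proof.
apply: (measurableT_comp (measurable_powR p)).
apply: measurable_norm_funB.
  exact: (measurableT_comp mf (@measurable_add_cV R d)).
exact: (measurableT_comp mf measurable_fst).
Qed.

Let g0 (sh : 'cV[R]_d * 'cV[R]_d) : (0 <= (g sh)%:E)%E.
Proof. by rewrite lee_fin powR_ge0. Qed.

(** The restriction to the ball is moved into the integrand, so that Tonelli's theorem applies on
    the whole product space. *)
Let gr (r : R) (sh : 'cV[R]_d * 'cV[R]_d) : \bar R :=
  if sh.2 \in (ball 0 r : set 'cV[R]_d) then (g sh)%:E else 0%E.

Let mem_measurable (V : set 'cV[R]_d) : measurable V ->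
  measurable_fun setT (fun x : 'cV[R]_d => x \in V).
Proof.
move=> mV; apply: (measurable_fun_bool true); rewrite setTI (_ : _ @^-1` _ = V)//.
by apply/seteqP; split => x /=; [move=> /set_mem|move=> ?; apply: mem_set].
Qed.

Let mgr r : measurable_fun setT (gr r).
Proof.
apply: measurable_fun_ifT => //; last exact/measurable_EFinP.
exact: (measurableT_comp (mem_measurable (measurable_ball_cV 0 r)) measurable_snd).
Qed.

Let gr0 r sh : (0 <= gr r sh)%E.
Proof. by rewrite /gr; case: ifP. Qed.

Let oscE r s : osc r s = (\int[mu]_h gr r (s, h))%E.
Proof.
rewrite /osc integral_mkcond; apply: eq_integral => h _.
by rewrite patchE /gr /=; case: ifP.
Qed.

Lemma measurable_osc r : measurable_fun setT (osc r).
Proof.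
rewrite (_ : osc r = (fun s => \int[mu]_h gr r (s, h))%E); last by apply/funext => s; exact: oscE.
exact: (measurable_fun_fubini_tonelli_F (m2 := mu) (gr r) (mgr r) (gr0 r)).
Qed.

Lemma osc_ge0 r s : (0 <= osc r s)%E.
Proof. by apply: integral_ge0 => h _; rewrite lee_fin powR_ge0. Qed.

Lemma osc_le (E : set 'cV[R]_d) (r C : R) : measurable E -> 0 < r -> 0 <= C ->
  (forall h, `|h| < r -> Nle mu p E (fun x => `|f (x + h) - f x|) C) ->
  (\int[mu]_(s in E) osc r s <= ((2 * r) ^+ d * C `^ p)%:E)%E.
Proof.
move=> mE r0 C0 H.
pose k (sh : 'cV[R]_d * 'cV[R]_d) : \bar R := if sh.1 \in E then gr r sh else 0%E.
have mk : measurable_fun setT k.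
  apply: measurable_fun_ifT => //.
  exact: (measurableT_comp (mem_measurable mE) measurable_fst).
have k0 sh : (0 <= k sh)%E by rewrite /k; case: ifP.
rewrite (_ : (\int[mu]_(s in E) osc r s)%E = (\int[mu]_s \int[mu]_h k (s, h))%E); last first.
  rewrite integral_mkcond; apply: eq_integral => s _.
  rewrite patchE /k /=; case: ifP => _; first exact: oscE.
  by rewrite integral0.
rewrite (fubini_tonelli k)//.
apply: (@le_trans _ _ (\int[mu]_(h in ball 0%R r) (C `^ p)%:E)%E); last first.
  rewrite integral_cst; last exact: measurable_ball_cV.
  rewrite mulrC EFinM; apply: lee_wpmul2l; first by rewrite lee_fin powR_ge0.
  by rewrite le_eqVlt; apply/orP; left; apply/eqP; exact: lebesgue_cV_ball.
rewrite [leRHS]integral_mkcond; apply: ge0_le_integral => //.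
- by move=> h _; exact: integral_ge0.
- exact: (measurable_fun_fubini_tonelli_G (m1 := mu) k mk k0).
- apply/(measurable_restrictT _ _).1 => //; exact: measurable_ball_cV.
- move=> h _; rewrite patchE; case: ifPn => hr.
    have hr' : `|h| < r.
      by move/set_mem : hr; rewrite -ball_normE /ball_/= sub0r normrN.
    apply: le_trans (H _ hr'); rewrite le_eqVlt; apply/orP; left; apply/eqP.
    rewrite [RHS]integral_mkcond; apply: eq_integral => s _.
    by rewrite patchE /k /gr /= hr; case: ifP => //; rewrite normr_id.
  rewrite (eq_integral (cst 0%E)) ?integral0// => s _.
  by rewrite /k /gr /= (negbTE hr); case: ifP.
Qed.

Lemma osc_ball (B : set 'cV[R]_d) (r : R) (s : 'cV[R]_d) : measurable B -> B `<=` ball s r ->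
  (\int[mu]_(t in B) (`|f s - f t| `^ p)%:E <= osc r s)%E.
Proof.
move=> mB Br; rewrite /osc.
have mfs : measurable_fun setT (fun t : 'cV[R]_d => (`|f s - f t| `^ p)%:E).
  apply/measurable_EFinP; apply: (measurableT_comp (measurable_powR p)).
  by apply: measurable_norm_funB => //; exact: measurable_cst.
have F0 t : (0 <= (`|f s - f t| `^ p)%:E)%E by rewrite lee_fin powR_ge0.
have S := @ge0_integral_shift R d s B (fun t => (`|f s - f t| `^ p)%:E) mB mfs F0.
apply: (@le_trans _ _ (\int[mu]_(h in (fun x => (x + s)%R) @^-1` B) (`|f (s + h)%R - f s| `^ p)%:E)%E).
  rewrite le_eqVlt; apply/orP; left; apply/eqP; apply: etrans (esym S) _.
  by apply: eq_integral => h _; rewrite distrC (addrC h s).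
apply: ge0_subset_integral.
- exact: measurable_shift_set.
- exact: measurable_ball_cV.
- apply: measurable_funTS; apply/measurable_EFinP; apply: (measurableT_comp (measurable_powR p)).
  apply: measurable_norm_funB; last exact: measurable_cst.
  have E : (fun h : 'cV[R]_d => f (s + h)) = (fun h : 'cV[R]_d => f (h + s)).
    by apply/funext => h; rewrite addrC.
  by rewrite E; exact: measurable_shift.
- by move=> h _; rewrite lee_fin powR_ge0.
- move=> h /= /Br; rewrite -!ball_normE /ball_/= sub0r normrN.
  by rewrite opprD addrCA subrr addr0 normrN.
Qed.

(** [averaging] is applied to the sum of the two quantities, so one point [t] serves both: [f] is
    close to the constant [f t] on [E], and [f t] is not far from [c0]. The weight [lam] balances
    them: 0 when there is no reference value yet, 1 to carry a bound along, and small when the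
    second term must not spoil the first. *)
Lemma good_point (E B : set 'cV[R]_d) (c0 : 'cV[R]_m) (x0 : 'cV[R]_d) (dl a b M lam : R) :
  measurable E -> measurable B -> E `<=` ball x0 dl -> B `<=` ball x0 dl ->
  0 < a -> 0 < b -> 0 <= lam -> 0 <= M -> mu B = b%:E ->
  (\int[mu]_(s in E) osc (2 * dl) s <= a%:E)%E ->
  (lam%:E * \int[mu]_(t in B) (`|f t - c0| `^ p)%:E <= M%:E)%E ->
  exists2 t, B t & (\int[mu]_(s in E) (`|f s - f t| `^ p)%:E + (lam * `|f t - c0| `^ p)%:E
    <= (2 * (a + M) / b)%:E)%E.
Proof.
move=> mE mB Ex Bx a0 b0 lam0 M0 muB Ea BM.
have EB s t : E s -> B t -> `|s - t| < 2 * dl.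
  move=> /Ex; rewrite -ball_normE /ball_/= => sx /Bx; rewrite -ball_normE /ball_/= => tx.
  have -> : s - t = (x0 - t) - (x0 - s) by rewrite opprB [RHS]addrC addrA subrK.
  by rewrite (le_lt_trans (ler_normB _ _))//; lra.
clear Ex Bx.
pose k (st : 'cV[R]_d * 'cV[R]_d) : \bar R :=
  if (st.1 \in E) && (st.2 \in B) then (`|f st.1 - f st.2| `^ p)%:E else 0%E.
have mk : measurable_fun setT k.
  apply: measurable_fun_ifT => //.
    apply: measurable_and.
      exact: (measurableT_comp (mem_measurable mE) measurable_fst).
    exact: (measurableT_comp (mem_measurable mB) measurable_snd).
  apply/measurable_EFinP; apply: (measurableT_comp (measurable_powR p)).
  apply: measurable_norm_funB; first exact: (measurableT_comp mf measurable_fst).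
  exact: (measurableT_comp mf measurable_snd).
have k0 st : (0 <= k st)%E by rewrite /k; case: ifP => // _; rewrite lee_fin powR_ge0.
pose G t : \bar R := ((\int[mu]_s k (s, t)) + (lam * `|f t - c0| `^ p)%:E)%E.
have mI : measurable_fun setT (fun t => \int[mu]_s k (s, t))%E.
  exact: (measurable_fun_fubini_tonelli_G (m1 := mu) k mk k0).
have mc : measurable_fun setT (fun t : 'cV[R]_d => (`|f t - c0| `^ p)%:E).
  apply/measurable_EFinP; apply: (measurableT_comp (measurable_powR p)).
  by apply: measurable_norm_funB => //; exact: measurable_cst.
have mlc : measurable_fun setT (fun t : 'cV[R]_d => (lam * `|f t - c0| `^ p)%:E).
  by under eq_fun do rewrite EFinM; exact: measurable_funeM.
have G0 t : (0 <= G t)%E.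
  by apply: adde_ge0; [exact: integral_ge0|rewrite lee_fin mulr_ge0 ?powR_ge0].
have mG : measurable_fun setT G by exact: emeasurable_funD.
have GB : (\int[mu]_(t in B) G t <= (a + M)%:E)%E.
  rewrite ge0_integralD//; first last.
  - exact: measurable_funTS.
  - by move=> t _; rewrite lee_fin mulr_ge0 ?powR_ge0.
  - exact: measurable_funTS.
  - by move=> t _; exact: integral_ge0.
  rewrite EFinD; apply: leeD; last first.
    under eq_integral do rewrite EFinM.
    rewrite ge0_integralZl_EFin//; exact: measurable_funTS.
  rewrite (_ : (\int[mu]_(t in B) \int[mu]_s k (s, t))%E = (\int[mu]_t \int[mu]_s k (s, t))%E); last first.
    rewrite integral_mkcond; apply: eq_integral => t _; rewrite patchE; case: ifPn => // tB.
    rewrite (eq_integral (cst 0%E)) ?integral0// => s _.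
    by rewrite /k /= (negbTE tB) andbF.
  have FT := @fubini_tonelli _ _ _ _ R mu mu k mk k0.
  apply: (@le_trans _ _ (\int[mu]_s \int[mu]_t k (s, t))%E).
    by rewrite le_eqVlt; apply/orP; left; apply/eqP; exact: esym FT.
  apply: le_trans Ea.
  rewrite [leRHS]integral_mkcond; apply: ge0_le_integral.
  - exact: measurableT.
  - by move=> s _; exact: integral_ge0.
  - exact: (measurable_fun_fubini_tonelli_F (m2 := mu) k mk k0).
  - have mo0 := measurable_osc (2 * dl).
    have mo := measurable_funS measurableT (@subsetT _ E) mo0.
    exact: (proj1 (measurable_restrictT _ mE) mo).
  - move=> s _; rewrite patchE; case: ifPn => sE; last first.
      have Z t : k (s, t) = 0%E by rewrite /k /= (negbTE sE).
      have -> : (\int[mu]_t k (s, t) = 0)%E by apply: integral0_eq => t _; exact: Z.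
      exact: lexx.
    apply: le_trans (osc_ball (B := B) (r := 2 * dl) mB _).
      rewrite [leRHS]integral_mkcond le_eqVlt; apply/orP; left; apply/eqP.
      by apply: eq_integral => t _; rewrite patchE /k /= sE; case: ifP.
    by move=> t Bt; rewrite -ball_normE /ball_/=; apply: EB Bt; exact: set_mem.
have aM : 0 < a + M by rewrite ltr_wpDr.
have [t Bt Gt] := averaging mB mG G0 aM b0 muB GB.
exists t => //; apply: le_trans Gt; rewrite /G; apply: leeD => //.
rewrite integral_mkcond le_eqVlt; apply/orP; left; apply/eqP; apply: eq_integral => s _.
by rewrite patchE /k /= (mem_set Bt) andbT.
Qed.

End oscillation.

Lemma powR_invK {R : realType} (p a : R) : p != 0 -> 0 <= a -> (a `^ p^-1) `^ p = a.
Proof. by move=> p0 a0; rewrite -powRrM mulVf// powRr1. Qed.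

Section partition.
Context {R : realType} (d : nat).
Notation mu := (@lebesgue_cV R d).

Lemma finite_partition (x : 'cV[R]_d) (r dl : R) : 0 < r -> 0 < dl ->
  exists (N : nat) (s : nat -> 'cV[R]_d) (E : nat -> set 'cV[R]_d),
  [/\ forall k, measurable (E k), forall k, E k `<=` ball (s k) dl,
      forall k, `|x - s k| <= r &
      forall g : 'cV[R]_d -> \bar R, measurable_fun setT g -> (forall v, 0 <= g v)%E ->
      (\int[mu]_(v in ball x r) g v = \sum_(k < N) \int[mu]_(v in E k) g v)%E].
Proof.
move=> r0 dl0; pose K : set 'cV[R]_d := [set v | `|x - v| <= r].
have cK : compact K.
  apply: compact_cV.
    exists (`|x| + r); split; first exact: num_real.
    move=> t tr v /= xv; apply: (@le_trans _ _ (`|x| + r)); last exact: ltW.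
    have -> : `|v| = `|x - (x - v)| by rewrite subKr.
    by apply: le_trans (ler_normB _ _) _; rewrite lerD2l.
  have -> : K = (fun v : 'cV[R]_d => `|x - v|) @^-1` [set t | t <= r] by [].
  apply: closed_comp; last exact: closed_le.
  move=> v _; have FF := nbhs_filter v; apply/cvgrPdist_lt => t t0.
  apply: filterS (nbhsx_ballx v _ t0) => w; rewrite -ball_normE /ball_/= => vw.
  apply: (le_lt_trans (ler_dist_dist _ _)).
  have -> : x - v - (x - w) = w - v by rewrite opprB addrC addrA subrK.
  by rewrite distrC.
pose P (B : set 'cV[R]_d) := exists l : seq 'cV[R]_d, (forall v, v \in l -> K v) /\
  forall w, K w -> B w -> exists2 v, v \in l & ball v dl w.
have [l [lK Kl]] : P K.
  apply: (compact_ind cK).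
  - by exists [::].
  - move=> B1 B2 [l1 [H1 G1]] [l2 [H2 G2]]; exists (l1 ++ l2); split.
      by move=> v; rewrite mem_cat => /orP[/H1|/H2].
    move=> w Kw [B1w|B2w].
      by have [v vl vw] := G1 _ Kw B1w; exists v; rewrite // mem_cat vl.
    by have [v vl vw] := G2 _ Kw B2w; exists v; rewrite // mem_cat vl orbT.
  - by move=> B1 B2 B12 [l1 [H1 G1]]; exists l1; split => // w Kw /B12; exact: G1.
  - move=> v Kv; exists (ball v dl); first exact: nbhsx_ballx.
    exists [:: v]; split; first by move=> w; rewrite inE => /eqP ->.
    by move=> w _ vw; exists v; rewrite // mem_head.
have xK : K x by rewrite /K/= subrr normr0 ltW.
(* The default [x] satisfies the same bound, so nothing has to be said about indices beyond the
   list. *)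
pose s k := nth x l k.
pose F k : set 'cV[R]_d := ball x r `&` ball (s k) dl.
have mF k : measurable (F k) by apply: measurableI; exact: measurable_ball_cV.
exists (size l), s, (seqDU F); split.
- by move=> k; apply: seqDU_measurable.
- by move=> k v [[_ H] _].
- move=> k; rewrite /s; have [kl|kl] := ltnP k (size l); first exact/lK/mem_nth.
  by rewrite nth_default// subrr normr0 ltW.
move=> g mg g0.
have EU : ball x r = \big[setU/set0]_(k < size l) seqDU F k.
  rewrite -bigsetU_seqDU -(bigcup_mkord (size l) F); apply/seteqP; split => v; last by move=> [k _ []].
  move=> xv; have Kv : K v by move: xv; rewrite -ball_normE /ball_/= => /ltW.
  have [w wl vw] := Kl _ Kv Kv; exists (index w l) => /=; first by rewrite index_mem.
  by split => //; rewrite /s nth_index.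
rewrite EU ge0_integral_bigsetU//.
- by move=> k; apply: seqDU_measurable.
- exact: index_enum_uniq.
- apply/trivIsetP => i j _ _ ij; have /trivIsetP := trivIset_seqDU F.
  by apply => //; rewrite (inj_eq val_inj).
- exact: measurable_funTS.
Qed.

End partition.

(** A cluster point of an ultrafilter is its limit: if the set of indices close to [l] were not in
    [U], its complement would be. *)
Lemma ultra_limit {R : realType} m (U : set_system nat) (w : nat -> 'cV[R]_m) (L : R) :
  UltraFilter U -> U [set n | `|w n| <= L] ->
  exists l, forall tau, 0 < tau -> U [set n | `|w n - l| <= tau].
Proof.
move=> UU UL.
have cK : compact [set v : 'cV[R]_m | `|v| <= L].
  apply: compact_cV.
    exists L; split; first exact: num_real.
    by move=> t Lt v /= vL; exact: le_trans (ltW Lt).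
  have -> : [set v : 'cV[R]_m | `|v| <= L] = (fun v : 'cV[R]_m => `|v|) @^-1` [set t | t <= L] by [].
  apply: closed_comp; last exact: closed_le.
  by move=> v _; exact: norm_continuous.
have [l [_ Hl]] := cK (w @ U) _ UL.
exists l => tau tau0.
have [//|UC] := in_ultra_setVsetC [set n | `|w n - l| <= tau] UU.
have [v [/= vt]] := Hl [set v | ~ (`|v - l| <= tau)] _ UC (nbhsx_ballx l _ tau0).
by rewrite -ball_normE /ball_/= distrC => /ltW.
Qed.

Lemma powR_add3 {R : realType} (p a b c : R) : 0 <= p -> 0 <= a -> 0 <= b -> 0 <= c ->
  (a + b + c) `^ p <= 3 `^ p * (a `^ p + b `^ p + c `^ p).
Proof.
move=> p0 a0 b0 c0; pose t := Num.max a (Num.max b c).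
have ta : a <= t by rewrite le_max lexx.
have tb : b <= t by rewrite !le_max lexx orbT.
have tc : c <= t by rewrite !le_max lexx !orbT.
have t0 : 0 <= t by exact: le_trans ta.
apply: (@le_trans _ _ ((3 * t) `^ p)).
  have h : a + b + c <= 3 * t by move: (t) ta tb tc => u ua ub uc; lra.
  apply: ge0_ler_powR h => //; rewrite nnegrE; first by rewrite !addr_ge0.
  by rewrite mulr_ge0.
rewrite powRM// ler_wpM2l ?powR_ge0//.
have ap := powR_ge0 a p; have bp := powR_ge0 b p; have cp := powR_ge0 c p.
by rewrite /t /Order.max; repeat case: ifP => _; lra.
Qed.

Lemma measurable_normpow_cV {R : realType} d (T : measurableType d) m (p : R) (g : T -> 'cV[R]_m) :
  measurable_fun setT g -> measurable_fun setT (fun x => (`|g x| `^ p)%:E).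
Proof.
move=> mg; apply/measurable_EFinP; apply: (measurableT_comp (measurable_powR p)).
exact: (measurableT_comp (@measurable_norm_cV R m) mg).
Qed.

Section translation_family.
Context {R : realType} (d m : nat) (p : R) (p_ge1 : 1 <= p).
Notation mu := (@lebesgue_cV R d).
Variables (Omega : set 'cV[R]_d) (f : nat -> 'cV[R]_d -> 'cV[R]_m).
Variables (e : nat -> R) (K0 C1 : R).
Hypothesis Omega_open : open Omega.
Hypothesis mf : forall n, measurable_fun setT (f n).
Hypothesis e0 : forall n, 0 < e n.
Hypothesis ecvg : e n @[n --> \oo] --> 0.
Hypotheses (K0_gt0 : 0 < K0) (C1_ge0 : 0 <= C1).
Hypothesis ftr : forall n V r h, measurable V -> V `<=` inner_part Omega r ->
  K0 * (`|h| + e n) < r -> Nle mu p V (fun x => `|f n (x + h) - f n x|) (C1 * (`|h| + e n)).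

Let p0 : 0 < p. Proof. exact: lt_le_trans p_ge1. Qed.

Lemma inner_part_ball (x : 'cV[R]_d) r : ball x (2 * r) `<=` Omega -> ball x r `<=` inner_part Omega r.
Proof.
move=> H v; rewrite -ball_normE /ball_/= => xv w; rewrite -ball_normE /ball_/= => vw.
apply: H; rewrite -ball_normE /ball_/= -(subrK v x) -addrA.
by rewrite (le_lt_trans (ler_normD _ _))// mulrDl mul1r ltrD.
Qed.

Lemma osc_bound n (E : set 'cV[R]_d) r dl : measurable E -> E `<=` inner_part Omega r ->
  0 < dl -> K0 * (2 * dl + e n) < r ->
  (\int[mu]_(s in E) osc p (f n) (2 * dl) s <= ((4 * dl) ^+ d * (C1 * (2 * dl + e n)) `^ p)%:E)%E.
Proof.
move=> mE Er dl0 Kr; have en := e0 n.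
have -> : 4 * dl = 2 * (2 * dl) by ring.
apply: osc_le => //.
- by rewrite mulr_gt0.
- by rewrite mulr_ge0// addr_ge0 ?mulr_ge0 ?(ltW dl0) ?(ltW en).
move=> h hr.
have H : Nle mu p E (fun x => `|f n (x + h) - f n x|) (C1 * (`|h| + e n)).
  apply: (ftr (r := r)) => //; apply: le_lt_trans Kr.
  by rewrite ler_wpM2l ?(ltW K0_gt0)// lerD2r ltW.
apply: Nle_mono H => //.
- exact: measurable_diff0.
- exact: measurable_diff0.
- rewrite mulr_ge0 ?addr_ge0 ?(ltW en)//= ler_wpM2l// lerD2r ltW//.
Qed.

Lemma local_scale (x : 'cV[R]_d) : Omega x -> exists r rho, [/\ 0 < r, r <= rho,
  ball x (2 * rho) `<=` Omega & \forall n \near \oo, K0 * (2 * r + e n) < rho].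
Proof.
move=> Ox; have /nbhs_ballP[s /= s0 sO] : nbhs x Omega by exact: open_nbhs_nbhs.
pose rho := s / 2; have rho0 : 0 < rho by rewrite divr_gt0.
(* Chosen so that [K0 * (2 * t + t) < rho]: two units for the translations, one for [e n]. *)
pose t := rho / (4 * K0); have t0 : 0 < t by rewrite divr_gt0// mulr_gt0.
exists (Num.min rho t), rho; split.
- by rewrite lt_min rho0.
- by rewrite ge_min lexx.
- by rewrite mulrC divfK.
have : \forall n \near \oo, e n < t.
  move/cvgrPdist_lt : ecvg => /(_ _ t0); apply: filterS => n.
  by rewrite sub0r normrN gtr0_norm.
apply: filterS => n en.
have : K0 * (4 * t) = rho by rewrite /t; field; rewrite gt_eqF.
move=> E; rewrite -[ltRHS]E ltr_pM2l//.
have mt : Num.min rho t <= t by rewrite ge_min lexx orbT.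
have mt2 := ler_wpM2l (ler0n R 2) mt; lra.
Qed.

Lemma Nle_cst_ball (x : 'cV[R]_d) r (g : 'cV[R]_d -> R) a : 0 < r ->
  (forall s, `|g s| `^ p = a) -> 0 <= a ->
  Nle mu p (ball x r) g ((a * (2 * r) ^+ d) `^ p^-1).
Proof.
move=> r0 ga a0; rewrite /Nle powR_invK ?gt_eqF ?mulr_ge0 ?exprn_ge0 ?mulr_ge0 ?(ltW r0)//.
under eq_integral do rewrite ga.
rewrite integral_cst; last exact: measurable_ball_cV.
rewrite EFinM; apply: lee_wpmul2l; first by rewrite lee_fin.
by rewrite le_eqVlt; apply/orP; left; apply/eqP; exact: lebesgue_cV_ball.
Qed.

Let minf r rho : 0 < r -> r <= rho -> forall x, ball x (2 * rho) `<=` Omega ->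
  ball x r `<=` inner_part Omega rho.
Proof. by move=> r0 rr x H; apply: subset_trans (inner_part_ball H); exact: le_ball. Qed.

(** A good point in the small ball has a value near [c n], and [f n] is close to that value on the
    large ball. The radius [r] depends on [x] alone, not on the small ball, so the property can
    reach [x] from points arbitrarily near. *)
Lemma bounded_propagate (x : 'cV[R]_d) : Omega x -> exists2 r, 0 < r &
  forall x' r' M (c : nat -> 'cV[R]_m), 0 < r' -> 0 <= M -> ball x' r' `<=` ball x r ->
   (\forall n \near \oo, Nle mu p (ball x' r') (fun s => `|f n s - c n|) M) ->
   exists2 M', 0 <= M' & \forall n \near \oo, Nle mu p (ball x r) (fun s => `|f n s - c n|) M'.
Proof.
move=> /local_scale[r [rho [r0 rr rhoO HN]]]; exists r => // x' r' M c r'0 M0 xr' HM.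
have rho0 : 0 < rho by exact: lt_le_trans rr.
(* The restriction on [n] gives [e n <= rho / K0], which makes the oscillation bound independent of
   [n]; the added 1 makes [a] positive even when [C1 = 0]. *)
pose a := (4 * r) ^+ d * (C1 * (2 * r + rho / K0)) `^ p + 1.
have a0 : 0 < a by rewrite ltr_wpDl// mulr_ge0 ?powR_ge0// exprn_ge0// mulr_ge0// ltW.
pose b := (2 * r') ^+ d; have b0 : 0 < b by rewrite exprn_gt0// mulr_gt0.
pose A := 2 * (a + M `^ p) / b.
have A0 : 0 <= A by rewrite divr_ge0 ?(ltW b0)// mulr_ge0// addr_ge0 ?(ltW a0)// powR_ge0.
have pn0 : p != 0 by rewrite gt_eqF.
exists (A `^ p^-1 + (A * (2 * r) ^+ d) `^ p^-1); first by rewrite addr_ge0 ?powR_ge0.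
apply: filterS2 HN HM => n HN HM; have en := e0 n.
have mc (c0 : 'cV[R]_m) : measurable_fun setT (fun s : 'cV[R]_d => `|f n s - c0|).
  by apply: measurable_norm_funB => //; exact: measurable_cst.
have [|||||||||||t Bt Ht] := @good_point R d m p (f n) (mf n) (ball x r) (ball x' r')
   (c n) x r a b (M `^ p) 1.
- exact: measurable_ball_cV.
- exact: measurable_ball_cV.
- exact: subset_refl.
- exact: xr'.
- exact: a0.
- exact: b0.
- exact: ler01.
- exact: powR_ge0.
- exact: lebesgue_cV_ball.
- apply: le_trans (osc_bound _ (minf r0 rr rhoO) r0 HN) _; first exact: measurable_ball_cV.
  rewrite lee_fin /a -[leLHS]addr0 lerD// ler_wpM2l ?exprn_ge0 ?mulr_ge0 ?(ltW r0)//.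
  have enr : e n <= rho / K0.
    rewrite ler_pdivlMr// mulrC; apply: ltW; apply: le_lt_trans HN.
    by rewrite ler_wpM2l ?(ltW K0_gt0)// lerDr mulr_ge0// ltW.
  have q0 : 0 <= rho / K0 by rewrite divr_ge0 ?(ltW rho0) ?(ltW K0_gt0).
  apply: ge0_ler_powR; rewrite ?nnegrE ?(ltW p0)//.
  - by rewrite mulr_ge0// addr_ge0 ?mulr_ge0 ?(ltW en) ?(ltW r0).
  - by rewrite mulr_ge0// addr_ge0// mulr_ge0// ltW.
  - by rewrite ler_wpM2l// lerD2l.
- by rewrite mul1e; move: HM; rewrite /Nle; under eq_integral do rewrite normr_id.
have I0 : (0 <= \int[mu]_(s in ball x r) (`|f n s - f n t| `^ p)%:E)%E.
  by apply: integral_ge0 => s _; rewrite lee_fin powR_ge0.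
have lp : 0 <= 1 * `|f n t - c n| `^ p by rewrite mulr_ge0 ?powR_ge0.
have H1 : Nle mu p (ball x r) (fun s => `|f n s - f n t|) (A `^ p^-1).
  rewrite /Nle powR_invK//; under eq_integral do rewrite normr_id.
  by apply: le_trans Ht; rewrite leeDl// lee_fin.
have H2 : `|f n t - c n| `^ p <= A.
  by rewrite -lee_fin; apply: le_trans Ht; rewrite mul1r leeDr.
have H3 : Nle mu p (ball x r) (fun=> `|f n t - c n|) ((A * (2 * r) ^+ d) `^ p^-1).
  have := @Nle_cst_ball x r (fun=> `|f n t - c n|) (`|f n t - c n| `^ p) r0.
  have h1 (s : 'cV[R]_d) : `|(`|f n t - c n|)| `^ p = `|f n t - c n| `^ p by rewrite normr_id.
  move=> /(_ h1 (powR_ge0 _ _)).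
  apply: Nle_mono => //; first exact: measurable_ball_cV.
  - exact: measurable_ball_cV.
  - rewrite powR_ge0/= ge0_ler_powR ?nnegrE ?invr_ge0 ?(ltW p0)//.
    + by rewrite mulr_ge0 ?powR_ge0// exprn_ge0// mulr_ge0// ltW.
    + by rewrite mulr_ge0// exprn_ge0// mulr_ge0// ltW.
    + by rewrite ler_wpM2r// exprn_ge0// mulr_ge0// ltW.
apply: (NleD p_ge1 _ _ _ _ _ _ _ H1 H3); rewrite ?powR_ge0//.
- exact: measurable_ball_cV.
- move=> s _; rewrite !normr_id.
  by rewrite (le_trans _ (ler_normD _ _))// addrA subrK.
Qed.

(** [good_point] with weight 0: no reference value exists yet, and the value found at [t] becomes
    [c n]. *)
Lemma bounded_start (x : 'cV[R]_d) : Omega x -> exists r M (c : nat -> 'cV[R]_m),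
  [/\ 0 < r, 0 <= M & \forall n \near \oo, Nle mu p (ball x r) (fun s => `|f n s - c n|) M].
Proof.
move=> /local_scale[r [rho [r0 rr rhoO HN]]].
have rho0 : 0 < rho by exact: lt_le_trans rr.
pose a := (4 * r) ^+ d * (C1 * (2 * r + rho / K0)) `^ p + 1.
have a0 : 0 < a by rewrite ltr_wpDl// mulr_ge0 ?powR_ge0// exprn_ge0// mulr_ge0// ltW.
pose b := (2 * r) ^+ d; have b0 : 0 < b by rewrite exprn_gt0// mulr_gt0.
pose A := 2 * (a + 0) / b.
have A0 : 0 <= A by rewrite divr_ge0 ?(ltW b0)// mulr_ge0// addr_ge0 ?(ltW a0).
have pn0 : p != 0 by rewrite gt_eqF.
have /choice[c Hc] : forall n, exists c, K0 * (2 * r + e n) < rho ->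
    Nle mu p (ball x r) (fun s => `|f n s - c|) (A `^ p^-1).
  move=> n; have en := e0 n.
  have [HN'|HN'] := pselect (K0 * (2 * r + e n) < rho); last by exists 0.
  have [|||||||||||t Bt Ht] := @good_point R d m p (f n) (mf n) (ball x r) (ball x r)
   0 x r a b 0 0.
  - exact: measurable_ball_cV.
  - exact: measurable_ball_cV.
  - exact: subset_refl.
  - exact: subset_refl.
  - exact: a0.
  - exact: b0.
  - exact: lexx.
  - exact: lexx.
  - exact: lebesgue_cV_ball.
  - apply: le_trans (osc_bound _ (minf r0 rr rhoO) r0 HN') _; first exact: measurable_ball_cV.
    rewrite lee_fin /a -[leLHS]addr0 lerD// ler_wpM2l ?exprn_ge0 ?mulr_ge0 ?(ltW r0)//.
    have enr : e n <= rho / K0.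
      rewrite ler_pdivlMr// mulrC; apply: ltW; apply: le_lt_trans HN'.
      by rewrite ler_wpM2l ?(ltW K0_gt0)// lerDr mulr_ge0// ltW.
    have q0 : 0 <= rho / K0 by rewrite divr_ge0 ?(ltW rho0) ?(ltW K0_gt0).
    apply: ge0_ler_powR; rewrite ?nnegrE ?(ltW p0)//.
    - by rewrite mulr_ge0// addr_ge0 ?mulr_ge0 ?(ltW en) ?(ltW r0).
    - by rewrite mulr_ge0// addr_ge0// mulr_ge0// ltW.
    - by rewrite ler_wpM2l// lerD2l.
  - by rewrite mul0e.
  exists (f n t); rewrite /Nle powR_invK//; under eq_integral do rewrite normr_id.
  by move=> _; apply: le_trans Ht; rewrite mul0r adde0.
exists r, (A `^ p^-1), c; split => //; first exact: powR_ge0.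
by apply: filterS HN => n; exact: Hc.
Qed.

Definition bounded_at (c : nat -> 'cV[R]_m) x := exists r M, [/\ 0 < r, 0 <= M &
  \forall n \near \oo, Nle mu p (ball x r) (fun s => `|f n s - c n|) M].

(** Once [c] is fixed near one point, the points near which it works form an open set that is closed
    in [Omega] by [bounded_propagate], so connectedness makes it all of [Omega]. *)
Lemma bounded_mod_cst : connected Omega ->
  exists c : nat -> 'cV[R]_m, forall x, Omega x -> bounded_at c x.
Proof.
move=> cO.
have [[x0 Ox0]|O0] := pselect (Omega !=set0); last first.
  by exists (fun=> 0) => x Ox; exfalso; apply: O0; exists x.
have [r0 [M0 [c [r0_gt0 M0_ge0 H0]]]] := bounded_start Ox0.
exists c; pose B := Omega `&` bounded_at c.
have oP : open (bounded_at c).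
  rewrite openE => x [r [M [rp M_ge0 HM]]]; rewrite /interior.
  apply/nbhs_ballP; exists (r / 2) => /=; first by rewrite divr_gt0.
  have r2 : 0 < r / 2 by rewrite divr_gt0.
  move=> v xv; exists (r / 2), M; split; [exact: r2|exact: M_ge0|].
  apply: filterS HM => n; apply: Nle_mono => //.
  - exact: measurable_ball_cV.
  - exact: measurable_ball_cV.
  - by apply: measurable_norm_funB => //; exact: measurable_cst.
  - by apply: measurable_norm_funB => //; exact: measurable_cst.
  - by move=> w vw; rewrite (splitr r); exact: ball_triangle xv vw.
  - by rewrite M_ge0 lexx.
have BO : B = Omega.
  apply: cO.
  - by exists x0; split => //; exists r0, M0.
  - by exists (bounded_at c).
  - exists (closure (bounded_at c)); first exact: closed_closure.
    apply/seteqP; split => x [Ox Hx]; split => //; first exact: subset_closure.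
    have [r rp Hr] := bounded_propagate Ox.
    have [v [Pv xv]] := Hx _ (nbhsx_ballx x r rp).
    have [s [M [s0 M_ge0 HM]]] := Pv.
    have xrv : nbhs v (ball x r) by apply: open_nbhs_nbhs; split => //; exact: ball_open.
    have /nbhs_ballP[t /= t0 vt] := xrv.
    pose u := Num.min s t; have u0 : 0 < u by rewrite lt_min s0.
    have [||M' M'0 HM'] := Hr v u M c u0 M_ge0.
    + by move=> w vw; apply: vt; apply: le_ball vw; rewrite ge_min lexx orbT.
    + apply: filterS HM => n; apply: Nle_mono => //.
      * exact: measurable_ball_cV.
      * exact: measurable_ball_cV.
      * by apply: measurable_norm_funB => //; exact: measurable_cst.
      * by apply: measurable_norm_funB => //; exact: measurable_cst.
      * by apply: le_ball; rewrite ge_min lexx.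
      * by rewrite M_ge0 lexx.
    + by exists r, M'.
by move=> x Ox; have [] : B x by rewrite BO.
Qed.

(** The pieces [E k] and the bound [L] do not depend on [n]; the values [w k] do, being values of
    [f n - c n] at good points near the pieces. The ball is fixed before [eta], so one ball serves
    all accuracies. *)
Lemma step_approx (c : nat -> 'cV[R]_m) (x : 'cV[R]_d) : Omega x -> bounded_at c x ->
  exists2 r, 0 < r & forall eta, 0 < eta ->
  exists (N : nat) (E : nat -> set 'cV[R]_d) (L : R), [/\ forall k, measurable (E k),
    forall g : 'cV[R]_d -> \bar R, measurable_fun setT g -> (forall v, 0 <= g v)%E ->
      (\int[mu]_(v in ball x r) g v = \sum_(k < N) \int[mu]_(v in E k) g v)%E &
    \forall n \near \oo, exists w : nat -> 'cV[R]_m, (forall k, `|w k| <= L) /\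
      (\sum_(k < N) \int[mu]_(s in E k) (`|f n s - c n - w k| `^ p)%:E <= eta%:E)%E].
Proof.
move=> Ox [r2 [M [r2_gt0 M_ge0 HM]]].
have [r1 [rho [r1_gt0 r1rho rhoO Hrho]]] := local_scale Ox.
pose r := Num.min r1 (r2 / 2); have r_gt0 : 0 < r by rewrite lt_min r1_gt0 divr_gt0.
exists r => // eta eta0.
have pn0 : p != 0 by rewrite gt_eqF.
have C31 : 0 < 3 * C1 + 1 by rewrite ltr_wpDl// mulr_ge0.
(* Pieces of size [dl] with [3 * C1 * dl <= z] bring the oscillation part of the error, at most
   [2 * 2 ^ d * (3 * C1 * dl) ^ p], down to [eta / 2]. The 3 comes from [2 * dl + e n] with
   [e n < dl]. *)
pose z := (eta / (4 * 2 ^+ d)) `^ p^-1.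
have z0 : 0 < z by rewrite powR_gt0// divr_gt0// mulr_gt0// exprn_gt0.
pose dl := Num.min r (z / (3 * C1 + 1)).
have dl0 : 0 < dl by rewrite lt_min r_gt0 divr_gt0.
have dlr : dl <= r by rewrite ge_min lexx.
have rr1 : r <= r1 by rewrite ge_min lexx.
have rr2 : r <= r2 / 2 by rewrite ge_min lexx orbT.
have [N [s [E [mE Es xs EI]]]] := finite_partition x r_gt0 dl0.
pose b := (2 * dl) ^+ d; have b0 : 0 < b by rewrite exprn_gt0// mulr_gt0.
pose At := (4 * dl) ^+ d * (C1 * (3 * dl)) `^ p.
have At0 : 0 <= At by rewrite mulr_ge0 ?powR_ge0// exprn_ge0// mulr_ge0// ltW.
have Atb : 2 * At / b <= eta / 2.
  have -> : 2 * At / b = 2 * 2 ^+ d * (C1 * (3 * dl)) `^ p.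
    rewrite /At /b (_ : 4 * dl = 2 * (2 * dl)); last by ring.
    by rewrite exprMn; field; rewrite gt_eqF.
  have : (C1 * (3 * dl)) `^ p <= eta / (4 * 2 ^+ d).
    rewrite -(powR_invK pn0 (_ : 0 <= eta / (4 * 2 ^+ d))); last first.
      by rewrite divr_ge0 ?(ltW eta0)// mulr_ge0// exprn_ge0.
    apply: ge0_ler_powR; rewrite ?nnegrE ?(ltW p0) ?powR_ge0//.
      by rewrite mulr_ge0// mulr_ge0// ltW.
    rewrite -/z; apply: (@le_trans _ _ ((3 * C1 + 1) * dl)); first by lra.
    by rewrite mulrC -ler_pdivlMr// ge_min lexx orbT.
  move=> H; apply: (@le_trans _ _ (2 * 2 ^+ d * (eta / (4 * 2 ^+ d)))).
    by rewrite ler_wpM2l// mulr_ge0// exprn_ge0.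
  rewrite le_eqVlt; apply/orP; left; apply/eqP.
  by field; rewrite gt_eqF// exprn_gt0.
(* Each piece costs two extra [tau]: one keeps the oscillation bound positive, the other pays for
   the weighted distance to [c n], as [lam * M ^ p <= tau]. Over [N] pieces this adds
   [4 * N * tau / b <= eta / 2]. *)
pose tau := eta * b / (8 * N.+1%:R).
have tau0 : 0 < tau by rewrite divr_gt0 ?mulr_gt0// ltr0n.
pose lam := tau / (M `^ p + 1).
have Mp1 : 0 < M `^ p + 1 by rewrite ltr_wpDl// powR_ge0.
have lam0 : 0 < lam by rewrite divr_gt0.
pose L := (2 * (At + tau + tau) / b / lam) `^ p^-1.
exists N, E, L; split => //.
have Hdl : \forall n \near \oo, e n < dl.
  move/cvgrPdist_lt : ecvg => /(_ _ dl0); apply: filterS => n.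
  by rewrite sub0r normrN gtr0_norm.
apply: filterS3 HM Hrho Hdl => n HMn Hrn edl; have en := e0 n.
have xrIn : ball x r `<=` inner_part Omega rho.
  apply: subset_trans (inner_part_ball rhoO).
  by apply: le_ball; exact: le_trans r1rho.
have oscT : (\int[mu]_(v in ball x r) osc p (f n) (2 * dl) v <= At%:E)%E.
  apply: le_trans (osc_bound (measurable_ball_cV x r) xrIn dl0 _) _.
    apply: le_lt_trans Hrn; rewrite ler_wpM2l ?(ltW K0_gt0)// lerD2r ler_wpM2l//.
    exact: le_trans rr1.
  rewrite lee_fin /At ler_wpM2l ?exprn_ge0 ?mulr_ge0 ?(ltW dl0)//.
  apply: ge0_ler_powR; rewrite ?nnegrE ?(ltW p0)//.
  - by rewrite mulr_ge0// addr_ge0 ?(ltW en)// mulr_ge0// ltW.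
  - by rewrite mulr_ge0// mulr_ge0// ltW.
  - by rewrite ler_wpM2l//; lra.
have mosc : measurable_fun setT (osc p (f n) (2 * dl)) by exact: measurable_osc.
have oscS := EI _ mosc (fun v => osc_ge0 p (f n) (2 * dl) v).
pose Ik k := (\int[mu]_(v in E k) osc p (f n) (2 * dl) v)%E.
have Ik0 k : (0 <= Ik k)%E by apply: integral_ge0 => v _; exact: osc_ge0.
rewrite oscS in oscT.
have IkT (k : 'I_N) : (Ik k <= \sum_(k < N) Ik k)%E.
  rewrite (bigD1 k)//=; apply: leeDl; apply: sume_ge0 => i _; exact: Ik0.
have Ikfin (k : 'I_N) : Ik k = (fine (Ik k))%:E.
  rewrite fineK// ge0_fin_numE//; apply: le_lt_trans (ltry At); exact: le_trans oscT.
have HB k : (\int[mu]_(t in ball (s k) dl) (`|f n t - c n| `^ p)%:E <= (M `^ p)%:E)%E.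
  have mfc : measurable_fun setT (fun t : 'cV[R]_d => `|f n t - c n|).
    by apply: measurable_norm_funB => //; exact: measurable_cst.
  have : Nle mu p (ball (s k) dl) (fun t => `|f n t - c n|) M.
    apply: Nle_mono HMn => //; first exact: measurable_ball_cV.
    - exact: measurable_ball_cV.
    - move=> v; rewrite -!ball_normE /ball_/= => sv.
      have -> : x - v = (x - s k) + (s k - v) by rewrite addrA subrK.
      by apply: (le_lt_trans (ler_normD _ _)); have := xs k; lra.
    - by rewrite M_ge0 lexx.
  by rewrite /Nle; under eq_integral do rewrite normr_id.
clear xrIn HMn Hrn rhoO.
have Hk (k : 'I_N) : exists w, `|w| <= L /\
    (\int[mu]_(v in E k) (`|f n v - c n - w| `^ p)%:E <= (2 * (fine (Ik k) + tau + tau) / b)%:E)%E.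
  have a0 : 0 < fine (Ik k) + tau by rewrite ltr_wpDl// fine_ge0.
  have [|||||||||||t Bt Ht] := @good_point R d m p (f n) (mf n) (E k) (ball (s k) dl)
     (c n) (s k) dl (fine (Ik k) + tau) b tau lam.
  - exact: mE.
  - exact: measurable_ball_cV.
  - exact: Es.
  - exact: subset_refl.
  - exact: a0.
  - exact: b0.
  - exact: ltW.
  - exact: ltW.
  - exact: lebesgue_cV_ball.
  - by rewrite -/(Ik k) Ikfin lee_fin /= lerDl ltW.
  - apply: (@le_trans _ _ (lam%:E * (M `^ p)%:E)%E).
      by apply: lee_wpmul2l; [rewrite lee_fin ltW|exact: HB].
    rewrite -EFinM lee_fin /lam -mulrA ler_piMr ?(ltW tau0)//.
    by rewrite mulrC ler_pdivrMr// mul1r lerDl.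
  have I0 : (0 <= \int[mu]_(s in E k) (`|f n s - f n t| `^ p)%:E)%E.
    by apply: integral_ge0 => v _; rewrite lee_fin powR_ge0.
  have l0 : 0 <= lam * `|f n t - c n| `^ p by rewrite mulr_ge0 ?powR_ge0// ltW.
  exists (f n t - c n); split; last first.
    under eq_integral do rewrite opprB addrA subrK.
    by apply: le_trans Ht; rewrite leeDl// lee_fin.
  have : lam * `|f n t - c n| `^ p <= 2 * (At + tau + tau) / b.
    rewrite -lee_fin; apply: (@le_trans _ _ (2 * (fine (Ik k) + tau + tau) / b)%:E).
      by apply: le_trans Ht; rewrite leeDr.
    rewrite lee_fin ler_wpM2r ?invr_ge0 ?(ltW b0)// ler_wpM2l// !lerD2r -lee_fin -Ikfin.
    exact: le_trans oscT.
  rewrite mulrC -ler_pdivlMr// => H.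
  rewrite -[leLHS](powRr1 (normr_ge0 _)) -(mulfV pn0) powRrM /L.
  apply: ge0_ler_powR; rewrite ?nnegrE ?invr_ge0 ?(ltW p0) ?powR_ge0//.
  by apply: le_trans H; exact: powR_ge0.
have L0 : 0 <= L by exact: powR_ge0.
have /choice[w Hw] : forall k : nat, exists w, `|w| <= L /\ ((k < N)%N ->
    (\int[mu]_(v in E k) (`|f n v - c n - w| `^ p)%:E <= (2 * (fine (Ik k) + tau + tau) / b)%:E)%E).
  move=> k; have [kN|Nk] := ltnP k N; last by exists 0; rewrite normr0.
  by have [w [wL Hw]] := Hk (Ordinal kN); exists w.
exists w; split; first by move=> k; exact: (proj1 (Hw k)).
apply: (@le_trans _ _ (\sum_(k < N) (2 * (fine (Ik k) + tau + tau) / b)%:E)%E).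
  by apply: lee_sum => k _; exact: (proj2 (Hw k)).
rewrite sumEFin lee_fin -mulr_suml -mulr_sumr.
under eq_bigr do rewrite -addrA.
rewrite big_split/= sumr_const card_ord.
have SA : \sum_(k < N) fine (Ik k) <= At.
  rewrite -lee_fin -sumEFin; apply: le_trans oscT.
  by apply: lee_sum => k _; rewrite -Ikfin.
have -> : 2 * (\sum_(k < N) fine (Ik k) + (tau + tau) *+ N) / b =
   2 * (\sum_(k < N) fine (Ik k)) / b + 4 * N%:R * tau / b.
  by rewrite -mulr_natr; field; rewrite gt_eqF.
have h1 : 2 * (\sum_(k < N) fine (Ik k)) / b <= eta / 2.
  by apply: le_trans Atb; rewrite ler_wpM2r ?invr_ge0 ?(ltW b0)// ler_wpM2l.
have h2 : 4 * N%:R * tau / b <= eta / 2.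
  have -> : 4 * N%:R * tau / b = eta / 2 * (N%:R / N.+1%:R).
    have KN0 : (N.+1%:R : R) != 0 by rewrite pnatr_eq0.
    by rewrite /tau; move: (N.+1%:R : R) KN0 => KN KN0; field; rewrite (gt_eqF b0) KN0.
  by rewrite ler_piMr ?divr_ge0 ?(ltW eta0)// ler_pdivrMr ?ltr0n// mul1r ler_nat.
by rewrite (splitr eta) lerD.
Qed.

Let gap (c : nat -> 'cV[R]_m) n n' s := `|(f n s - c n) - (f n' s - c n')| `^ p.

Let mfc (c : nat -> 'cV[R]_m) n : measurable_fun setT (fun s : 'cV[R]_d => f n s - c n).
Proof. by apply: measurable_funB_cV => //; exact: measurable_cst. Qed.

Let mgap c n n' : measurable_fun setT (fun s : 'cV[R]_d => (gap c n n' s)%:E).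
Proof. by apply: measurable_normpow_cV; apply: measurable_funB_cV; exact: mfc. Qed.

(** For a given accuracy [f n - c n] is described by [N] bounded vectors, which converge along [U].
    Indices in a suitable member of [U] have nearly the same vectors, hence nearly the same step
    functions. *)
Lemma local_cauchy (U : set_system nat) (c : nat -> 'cV[R]_m) (x : 'cV[R]_d) :
  UltraFilter U -> \oo `<=` U -> Omega x -> bounded_at c x ->
  exists2 r, 0 < r & forall eta, 0 < eta -> exists2 S, U S &
    forall n n', S n -> S n' -> (\int[mu]_(s in ball x r) (gap c n n' s)%:E <= eta%:E)%E.
Proof.
move=> UU ooU Ox bx.
have [r r0 Hr] := step_approx Ox bx.
exists r => // eta eta0.
pose V := (2 * r) ^+ d; have V0 : 0 < V by rewrite exprn_gt0// mulr_gt0.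
have t3 : 0 < 3 `^ p :> R by rewrite powR_gt0.
(* Two approximation errors and the difference of the step functions, each worth [eta1], combined
   through [powR_add3]; below, [tau] satisfies [(2 * tau) ^ p * V = eta1]. *)
pose eta1 := eta / (3 `^ p * 3); have eta1_gt0 : 0 < eta1 by rewrite divr_gt0// mulr_gt0.
have [N [E [L [mE EI Hn]]]] := Hr _ eta1_gt0.
pose tau := (eta1 / V) `^ p^-1 / 2.
have tau0 : 0 < tau by rewrite divr_gt0// powR_gt0// divr_gt0.
pose good n w := (forall k : nat, `|w k| <= L) /\
  (\sum_(k < N) \int[mu]_(s in E k) (`|f n s - c n - w k| `^ p)%:E <= eta1%:E)%E.
have /choice[w Hw] : forall n, exists w : nat -> 'cV[R]_m, (exists w', good n w') -> good n w.
  move=> n; have [[w Hw]|nw] := pselect (exists w', good n w'); first by exists w.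
  by exists (fun=> 0).
have UG : U [set n | good n (w n)].
  by apply: ooU; apply: filterS Hn => n Hn; exact: Hw.
have /choice[l Hl] : forall k : nat, exists l, forall tau, 0 < tau -> U [set n | `|w n k - l| <= tau].
  move=> k; apply: (@ultra_limit _ _ _ _ L) => //.
  by apply: filterS UG => n [H _]; exact: H.
have UW : U [set n | forall k : 'I_N, `|w n k - l k| <= tau].
  by apply: filter_forall => k; exact: Hl.
exists ([set n | good n (w n)] `&` [set n | forall k : 'I_N, `|w n k - l k| <= tau]).
  exact: filterI.
move=> n n' [[_ G1] W1] [[_ G2] W2].
have g0 v : (0 <= (gap c n n' v)%:E)%E by rewrite lee_fin powR_ge0.
rewrite EI//.
pose A n k := (\int[mu]_(s in E k) (`|f n s - c n - w n k| `^ p)%:E)%E.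
have A0 i k : (0 <= A i k)%E by apply: integral_ge0 => v _; rewrite lee_fin powR_ge0.
pose B (k : nat) := (\int[mu]_(s in E k) ((2 * tau) `^ p)%:E)%E.
have B0 k : (0 <= B k)%E by apply: integral_ge0 => v _; rewrite lee_fin powR_ge0.
have mA i k : measurable_fun (E k) (fun s => (`|f i s - c i - w i k| `^ p)%:E).
  apply: measurable_funTS; apply: measurable_normpow_cV.
  by apply: measurable_funB_cV; [exact: mfc|exact: measurable_cst].
have HE (k : 'I_N) : (\int[mu]_(v in E k) (gap c n n' v)%:E <=
    (3 `^ p)%:E * (A n k + A n' k + B k))%E.
  rewrite /A /B -ge0_integralD//.
  rewrite -ge0_integralD//; try exact: emeasurable_funD; try (by move=> v _; rewrite lee_fin powR_ge0); try by move=> v _; rewrite -EFinD lee_fin addr_ge0 ?powR_ge0.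
  rewrite -ge0_integralZl_EFin ?powR_ge0//;
    try (by apply: emeasurable_funD => //; exact: emeasurable_funD);
    try by move=> v _; rewrite -[leRHS]/((_ + _ + _)%:E) lee_fin !addr_ge0 ?powR_ge0.
  apply: ge0_le_integral => //.
  - exact: measurable_funTS.
  - by apply: measurable_funeM; apply: emeasurable_funD => //; exact: emeasurable_funD.
  - move=> v _.
    rewrite -[leRHS]/((3 `^ p * (`|f n v - c n - w n k| `^ p + `|f n' v - c n' - w n' k| `^ p + (2 * tau) `^ p))%:E) lee_fin.
    have tt : 0 <= 2 * tau by rewrite mulr_ge0// ltW.
    apply: le_trans (powR_add3 (ltW p0) (normr_ge0 _) (normr_ge0 _) tt).
    apply: ge0_ler_powR; rewrite ?nnegrE ?addr_ge0 ?(ltW p0)//.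
    have -> : f n v - c n - (f n' v - c n') =
       (f n v - c n - w n k) - (f n' v - c n' - w n' k) + ((w n k - l k) - (w n' k - l k)).
      by apply/matrixP => i j; rewrite !mxE; ring.
    apply: (le_trans (ler_normD _ _)); apply: lerD; first exact: ler_normB.
    apply: (le_trans (ler_normB _ _)); have := W1 k; have := W2 k; lra.
pose G (k : 'I_N) := ((3 `^ p)%:E * (A n k + A n' k + B k))%E.
apply: (@le_trans _ _ (\sum_(k < N) G k)%E); first by apply: lee_sum => k _; exact: HE.
have -> : (\sum_(k < N) G k = (3 `^ p)%:E * (\sum_(k < N) A n k + \sum_(k < N) A n' k + \sum_(k < N) B k))%E.
  rewrite /G -ge0_sume_distrr; last by move=> k _; apply: adde_ge0 => //; exact: adde_ge0.
  by congr (_ * _)%E; rewrite big_split/= big_split.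
have SB : (\sum_(k < N) B k <= eta1%:E)%E.
  rewrite /B -EI//; last by move=> v; rewrite lee_fin powR_ge0.
  rewrite integral_cst; last exact: measurable_ball_cV.
  apply: (@le_trans _ _ (((2 * tau) `^ p)%:E * V%:E)%E).
    apply: lee_wpmul2l; first by rewrite lee_fin powR_ge0.
    by rewrite le_eqVlt; apply/orP; left; apply/eqP; exact: lebesgue_cV_ball.
  have E2 : 2 * tau = (eta1 / V) `^ p^-1 by rewrite /tau mulrC divfK.
  have q0 : 0 <= eta1 / V by apply: divr_ge0; exact: ltW.
  have pn0 : p != 0 by rewrite gt_eqF.
  rewrite -EFinM lee_fin E2 (powR_invK pn0 q0).
  by rewrite divfK// gt_eqF.
apply: (@le_trans _ _ ((3 `^ p)%:E * (eta1%:E + eta1%:E + eta1%:E))%E).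
  apply: lee_wpmul2l; first by rewrite lee_fin powR_ge0.
  by apply: leeD; [apply: leeD; [exact: G1|exact: G2]|exact: SB].
rewrite -!EFinD -EFinM lee_fin /eta1 le_eqVlt; apply/orP; left; apply/eqP.
by field; rewrite gt_eqF.
Qed.

Lemma compact_cauchy (U : set_system nat) (c : nat -> 'cV[R]_m) (K : set 'cV[R]_d) :
  UltraFilter U -> \oo `<=` U -> (forall x, Omega x -> bounded_at c x) ->
  compact K -> measurable K -> K `<=` Omega ->
  forall eta, 0 < eta -> exists2 S, U S &
    forall n n', S n -> S n' -> (\int[mu]_(s in K) (gap c n n' s)%:E <= eta%:E)%E.
Proof.
move=> UU ooU bc cK mK KO.
have g0 n n' v : (0 <= (gap c n n' v)%:E)%E by rewrite lee_fin powR_ge0.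
(* The sets met by [compact_ind] need not be measurable, so the estimate is attached to a measurable
   set containing them. *)
pose P (A : set 'cV[R]_d) := exists B, [/\ measurable B, A `<=` B &
  forall eta, 0 < eta -> exists2 S, U S &
    forall n n', S n -> S n' -> (\int[mu]_(s in B) (gap c n n' s)%:E <= eta%:E)%E].
have [B [mB KB HB]] : P K.
  apply: (compact_ind cK).
  - exists set0; split => // eta eta0; exists setT; first exact: filterT.
    by move=> n n' _ _; rewrite integral_set0 lee_fin ltW.
  - move=> A1 A2 [B1 [mB1 AB1 H1]] [B2 [mB2 AB2 H2]]; exists (B1 `|` B2); split.
    + exact: measurableU.
    + exact: setUSS.
    + clear AB1 AB2 KO; move=> eta eta0; have e2 : 0 < eta / 2 by rewrite divr_gt0.
      have [S1 US1 HS1] := H1 _ e2; have [S2 US2 HS2] := H2 _ e2.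
      exists (S1 `&` S2); first exact: filterI.
      move=> n n' [S1n S2n] [S1n' S2n'].
      have -> : B1 `|` B2 = B1 `|` (B2 `\` B1) by rewrite setDE setUIr setUCr setIT.
      rewrite ge0_integral_setU//.
      * rewrite (splitr eta) EFinD; apply: leeD; first exact: HS1.
        apply: le_trans (HS2 _ _ S2n S2n'); apply: ge0_subset_integral => //.
        - exact: measurableD.
        - exact: measurable_funTS.
      * exact: measurableD.
      * exact: measurable_funTS.
      * by apply/disj_setPS => v [/= ? [_ ?]].
  - move=> A1 A2 A21 [B1 [mB1 AB1 H1]]; exists B1; split => //; exact: subset_trans AB1.
  - move=> x Kx; have Ox := KO _ Kx.
    have [r r0 Hr] := local_cauchy UU ooU Ox (bc _ Ox).
    exists (ball x r); first exact: nbhsx_ballx.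
    exists (ball x r); split => //; first exact: measurable_ball_cV.
move=> eta eta0; have [S US HS] := HB _ eta0; exists S => // n n' Sn Sn'.
apply: le_trans (HS _ _ Sn Sn'); apply: ge0_subset_integral => //; exact: measurable_funTS.
Qed.

End translation_family.

(** * Exhaustion by inner parts, extraction of the subsequence and translation bounds for its
    limit *)

Section exhaustion.
Context {R : realType} (d : nat).
Notation mu := (@lebesgue_cV R d).
Implicit Types (Omega : set 'cV[R]_d).

Lemma inner_part_sub Omega r : 0 < r -> inner_part Omega r `<=` Omega.
Proof. by move=> r0 x; apply; exact: ballxx. Qed.

Lemma closed_inner_part Omega r : closed (inner_part Omega r).
Proof.
rewrite -openC openE => x nx.
have [w xw nw] : exists2 w, ball x r w & ~ Omega w.
  apply: contrapT => H; apply: nx => w xw; apply: contrapT => nw; apply: H; by exists w.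
move: xw; rewrite -ball_normE /ball_/= => xw.
apply/nbhs_ballP; exists (r - `|x - w|) => /=; first by rewrite subr_gt0.
move=> v; rewrite -ball_normE /ball_/= => xv Hv; apply: nw; apply: Hv.
rewrite -ball_normE /ball_/=.
have -> : v - w = (x - w) - (x - v) by rewrite opprB [RHS]addrC addrA subrK.
by apply: (le_lt_trans (ler_normB _ _)); rewrite -ltrBrDl.
Qed.

Definition exhaust Omega (j : nat) : set 'cV[R]_d := inner_part Omega (j.+1%:R^-1).

Lemma exhaust_gt0 (j : nat) : 0 < (j.+1%:R^-1 : R). Proof. by rewrite invr_gt0. Qed.

Lemma measurable_exhaust Omega j : measurable (exhaust Omega j).
Proof. exact: closed_measurable_cV (@closed_inner_part _ _). Qed.

Lemma exhaust_sub Omega j : exhaust Omega j `<=` Omega.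
Proof. exact: (inner_part_sub (exhaust_gt0 j)). Qed.

Lemma exhaust_nd Omega i j : (i <= j)%N -> exhaust Omega i `<=` exhaust Omega j.
Proof. by move=> ij; apply: inner_part_le; rewrite lef_pV2 ?posrE ?ltr0n// ler_nat. Qed.

Lemma small_exhaust (r : R) : 0 < r -> exists j : nat, j.+1%:R^-1 < r.
Proof.
move=> r0; have [k _ H] := near_infty_natSinv_lt (PosNum r0).
by exists k; apply: H => /=.
Qed.

Lemma exhaust_compact Omega j : bounded_set Omega -> compact (exhaust Omega j).
Proof.
move=> [M [Mr H]]; apply: compact_cV; last exact: closed_inner_part.
exists M; split => // t Mt x /exhaust_sub; exact: H.
Qed.

Lemma bigcup_exhaust Omega : open Omega -> \bigcup_j exhaust Omega j = Omega.
Proof.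
move=> oO; apply/seteqP; split => x; first by move=> [j _ /exhaust_sub].
move=> Ox; have /nbhs_ballP[s /= s0 sO] : nbhs x Omega by exact: open_nbhs_nbhs.
have [j js] := small_exhaust s0.
by exists j => // v xv; apply: sO; apply: le_ball xv; exact: ltW.
Qed.

Lemma compact_sub_exhaust Omega K : open Omega -> compact K -> K `<=` Omega ->
  exists j, K `<=` exhaust Omega j.
Proof.
move=> oO cK KO; apply: (compact_ind (P := fun A => exists j, A `<=` exhaust Omega j) cK).
- by exists 0%N => x.
- move=> A B [i Ai] [j Bj]; exists (maxn i j) => x [/Ai|/Bj]; apply: exhaust_nd.
    exact: leq_maxl.
  exact: leq_maxr.
- by move=> A B BA [j Aj]; exists j; exact: subset_trans Aj.
- move=> x /KO Ox; have /nbhs_ballP[s /= s0 sO] : nbhs x Omega by exact: open_nbhs_nbhs.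
  have s2 : 0 < s / 2 by rewrite divr_gt0.
  have [j js] := small_exhaust s2.
  exists (ball x (s / 2)); first exact: nbhsx_ballx.
  exists j; apply: (@subset_trans _ (inner_part Omega (s / 2))); last by apply: inner_part_le; exact: ltW.
  by apply: inner_part_ball; rewrite mulrC divfK.
Qed.

Lemma negligible_shift (h : 'cV[R]_d) (P : 'cV[R]_d -> Prop) :
  {ae mu, forall x, P x} -> {ae mu, forall x, P (x + h)}.
Proof.
move=> [N [mN muN H]]; exists ((fun x => x + h) @^-1` N); split.
- exact: measurable_shift_set.
- by rewrite -muN; exact: lebesgue_cV_shift.
- by move=> x /= nP; apply: H.
Qed.

End exhaustion.

Section compactness.
Context {R : realType} (d m : nat) (p : R) (p_ge1 : 1 <= p).
Notation mu := (@lebesgue_cV R d).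
Variables (Omega : set 'cV[R]_d) (f : nat -> 'cV[R]_d -> 'cV[R]_m).
Variables (e : nat -> R) (K0 C1 : R).
Hypothesis Omega_open : open Omega.
Hypothesis Omega_bounded : bounded_set Omega.
Hypothesis Omega_connected : connected Omega.
Hypothesis mf : forall n, measurable_fun setT (f n).
Hypothesis e0 : forall n, 0 < e n.
Hypothesis ecvg : e n @[n --> \oo] --> 0.
Hypotheses (K0_ge1 : 1 <= K0) (C1_ge0 : 0 <= C1).
Hypothesis ftr : forall n V r h, measurable V -> V `<=` inner_part Omega r ->
  K0 * (`|h| + e n) < r -> Nle mu p V (fun x => `|f n (x + h) - f n x|) (C1 * (`|h| + e n)).

Let p0 : 0 < p. Proof. exact: lt_le_trans p_ge1. Qed.

Let K0_gt0 : 0 < K0. Proof. exact: lt_le_trans K0_ge1. Qed.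

Lemma compactness : exists (k : nat -> nat) (c : nat -> 'cV[R]_m) (u : 'cV[R]_d -> 'cV[R]_m),
  [/\ {homo k : i j / (i < j)%N}, measurable_fun setT u,
     {ae mu, forall x, Omega x -> (fun n => f (k n) x - c n) @ \oo --> u x} &
     forall j n, (j <= n)%N ->
       Nle mu p (exhaust Omega j) (fun x => `|f (k n) x - c n - u x|) ((4^-1) ^+ j)].
Proof.
have [U [UU ooU]] := ultraFilterLemma eventually_filter.
have [c bc] := bounded_mod_cst p_ge1 Omega_open mf e0 ecvg K0_gt0 C1_ge0 ftr Omega_connected.
have /choice[S HS] : forall j : nat, exists S, U S /\ forall n n', S n -> S n' ->
    Nle mu p (exhaust Omega j) (fun x => `|f n x - c n - (f n' x - c n')|) ((4^-1) ^+ j).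
  move=> j; have t0 : 0 < ((4^-1) ^+ j : R) `^ p by rewrite powR_gt0 ?exprn_gt0 ?invr_gt0.
  have [S US HS] := compact_cauchy p_ge1 Omega_open mf e0 ecvg K0_gt0 C1_ge0 ftr UU ooU bc
    (exhaust_compact Omega_bounded) (measurable_exhaust Omega j) (@exhaust_sub _ _ Omega j) t0.
  exists S; split; first exact: US.
  move=> n n' Sn Sn'; rewrite /Nle; under eq_integral do rewrite normr_id.
  exact: HS.
have pick N j : exists n, (N < n)%N /\ forall i, (i <= j)%N -> S i n.
  have UN : U [set n | (N < n)%N] by apply: ooU; exists N.+1.
  have Uj : U [set n | forall i : 'I_j.+1, S i n].
    by apply: filter_forall => i; exact: (proj1 (HS i)).
  have [n [Nn Hn]] := filter_ex (filterI UN Uj).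
  by exists n; split => // i ij; exact: (Hn (Ordinal (ij : (i < j.+1)%N))).
have /choice[nx Hnx] : forall Nj : nat * nat, exists n, (Nj.1 < n)%N /\ forall i, (i <= Nj.2)%N -> S i n.
  by move=> [N j]; exact: pick.
(* The n-th index is taken beyond the previous one and in [S 0], ..., [S n], all of which belong to
   [U] and so meet beyond any index. *)
pose k := fix k n := if n is n'.+1 then nx (k n', n) else nx (0%N, 0%N).
have kS i n : (i <= n)%N -> S i (k n).
  by case: n => [|n] i_n; exact: (proj2 (Hnx _)).
have kmono : {homo k : i j / (i < j)%N}.
  apply: homo_ltn; first exact: ltn_trans.
  by move=> n; exact: (proj1 (Hnx (k n, n.+1))).
have mfk n : measurable_fun setT (fun x : 'cV[R]_d => f (k n) x - c (k n)).
  by apply: measurable_funB_cV => //; exact: measurable_cst.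
have [u mu_u [uae uN]] := @Lp_completion _ _ _ mu p p_ge1 m (fun n x => f (k n) x - c (k n))
  (exhaust Omega) mfk (measurable_exhaust Omega) (@exhaust_nd _ _ Omega)
  (fun j i n ji jn => proj2 (HS j) _ _ (kS _ _ jn) (kS _ _ ji)).
exists k, (c \o k), u; split => //.
by rewrite bigcup_exhaust// in uae.
Qed.

Variables (k : nat -> nat) (c : nat -> 'cV[R]_m) (u : 'cV[R]_d -> 'cV[R]_m).
Hypothesis kmono : {homo k : i j / (i < j)%N}.
Hypothesis mu_u : measurable_fun setT u.
Hypothesis uae : {ae mu, forall x, Omega x -> (fun n => f (k n) x - c n) @ \oo --> u x}.

(** The constants cancel in differences. For [h != 0] eventually [e (k n) < |h|], so the additive
    term is absorbed at the price of a factor 2 and the bound passes to the limit by Fatou's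
    lemma. *)
Lemma limit_translation V r h : measurable V -> V `<=` inner_part Omega r -> K0 * `|h| < r ->
  Nle mu p V (fun x => `|u (x + h) - u x|) (2 * C1 * `|h|).
Proof.
move=> mV Vr hr.
have [->|h0] := eqVneq h 0.
  rewrite /Nle (eq_integral (cst 0%E)); last first.
    by move=> x _; rewrite addr0 subrr !normr0 powR0// gt_eqF.
  by rewrite integral0 lee_fin powR_ge0.
have hp : 0 < `|h| by rewrite normr_gt0.
have ksub n : (n <= k n)%N.
  elim: n => // n IH; exact: leq_ltn_trans IH (kmono (ltnSn n)).
have ek t : 0 < t -> \forall n \near \oo, e (k n) < t.
  move=> t0; move/cvgrPdist_lt : ecvg => /(_ _ t0) [N _ HN]; exists N => // n /= Nn.
  have := HN (k n) (leq_trans Nn (ksub n)).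
  by rewrite /= sub0r normrN gtr0_norm.
have r0 : 0 < r by apply: le_lt_trans hr; rewrite mulr_ge0// ltW.
have t1 : 0 < (r - K0 * `|h|) / K0 by rewrite divr_gt0// subr_gt0.
have Vh x : V x -> Omega x /\ Omega (x + h).
  move=> /Vr H; split; apply: H; first exact: ballxx.
  rewrite -ball_normE /ball_/= opprD addrA subrr sub0r normrN.
  by apply: le_lt_trans hr; rewrite ler_peMl.
have HF n : K0 * (`|h| + e (k n)) < r -> Nle mu p V (fun x => `|f (k n) (x + h) - f (k n) x|) (C1 * (`|h| + e (k n))).
  exact: ftr.
clear Vr; rewrite /Nle.
apply: (@fatou_ae _ _ _ mu V (fun n x => (`|(`|f (k n) (x + h) - f (k n) x|)| `^ p)%:E)) => //.
- by move=> n; apply: measurable_normpow; exact: measurable_diff0.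
- by apply: measurable_normpow; exact: measurable_diff0.
- have uh := negligible_shift h uae.
  apply: filterS2 uae uh => x ux uxh Vx; have [Ox Oxh] := Vh _ Vx.
  have {}ux := ux Ox; have {}uxh := uxh Oxh.
  apply: cvg_EFin; first exact: nearW.
  apply: cvg_powR => //.
  rewrite (_ : (fun n => _) = (fun n => `|(`|(f (k n) (x + h) - c n) - (f (k n) x - c n)|)|)); last first.
    by apply/funext => n; rewrite opprB addrA subrK.
  by apply: cvg_norm; apply: cvg_norm; exact: cvgB.
- apply: filterS2 (ek _ hp) (ek _ t1) => n e1 e2.
  have H : K0 * (`|h| + e (k n)) < r.
    by rewrite ltr_pdivlMr// in e2; lra.
  apply: le_trans (HF _ H) _; rewrite lee_fin.
  have en := e0 (k n).
  apply: ge0_ler_powR; rewrite ?nnegrE ?(ltW p0)//.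
  + by rewrite mulr_ge0// addr_ge0// ltW.
  + by rewrite mulr_ge0// mulr_ge0.
  + by rewrite (mulrC 2) -mulrA ler_wpM2l//; lra.
Qed.

(** Cutting [h] into pieces short compared with [r] removes the relation between [|h|] and the
    distance to the complement: the segment has to stay in some inner part, and the constant does
    not depend on which one. *)
Lemma long_translation (V : set 'cV[R]_d) r (h : 'cV[R]_d) : measurable V -> 0 < r ->
  (forall (x : 'cV[R]_d) t, V x -> 0 <= t <= 1 -> inner_part Omega r (x + t *: h)) ->
  Nle mu p V (fun x => `|u (x + h) - u x|) (2 * C1 * `|h|).
Proof.
move=> mV r0 Vr; pose n := (Num.truncn (K0 * `|h| / r)).+1.
have n0 : 0 < n%:R :> R by rewrite ltr0n.
have nh : n%:R *: (n%:R^-1 *: h) = h by rewrite scalerA mulfV ?scale1r// gt_eqF.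
have hn : `|n%:R^-1 *: h| = `|h| / n%:R by rewrite normrZ normfV gtr0_norm// mulrC.
have := @Nle_subdivide _ d m p p_ge1 V u (n%:R^-1 *: h) n (2 * C1 * (`|h| / n%:R)) mV mu_u.
rewrite nh (_ : n%:R * (2 * C1 * (`|h| / n%:R)) = 2 * C1 * `|h|); last first.
  by field; rewrite gt_eqF.
apply; first by rewrite mulr_ge0 ?mulr_ge0// divr_ge0// ltW.
move=> i i_n; pose v := i%:R *: (n%:R^-1 *: h).
apply: (@Nle_shift _ _ p V (fun x => `|u (x + n%:R^-1 *: h) - u x|) v) => //.
  exact: measurable_diff0.
rewrite -hn; apply: (limit_translation (r := r)).
- exact: measurable_shift_set.
- move=> x /= Vx; have := Vr _ (i%:R / n%:R) Vx.
  rewrite -scalerA -/v subrK; apply.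
  by rewrite divr_ge0 ?(ltW n0)//= ler_pdivrMr// mul1r ler_nat ltnW.
- by rewrite hn mulrA ltr_pdivrMr// -ltr_pdivrMl// [_^-1 * _]mulrC; exact: truncnS_gt.
Qed.

End compactness.

(** * Integrability up to the Lipschitz boundary *)

Section global_integrability.
Context {R : realType} (d m : nat) (p : R) (p_ge1 : 1 <= p).
Notation mu := (@lebesgue_cV R d).
Variables (Omega : set 'cV[R]_d) (u : 'cV[R]_d -> 'cV[R]_m) (Cu : R).
Hypothesis Omega_open : open Omega.
Hypothesis Omega_bounded : bounded_set Omega.
Hypothesis Omega_lip : lipschitz_boundary Omega.
Hypothesis mu_u : measurable_fun setT u.
Hypothesis Cu0 : 0 <= Cu.
Hypothesis u_long : forall (V : set 'cV[R]_d) r (h : 'cV[R]_d), measurable V -> 0 < r ->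
  (forall (x : 'cV[R]_d) t, V x -> 0 <= t <= 1 -> inner_part Omega r (x + t *: h)) ->
  Nle mu p V (fun x => `|u (x + h) - u x|) (Cu * `|h|).
Hypothesis u_loc : forall j, exists2 M, 0 <= M & Nle mu p (exhaust Omega j) (fun x => `|u x|) M.

Let p0 : 0 < p. Proof. exact: lt_le_trans p_ge1. Qed.

Let mnu : measurable_fun setT (fun x : 'cV[R]_d => `|u x|).
Proof. exact: (measurableT_comp (@measurable_norm_cV R m) mu_u). Qed.

Let u_inner r : 0 < r -> exists2 M, 0 <= M & Nle mu p (inner_part Omega r) (fun x => `|u x|) M.
Proof.
move=> r0; have [j jr] := small_exhaust r0; have [M M0 HM] := u_loc j.
exists M; first exact: M0.
have mI : measurable (inner_part Omega r) := closed_measurable_cV (@closed_inner_part _ _ _ _).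
apply: (Nle_mono p_ge1 mI (@measurable_exhaust _ _ _ _) mnu mnu _ _ _ HM).
- by apply: inner_part_le; exact: ltW.
- by move=> x _; rewrite normr_id.
- by rewrite M0 lexx.
Qed.

(* e points into Omega along the vertical axis of the Lipschitz chart at x. *)
Lemma boundary_chart x : (closure Omega `\` Omega) x -> exists rho (e : 'cV[R]_d) s,
  [/\ 0 < rho, 0 < s &
     forall tau, 0 < tau -> exists2 r, 0 < r & forall w t, Omega w -> ball x rho w ->
       tau <= t <= s -> inner_part Omega r (w + t *: e)].
Proof.
move=> [clx nx].
have bx : (closure Omega `\` Omega°) x by split => // /interior_subset.
have [Q [i [gam [QQ lipg near_x]]]] := Omega_lip bx.
have [L L0 HL] : exists2 L, 0 <= L & forall a b, gam a - gam b <= L * `|a - b|.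
  have [M [Mr HM]] := lipg; exists (`|M| + 1); first by rewrite addr_ge0.
  move=> a b; apply: (le_trans (ler_norm _)).
  apply: (HM (`|M| + 1) _ (a, b)) => //.
  by rewrite (le_lt_trans (ler_norm M))// ltrDl.
have /nbhs_ballP[rho4 /= rho40 Hrho] := near_x.
(* Room for the displacement: [w] is within [rho] of [x], the shift [t *: e] is at most [rho / 2],
   and [v] is within [r <= rho] of the shifted point, all still inside the chart. *)
pose rho := rho4 / 4; have rho0 : 0 < rho by rewrite divr_gt0.
have rho4E : rho4 = 4 * rho by rewrite /rho; field.
pose e : 'cV[R]_d := Q^T *m delta_mx i ord0.
have Qe : Q *m e = delta_mx i ord0 by rewrite /e mulmxA QQ mul1mx.
have e10 : 0 < `|e| + 1 by rewrite ltr_wpDl.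
pose s := rho / 2 / (`|e| + 1); have s0 : 0 < s by rewrite !divr_gt0.
have se : s * `|e| <= rho / 2.
  by rewrite /s mulrAC ler_pdivrMr//; apply: ler_wpM2l; [exact/ltW/divr_gt0 | rewrite lerDl].
exists rho, e, s; split => // tau tau0.
(* Moving by less than [r] changes the chart coordinates by at most [d * |Q| * r], and the height
   above the graph by at most [L + 1] times that. Since [r * K <= tau], the height gained by the
   shift outweighs this. *)
pose K := (L + 1) * (d%:R * `|Q|) + 1.
have K0 : 0 < K by rewrite ltr_wpDl// mulr_ge0 ?mulr_ge0// addr_ge0.
exists (Num.min rho (tau / K)); first by rewrite lt_min rho0 divr_gt0.
set r := Num.min _ _ => w t Ow xw /andP[taut ts] v wv.
have rrho : r <= rho by rewrite ge_min lexx.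
have rtau : r * K <= tau by rewrite -ler_pdivlMr// ge_min lexx orbT.
have t0 : 0 <= t by rewrite (le_trans (ltW tau0)).
have te : `|t *: e| <= rho / 2.
  by rewrite normrZ ger0_norm// (le_trans _ se)// ler_wpM2r.
move: xw wv; rewrite -!ball_normE /ball_/= => xw wv.
have xw4 : ball x rho4 w by rewrite -ball_normE /ball_/= rho4E; lra.
have xv4 : ball x rho4 v.
  rewrite -ball_normE /ball_/= rho4E.
  have -> : x - v = (x - w) + ((w + t *: e - v) - t *: e).
    by apply/matrixP => a b; rewrite !mxE; ring.
  apply: (le_lt_trans (ler_normD _ _)); have := ler_normB (w + t *: e - v) (t *: e); lra.
apply/(Hrho _ xv4); move/(Hrho _ xw4) : Ow => Ow.
pose D := Q *m v - (Q *m w + t *: delta_mx i ord0).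
have Dr : `|D| <= d%:R * `|Q| * r.
  have -> : D = Q *m (v - (w + t *: e)) by rewrite /D mulmxBr mulmxDr -scalemxAr Qe.
  apply: (le_trans (mulmx_norm_le _ _)); rewrite ler_wpM2l ?mulr_ge0//.
  by rewrite distrC ltW.
have Ovi : (Q *m v) i ord0 = (Q *m w) i ord0 + t + D i ord0.
  have -> : D i ord0 = (Q *m v) i ord0 - ((Q *m w) i ord0 + t).
    rewrite /D; move: (Q *m v) (Q *m w) => a b; by rewrite !mxE !eqxx mulr1.
  by rewrite addrC subrK.
have rowE : row' i (Q *m v) - row' i (Q *m w) = row' i D.
  rewrite /D; move: (Q *m v) (Q *m w) => a b; apply/matrixP => k l; rewrite !mxE.
  by rewrite eq_sym (negbTE (neq_lift _ _)) mulr0 addr0.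
have rowD : `|row' i D| <= `|D|.
  by apply/mx_norm_leP => // k l; rewrite mxE ler_mx_norm.
have g1 := HL (row' i (Q *m v)) (row' i (Q *m w)).
rewrite rowE in g1.
have D1 : - D i ord0 <= `|D| by rewrite (le_trans (ler_norm _))// normrN ler_mx_norm.
have g2 : L * `|row' i D| <= L * `|D| by rewrite ler_wpM2l.
rewrite Ovi.
have LD : (L + 1) * `|D| <= (L + 1) * (d%:R * `|Q| * r) by rewrite ler_wpM2l// addr_ge0.
have rK : (L + 1) * (d%:R * `|Q| * r) + r <= tau.
  by apply: le_trans rtau; rewrite /K le_eqVlt; apply/orP; left; apply/eqP; ring.
have rp : 0 < r by rewrite lt_min rho0 divr_gt0.
lra.
Qed.

Let NleU X Y a b : measurable X -> measurable Y -> 0 <= a -> 0 <= b ->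
  Nle mu p X (fun x => `|u x|) a -> Nle mu p Y (fun x => `|u x|) b ->
  exists2 M, 0 <= M & Nle mu p (X `|` Y) (fun x => `|u x|) M.
Proof.
move=> mX mY a0 b0 Xa Yb.
have ab0 : 0 <= a `^ p + b `^ p by rewrite addr_ge0 ?powR_ge0.
exists ((a `^ p + b `^ p) `^ p^-1); first exact: powR_ge0.
have mun : measurable_fun setT (fun x : 'cV[R]_d => (`| `|u x| | `^ p)%:E).
  exact: (measurable_normpow p mnu).
rewrite /Nle powR_invK ?gt_eqF//.
have -> : X `|` Y = X `|` (Y `\` X) by rewrite setDE setUIr setUCr setIT.
rewrite ge0_integral_setU//.
- rewrite EFinD; apply: leeD; first exact: Xa.
  apply: le_trans Yb; apply: ge0_subset_integral => //.
  + exact: measurableD.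
  + exact: measurable_funTS.
- exact: measurableD.
- exact: measurable_funTS.
- by apply/disj_setPS => v [/= ? [_ ?]].
Qed.

(** The part [W] of the domain, raised by [tau *: e], keeps a positive distance from the complement
    on its way up to height [s], where [u] is already bounded in L^p. That distance shrinks with
    [tau], but the constant in [u_long] does not see it, so [tau] can tend to 0. *)
Lemma boundary_bound x : (closure Omega `\` Omega) x ->
  exists2 rho, 0 < rho & exists2 M, 0 <= M & Nle mu p (Omega `&` ball x rho) (fun x => `|u x|) M.
Proof.
move=> /boundary_chart[rho [e [s [rho0 s0 H]]]].
exists rho; first exact: rho0.
pose W := Omega `&` ball x rho.
have mW : measurable W.
  by apply: measurableI; [exact: open_measurable_cV | exact: measurable_ball_cV].
have [r r0 Hr] := H _ s0.
have [M M0 HM] := u_inner r0.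
pose B := Cu * (s * `|e|) + M.
have B0 : 0 <= B by rewrite addr_ge0// mulr_ge0// mulr_ge0// ltW.
exists B; first exact: B0.
have bound tau : 0 < tau <= s ->
    Nle mu p ((fun v : 'cV[R]_d => v + (- (tau *: e))) @^-1` W) (fun x => `|u x|) B.
  move=> /andP[tau0 taus]; set V := _ @^-1` _.
  have mV : measurable V by exact: measurable_shift_set.
  have [q q0 Hq] := H _ tau0.
  pose h := (s - tau) *: e.
  have H1 : Nle mu p V (fun v => `|u (v + h) - u v|) (Cu * `|h|).
    apply: (u_long mV q0) => v t [/= Ov xv] /andP[t0 t1].
    have -> : v + t *: h = (v + - (tau *: e)) + (tau + t * (s - tau)) *: e.
      by rewrite scalerDl addrA subrK scalerA.
    have st : 0 <= s - tau by rewrite subr_ge0.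
    have u1 : 0 <= t * (s - tau) by exact: mulr_ge0.
    have u2 : t * (s - tau) <= s - tau by rewrite -[leRHS]mul1r; exact: ler_wpM2r.
    by apply: (Hq _ _ Ov xv); apply/andP; split; lra.
  have H2 : Nle mu p V (fun v => `|u (v + h)|) M.
    apply: (@Nle_shift _ _ p V (fun v => `|u v|) h M mV mnu).
    apply: (Nle_mono p_ge1 _ _ mnu mnu _ _ _ HM).
    - exact: measurable_shift_set.
    - exact: closed_measurable_cV (@closed_inner_part _ _ _ _).
    - move=> v [/= Ov xv]; rewrite -(subrK (s *: e) v); apply: (Hr _ _ _ _ _); last by rewrite !lexx.
      + by move: Ov; congr Omega; rewrite /h; apply/matrixP => i j; rewrite !mxE; ring.
      + by move: xv; congr (ball x rho _); rewrite /h; apply/matrixP => i j; rewrite !mxE; ring.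
    - by move=> v _; exact: lexx.
    - by rewrite M0 lexx.
  have hs : `|h| <= s * `|e|.
    rewrite normrZ ger0_norm ?subr_ge0//; apply: ler_wpM2r; first exact: normr_ge0.
    by lra.
  have HB : Nle mu p V (fun v => `|u v|) (Cu * `|h| + M).
    apply: (NleD p_ge1 mV _ _ mnu _ _ M0 H1 H2).
    - exact: measurable_diff0.
    - exact: (measurableT_comp mnu (measurable_addr_cV h)).
    - move=> v _; rewrite !normr_id -{1}(subKr (u (v + h)) (u v)).
      by rewrite [leRHS]addrC; exact: ler_normB.
    - by rewrite mulr_ge0.
  apply: (Nle_mono p_ge1 mV mV mnu mnu _ _ _ HB).
  - exact: subset_refl.
  - by move=> v _; exact: lexx.
  - by rewrite addr_ge0 ?mulr_ge0//= /B lerD2r ler_wpM2l.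
pose tau n : R := s / n.+1%:R.
have tau0 n : 0 < tau n <= s.
  by rewrite /tau divr_gt0//= ler_pdivrMr// ler_peMr ?(ltW s0)// ler1n.
have tau_cvg : (fun n => - (tau n *: e)) @ \oo --> (0 : 'cV[R]_d).
  rewrite -oppr0; apply: cvgN; rewrite -(scale0r e); apply: cvgZr_tmp.
  by rewrite -(mulr0 s); apply: cvgMr; exact: cvg_harmonic.
pose V n := (fun v : 'cV[R]_d => v + (- (tau n *: e))) @^-1` W.
have mV n : measurable (V n) by exact: measurable_shift_set.
have mun : measurable_fun setT (fun x : 'cV[R]_d => (`| `|u x| | `^ p)%:E).
  exact: (measurable_normpow p mnu).
(* The bound on V n does not depend on n, and V n exhausts W. *)
apply: (@fatou_ae _ _ _ mu W (fun n => (fun x => (`| `|u x| | `^ p)%:E) \_ (V n))).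
- exact: mW.
- by move=> n; apply/(measurable_restrictT _ (mV n)); exact: measurable_funTS.
- exact: mun.
- by move=> n v; rewrite patchE; case: ifP; rewrite ?lee_fin ?powR_ge0.
- by move=> v; rewrite lee_fin powR_ge0.
- apply: aeW => v Wv; apply: cvg_near_cst.
  have oW : open W by apply: openI => //; exact: ball_open.
  have tv : (fun n => v + (- (tau n *: e))) @ \oo --> v.
    by rewrite -[X in _ --> X]addr0; apply: cvgD => //; exact: cvg_cst.
  have : \forall n \near \oo, W (v + (- (tau n *: e))) by apply: tv; exact: open_nbhs_nbhs.
  by apply: filterS => n Wn; rewrite patchE mem_set.
- apply: nearW => n; rewrite -integral_mkcondr.
  apply: le_trans (bound _ (tau0 n)).
  apply: ge0_subset_integral.
  + exact: measurableI.
  + exact: mV.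
  + exact: measurable_funTS.
  + by move=> v _; rewrite lee_fin powR_ge0.
  + exact: subIsetr.
Qed.

Lemma global_Lp : exists2 M, 0 <= M & Nle mu p Omega (fun x => `|u x|) M.
Proof.
have mO : measurable Omega by exact: open_measurable_cV.
(* A measurable enclosing set again, intersected with [Omega]: the neighbourhoods that cover the
   closure leave the domain. *)
pose P (X : set 'cV[R]_d) := exists B, [/\ measurable B, X `<=` B &
  exists2 M, 0 <= M & Nle mu p (Omega `&` B) (fun x => `|u x|) M].
have cl : compact (closure Omega).
  have [M [Mr H]] := Omega_bounded.
  apply: compact_cV; last exact: closed_closure.
  exists M; split; first exact: Mr.
  move=> t Mt x clx.
  have cb : closed [set v : 'cV[R]_d | `|v| <= t].
    by apply: (@closed_comp _ _ (fun v : 'cV[R]_d => `|v|) [set z | z <= t]);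
      [move=> v _; exact: norm_continuous | exact: closed_le].
  have : closure [set v : 'cV[R]_d | `|v| <= t] x by apply: closure_subset clx => v; exact: H.
  by move/closure_id : cb => <-.
have [B [mB OB [M M0 HM]]] : P (closure Omega).
  apply: (compact_ind cl).
  - exists set0; split; [exact: measurable0|exact: subset_refl|].
    by exists 0 => //; rewrite setI0 /Nle integral_set0 lee_fin powR_ge0.
  - move=> X1 X2 [B1 [mB1 AB1 [M1 M10 H1]]] [B2 [mB2 AB2 [M2 M20 H2]]]; exists (B1 `|` B2); split.
    + exact: measurableU.
    + exact: setUSS.
    + rewrite setIUr; apply: (NleU _ _ M10 M20 H1 H2); exact: measurableI.
  - move=> X1 X2 X21 [B1 [mB1 AB1 H1]]; exists B1; split; [exact: mB1| |exact: H1].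
    exact: subset_trans AB1.
  - move=> x clx; have [Ox|nOx] := pselect (Omega x).
      have /nbhs_ballP[q /= q0 Hq] : nbhs x Omega by exact: open_nbhs_nbhs.
      pose r := q / 2; have r0 : 0 < r by rewrite divr_gt0.
      have [M M0 HM] := u_inner r0.
      exists (ball x r); first exact: nbhsx_ballx.
      exists (ball x r); split; [exact: measurable_ball_cV|exact: subset_refl|].
      exists M; first exact: M0.
      have qE : 2 * r = q by rewrite /r; field.
      rewrite -qE in Hq.
      apply: (Nle_mono p_ge1 _ _ mnu mnu _ _ _ HM).
      + by apply: measurableI; [exact: mO|exact: measurable_ball_cV].
      + exact: closed_measurable_cV (@closed_inner_part _ _ _ _).
      + by move=> v [_ xv]; exact: (inner_part_ball Hq xv).
      + by move=> v _; exact: lexx.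
      + by rewrite M0 lexx.
    have [rho rho0 HM] := boundary_bound (conj clx nOx).
    exists (ball x rho); first exact: nbhsx_ballx.
    by exists (ball x rho); split; [exact: measurable_ball_cV|exact: subset_refl|exact: HM].
exists M; first exact: M0.
apply: (Nle_mono p_ge1 mO _ mnu mnu _ _ _ HM).
- exact: measurableI.
- by move=> x Ox; split; [exact: Ox|apply: OB; exact: subset_closure].
- by move=> v _; exact: lexx.
- by rewrite M0 lexx.
Qed.

End global_integrability.

(** * Weak derivatives from difference quotients *)

Section test_functions.
Context {R : realType} (d : nat).
Implicit Types (f phi : 'cV[R]_d -> R) (K Omega : set 'cV[R]_d).

Lemma compact_support_bounded f K : continuous f -> compact K ->
  (forall x, ~ K x -> f x = 0) -> exists2 B, 0 <= B & forall x, `|f x| <= B.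
Proof.
move=> cf cK f0.
have [M [Mr H]] : bounded_set (f @` K).
  by apply: compact_bounded; apply: continuous_compact => //; exact: continuous_subspaceT.
have M1 : M < `|M| + 1 by rewrite (le_lt_trans (ler_norm M))// ltrDl.
exists (`|M| + 1); first by rewrite addr_ge0.
move=> x; have [Kx|nKx] := pselect (K x); last by rewrite f0// normr0 addr_ge0.
by apply: (H _ M1); exists x.
Qed.

Section one_test_function.
Variables (Omega : set 'cV[R]_d) (phi : 'cV[R]_d -> R) (j : 'I_d).
Hypothesis phiP : test_function Omega phi.
Let e := @basis_cV R d j.
Let K := closure [set x | phi x != 0].

Lemma test_continuous : continuous phi.
Proof. by have [H _ _] := phiP; exact: (H 0%N). Qed.

Lemma test_derivable x : derivable phi x e.
Proof. by have [H _ _] := phiP; have [_ /(_ j)[]] := H 1%N. Qed.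

Lemma test_derive_continuous : continuous ('D_e phi).
Proof. by have [H _ _] := phiP; have [_ /(_ j)[]] := H 1%N. Qed.

Lemma test_outside x : ~ K x -> phi x = 0.
Proof. by move=> nK; apply: contrapT => /eqP px; apply: nK; apply: subset_closure. Qed.

Lemma test_bounded : exists2 B, 0 <= B & forall x, `|phi x| <= B.
Proof.
by have [_ cK _] := phiP; apply: compact_support_bounded test_continuous cK test_outside.
Qed.

Lemma test_derive_cvg x (s : nat -> R) : (forall n, s n != 0) -> s @ \oo --> 0 ->
  (fun n => (s n)^-1 * (phi (x + s n *: e) - phi x)) @ \oo --> 'D_e phi x.
Proof.
move=> s0 scvg.
have H : (fun h => h^-1 *: ((phi \o shift x) (h *: e) - phi x)) @ 0^' --> 'D_e phi x.
  exact: test_derivable.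
have -> : (fun n => (s n)^-1 * (phi (x + s n *: e) - phi x)) =
    (fun h => h^-1 *: ((phi \o shift x) (h *: e) - phi x)) \o s.
  by apply/funext => n /=; rewrite [x + _]addrC.
apply: (cvg_comp s _ _ H) => A; rewrite /dnbhs withinE => -[B B0 AB].
have : \forall n \near \oo, B (s n) by exact: scvg.
apply: filterS => n Bn /=.
have : (B `&` (fun x0 : R => x0 != 0)) (s n) by split; [exact: Bn | exact: s0].
by rewrite -AB => -[].
Qed.

Lemma test_derive_outside x : ~ K x -> 'D_e phi x = 0.
Proof.
move=> nK.
pose s (n : nat) : R := n.+1%:R^-1.
have s0 n : s n != 0 by rewrite invr_eq0 pnatr_eq0.
have scvg : s @ \oo --> 0 by exact: cvg_harmonic.
have := @test_derive_cvg x s s0 scvg; move/cvg_lim => <- //; apply/cvg_lim => //; apply: cvg_near_cst.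
have oK : open (~` K) by apply: closed_openC; exact: closed_closure.
have tv : (fun n => x + s n *: e) @ \oo --> x.
  rewrite -[X in _ --> X]addr0; apply: cvgD; first exact: cvg_cst.
  by rewrite -(scale0r e); apply: cvgZr_tmp.
have : \forall n \near \oo, (~` K) (x + s n *: e) by apply: tv; exact: open_nbhs_nbhs.
by apply: filterS => n Kn; rewrite !test_outside// subrr mulr0.
Qed.

Lemma test_derive_bounded : exists2 B, 0 <= B & forall x, `|'D_e phi x| <= B.
Proof.
have [_ cK _] := phiP.
exact: compact_support_bounded test_derive_continuous cK test_derive_outside.
Qed.

Lemma test_lipschitz B x (s : R) : (forall x, `|'D_e phi x| <= B) ->
  `|phi (x + s *: e) - phi x| <= B * `|s|.
Proof.
move=> HB.
have key y t : 0 <= t -> `|phi (y + t *: e) - phi y| <= B * t.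
  move=> t0; pose F (a : R) := phi (y + a *: e).
  have dF (a : R) : is_derive a (1 : R) F ('D_e phi (y + a *: e)).
    have dq : (fun h : R => h^-1 *: ((F \o shift a) (h *: 1) - F a)) =
        (fun h => h^-1 *: ((phi \o shift (y + a *: e)) (h *: e) - phi (y + a *: e))).
      apply/funext => h; rewrite /F /= scaler1 /shift /=; congr (_ *: (phi _ - _)).
      by rewrite scalerDl addrCA addrA.
    split; first by rewrite /derivable dq; exact: test_derivable.
    by rewrite /derive dq.
  have cF : {within `[0, t], continuous F}.
    apply: continuous_subspaceT => a; apply: differentiable_continuous.
    by apply/derivable1_diffP; have [] := dF a.
  have [c _] := MVT_segment t0 (fun a _ => dF a) cF.
  rewrite /F scale0r addr0 subr0 => ->.
  by rewrite normrM (ger0_norm t0) ler_wpM2r.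
have [s0|s0] := leP 0 s; first by rewrite (ger0_norm s0); exact: key.
rewrite (ltr0_norm s0) distrC.
have := key (x + s *: e) (- s); rewrite scaleNr addrK; apply.
by rewrite oppr_ge0 ltW.
Qed.

End one_test_function.
End test_functions.

Section integrable_theory.
Context {R : realType} (d : nat).
Notation mu := (@lebesgue_cV R d).
Implicit Types (w : 'cV[R]_d -> R) (D : set 'cV[R]_d).

Lemma Nle_integrable p D w M : 1 <= p -> measurable D -> (mu D < +oo)%E ->
  measurable_fun setT w -> Nle mu p D w M -> mu.-integrable D (EFin \o w).
Proof.
move=> p1 mD Doo mw H; apply/integrableP; split.
  by apply/measurable_EFinP; exact: measurable_funTS.
apply: (@le_lt_trans _ _ (\int[mu]_(x in D) (1%:E + (`|w x| `^ p)%:E))%E).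
  apply: ge0_le_integral => //.
  - apply: measurableT_comp => //; apply/measurable_EFinP; exact: measurable_funTS.
  - by apply: emeasurable_funD => //; exact: measurable_normpowS.
  - move=> x _; rewrite /= lee_fin.
    have [g1|/ltW g1] := leP `|w x| 1; first by rewrite (le_trans g1)// lerDl powR_ge0.
    by rewrite (le_trans (le1r_powR g1 p1))// lerDr.
rewrite ge0_integralD//; last exact: measurable_normpowS.
rewrite integral_cst// mul1e lte_add_pinfty//.
by rewrite (le_lt_trans H)// ltry.
Qed.

Lemma integral_shift (h : 'cV[R]_d) (f : 'cV[R]_d -> \bar R) : measurable_fun setT f ->
  (\int[mu]_x f (x + h)%R = \int[mu]_x f x)%E.
Proof.
move=> mf; rewrite integralE [RHS]integralE; congr (_ - _)%E.
- have := @ge0_integral_shift _ _ h setT (f^\+)%E measurableT (measurable_funepos mf)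
    (funepos_ge0 f); rewrite preimage_setT => H; apply: etrans H; apply: eq_integral => x _; by rewrite !funeposE /=.
- have := @ge0_integral_shift _ _ h setT (f^\-)%E measurableT (measurable_funeneg mf)
    (funeneg_ge0 f); rewrite preimage_setT => H; by apply: etrans H; apply: eq_integral => x _; rewrite !funenegE.
Qed.

Lemma integrable_shift (h : 'cV[R]_d) (f : 'cV[R]_d -> \bar R) :
  mu.-integrable setT f -> mu.-integrable setT (fun x => f (x + h)).
Proof.
move=> /integrableP[mf foo]; apply/integrableP; split.
  exact: (measurableT_comp mf (measurable_addr_cV h)).
rewrite (@integral_shift h (fun x => `|f x|)%E)//.
exact: measurableT_comp.
Qed.

Lemma integrable_mul_bounded D w (phi : 'cV[R]_d -> R) B : measurable D ->
  mu.-integrable D (EFin \o w) ->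
  measurable_fun setT phi -> (forall x, `|phi x| <= B) ->
  mu.-integrable D (EFin \o (fun x => w x * phi x)).
Proof.
move=> mD iw mphi HB.
have -> : EFin \o (fun x => w x * phi x) = ((EFin \o w) \* (EFin \o phi))%E.
  by apply/funext => x /=; rewrite EFinM.
apply: integrableMl => //; first exact: measurable_funTS.
exists B; split; first exact: num_real.
by move=> t Bt x _ /=; rewrite (le_trans (HB x))// ltW.
Qed.

Variables (Omega : set 'cV[R]_d) (phi : 'cV[R]_d -> R) (j : 'I_d).
Hypothesis phiP : test_function Omega phi.
Let e := @basis_cV R d j.

Let mphi : measurable_fun setT phi.
Proof. by apply: continuous_measurable_cV; exact: test_continuous phiP. Qed.

Lemma summation_by_parts w (s : R) : mu.-integrable setT (EFin \o w) ->
  \int[mu]_x ((w (x - s *: e) - w x) * phi x) = \int[mu]_x (w x * (phi (x + s *: e) - phi x)).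
Proof.
move=> iw; have [B B0 HB] := test_bounded phiP.
have mw : measurable_fun setT w by apply/measurable_EFinP; have /integrableP[] := iw.
have HB' x : `|phi (x + s *: e)| <= B by exact: HB.
have mphi' : measurable_fun setT (fun x : 'cV[R]_d => phi (x + s *: e)).
  exact: (measurableT_comp mphi (measurable_addr_cV _)).
under eq_Rintegral do rewrite mulrBl.
under [RHS]eq_Rintegral do rewrite mulrBr.
have i2 := integrable_mul_bounded measurableT iw mphi HB.
have i1 := integrable_mul_bounded measurableT (integrable_shift (- (s *: e)) iw) mphi HB.
have i3 := integrable_mul_bounded measurableT iw mphi' HB'.
rewrite RintegralB// RintegralB//; congr (_ - _).
rewrite /Rintegral -(@integral_shift (- (s *: e)) (fun x => (w x * phi (x + s *: e))%:E)).
  by congr fine; apply: eq_integral => x _; rewrite subrK.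
by apply/measurable_EFinP; exact: measurable_funM.
Qed.

(** Dominated convergence: by the mean value theorem the quotients of [phi] are bounded by a bound
    [B] of its derivative, so [B * |w|] dominates. *)
Lemma difference_quotient_cvg w (s : nat -> R) : mu.-integrable setT (EFin \o w) ->
  (forall n, s n != 0) -> s @ \oo --> 0 ->
  (fun n => \int[mu]_x (w x * ((s n)^-1 * (phi (x + s n *: e) - phi x)))) @ \oo -->
  \int[mu]_x (w x * 'D_e phi x).
Proof.
move=> iw s0 scvg.
have mw : measurable_fun setT w by apply/measurable_EFinP; have /integrableP[] := iw.
have [B B0 HB] := test_derive_bounded j phiP.
have mD : measurable_fun setT ('D_e phi).
  by apply: continuous_measurable_cV; exact: test_derive_continuous phiP.
have i1 := integrable_mul_bounded measurableT iw mD HB.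
apply: fine_cvg; rewrite fineK; last exact: integrable_fin_num.
apply: (@dominated_cvg _ _ _ mu setT measurableT
  (fun n x => (w x * ((s n)^-1 * (phi (x + s n *: e) - phi x)))%:E)
  (fun x => (w x * 'D_e phi x)%:E) (fun x => (B%:E * `|(w x)%:E|)%E)).
- move=> n; apply/measurable_EFinP; apply: measurable_funM => //.
  apply: measurable_funM => //; apply: measurable_funB => //.
  exact: (measurableT_comp mphi (measurable_addr_cV _)).
- move=> x _; apply: cvg_EFin; first exact: nearW.
  apply: cvgM; first exact: cvg_cst.
  exact: (@test_derive_cvg _ _ _ _ j phiP x s s0 scvg).
- by [].
- by apply: integrableZl => //; exact: integrable_abse.
- move=> n x _; rewrite -EFinM lee_fin normrM mulrC ler_wpM2r//.
  rewrite normrM normfV mulrC ler_pdivrMr ?normr_gt0//.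
  exact: (test_lipschitz phiP).
Qed.

End integrable_theory.

Section weak_partial.
Context {R : realType} (d : nat) (p : R) (p_gt1 : 1 < p).
Notation mu := (@lebesgue_cV R d).
Variables (Omega : set 'cV[R]_d) (w : 'cV[R]_d -> R) (j : 'I_d) (M Ct K0 : R).
Hypothesis Omega_open : open Omega.
Hypothesis Omega_bounded : bounded_set Omega.
Hypothesis mw : measurable_fun setT w.
Hypothesis wM : Nle mu p Omega w M.
Hypothesis Ct0 : 0 <= Ct.
Hypothesis K0_ge1 : 1 <= K0.
Let e := @basis_cV R d j.
Hypothesis wtr : forall (V : set 'cV[R]_d) r t, measurable V -> V `<=` inner_part Omega r ->
  0 < t -> K0 * t < r -> Nle mu p V (fun x => w (x + t *: e) - w x) (Ct * t).

Let p_ge1 : 1 <= p. Proof. exact: ltW. Qed.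
Let p0 : 0 < p. Proof. exact: lt_trans p_gt1. Qed.
Let mO : measurable Omega. Proof. exact: open_measurable_cV. Qed.
Let Ooo : (mu Omega < +oo)%E. Proof. exact: lebesgue_cV_bounded. Qed.

(** Steps small enough that [K0 * t n] is below the radius [1 / (n + 1)] of [exhaust Omega n], on
    which the n-th difference quotient is then controlled. *)
Let t (n : nat) : R := ((K0 + 1) * n.+1%:R)^-1.

Let t0 n : 0 < t n.
Proof. by rewrite invr_gt0 mulr_gt0// addr_gt0// (lt_le_trans ltr01). Qed.

Let Kt n : K0 * t n < n.+1%:R^-1.
Proof.
have K1 : 0 < K0 + 1 by rewrite addr_gt0// (lt_le_trans ltr01).
rewrite /t invfM mulrA gtr_pMl ?invr_gt0// ltr_pdivrMr// mul1r; lra.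
Qed.

Let t_le n : t n < n.+1%:R^-1.
Proof. by apply: le_lt_trans (Kt n); rewrite ler_peMl// ltW. Qed.

Let t_cvg : t @ \oo --> 0.
Proof.
apply: (@squeeze_cvgr _ _ _ _ (fun=> 0) (fun n => n.+1%:R^-1)).
- by apply: nearW => n; rewrite !ltW.
- exact: cvg_cst.
- exact: cvg_harmonic.
Qed.

Let Nle_patch (V D : set 'cV[R]_d) (f : 'cV[R]_d -> R) a : V `<=` D ->
  Nle mu p V f a -> Nle mu p D (f \_ V) a.
Proof.
move=> VD; rewrite /Nle => H; apply: le_trans H.
have -> : V = D `&` V by apply/esym; exact: setIidr.
rewrite integral_mkcondr le_eqVlt; apply/orP; left; apply/eqP; apply: eq_integral => x Dx.
rewrite !patchE in_setI Dx /=; case: ifP => //.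
by rewrite normr0 powR0// gt_eqF.
Qed.

Let g n := (fun x : 'cV[R]_d => (t n)^-1 * (w (x + t n *: e) - w x)) \_ (exhaust Omega n).

Let mshift n : measurable_fun setT (fun x : 'cV[R]_d => w (x + t n *: e) - w x).
Proof. by apply: measurable_funB => //; exact: (measurableT_comp mw (measurable_addr_cV _)). Qed.

Let mg n : measurable_fun setT (g n).
Proof.
apply/(measurable_restrictT _ (@measurable_exhaust _ _ Omega n)); apply: measurable_funTS.
by apply: measurable_funM => //; exact: mshift.
Qed.

Let gC n : Nle mu p Omega (g n) Ct.
Proof.
apply: Nle_patch; first exact: exhaust_sub.
have := wtr (measurable_exhaust Omega n) (@subset_refl _ _) (t0 n) (Kt n).
move=> /(NleZ (t n)^-1 (measurable_exhaust Omega n) (mshift n)).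
have -> : `|(t n)^-1| * (Ct * t n) = Ct.
  have it0 : 0 < (t n)^-1 by rewrite invr_gt0; exact: t0.
  rewrite (gtr0_norm it0) mulrCA mulVf ?mulr1; first by [].
  by have := t0 n; rewrite lt_neqAle eq_sym => /andP[].
by apply; rewrite mulr_ge0// ltW.
Qed.

Let iO f a : measurable_fun setT f -> Nle mu p Omega f a -> mu.-integrable Omega (EFin \o f).
Proof. exact: Nle_integrable. Qed.

Let iphi f a phi : measurable_fun setT f -> Nle mu p Omega f a -> test_function Omega phi ->
  mu.-integrable Omega (EFin \o (fun x => f x * phi x)).
Proof.
move=> mf fa phiP; have [B _ HB] := test_bounded phiP.
apply: (integrable_mul_bounded mO (iO mf fa) _ HB).
by apply: continuous_measurable_cV; exact: test_continuous phiP.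
Qed.

Let L (phi : 'cV[R]_d -> R) : R := \int[mu]_(x in Omega) (w x * 'D_e phi x).

(** Summation by parts turns forward quotients of [w] into backward quotients of [phi], that is,
    quotients with step [- t n]; this is the origin of the minus sign. *)
Let g_cvg phi : test_function Omega phi ->
  (fun n => \int[mu]_(x in Omega) (g n x * phi x)) @ \oo --> - L phi.
Proof.
move=> phiP; pose W := w \_ Omega.
have iW : mu.-integrable setT (EFin \o W).
  by rewrite -restrict_EFin; apply/(integrable_mkcond _ mO); exact: iO wM.
have -> : L phi = \int[mu]_x (W x * 'D_e phi x).
  rewrite /L Rintegral_mkcond; apply: eq_Rintegral => x _.
  by rewrite /W !patchE; case: ifP => // _; exact/esym/mul0r.
have s0 n : - t n != 0 by rewrite oppr_eq0 gt_eqF.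
have scvg : (fun n => - t n) @ \oo --> 0 by rewrite -oppr0; exact: cvgN.
pose f1 n := - (\int[mu]_x (W x * ((- t n)^-1 * (phi (x + - t n *: e) - phi x)))).
pose f2 n := \int[mu]_(x in Omega) (g n x * phi x).
have H : f1 @ \oo --> - \int[mu]_x (W x * 'D_e phi x).
  by apply: cvgN; exact: (difference_quotient_cvg phiP iW s0 scvg).
suff E : {near \oo, f1 =1 f2} by exact: (cvg_trans (near_eq_cvg E) H).
rewrite /f1 /f2.
have [_ cK KO] := phiP; have [j0 Kj0] := compact_sub_exhaust Omega_open cK KO.
near=> n; apply/esym; have nj : (j0 <= n)%N by near: n; exact: nbhs_infty_ge.
have -> : \int[mu]_(x in Omega) (g n x * phi x) =
    \int[mu]_x ((t n)^-1 * ((W (x - (- t n) *: e) - W x) * phi x)).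
  rewrite Rintegral_mkcond; apply: eq_Rintegral => x _.
  (* Off the support both sides vanish. On it, for [n >= j0], both [x] and [x + t n *: e] lie in
     [Omega], so the truncations in [W] and [g n] have no effect. *)
  have [Kx|nKx] := pselect (closure [set x | phi x != 0] x); last first.
    by rewrite patchE (test_outside nKx) !mulr0; case: ifP.
  have jx := Kj0 _ Kx; have nx := @exhaust_nd _ _ Omega _ _ nj _ jx.
  have Ox := exhaust_sub jx.
  have Oxt : Omega (x + t n *: e).
    apply: nx; rewrite -ball_normE /ball_/= opprD addrA subrr sub0r normrN normrZ (gtr0_norm (t0 n)).
    apply: le_lt_trans (t_le n); rewrite ler_piMr ?(ltW (t0 n))//.
    by apply/mx_norm_leP => // a b; rewrite mxE; case: (_ && _); rewrite ?normr0 ?normr1.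
  by rewrite scaleNr opprK /W /g !patchE !mem_set// mulrA.
have iWt : mu.-integrable setT (EFin \o (fun x : 'cV[R]_d => (W (x - - t n *: e) - W x) * phi x)).
  have [B _ HB] := test_bounded phiP.
  apply: (integrable_mul_bounded measurableT _ _ HB).
    by apply: (@integrableB _ _ _ mu setT measurableT _ _ (integrable_shift _ iW) iW).
  by apply: continuous_measurable_cV; exact: test_continuous phiP.
rewrite RintegralZl// (summation_by_parts j phiP (- t n) iW).
have i2 : mu.-integrable setT (EFin \o (fun x : 'cV[R]_d => W x * (phi (x + - t n *: e) - phi x))).
  have [B _ HB] := test_bounded phiP.
  apply: (@integrable_mul_bounded _ _ _ _ _ (B + B) measurableT iW).
    apply: measurable_funB; last by apply: continuous_measurable_cV; exact: test_continuous phiP.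
    apply: (measurableT_comp _ (measurable_addr_cV _)).
    by apply: continuous_measurable_cV; exact: test_continuous phiP.
  by move=> x; rewrite (le_trans (ler_normB _ _))// lerD.
have -> : \int[mu]_x (W x * ((- t n)^-1 * (phi (x + - t n *: e) - phi x))) =
    \int[mu]_x ((- t n)^-1 * (W x * (phi (x + - t n *: e) - phi x))).
  by apply: eq_Rintegral => x _; rewrite mulrCA.
by rewrite RintegralZl// invrN mulNr opprK.
Unshelve. all: by end_near.
Qed.

Let bound phi B f a : test_function Omega phi -> (forall x, `|phi x| <= B) -> 0 <= B ->
  measurable_fun setT f -> 0 <= a -> Nle mu 1 Omega f a ->
  `|\int[mu]_(x in Omega) (f x * phi x)| <= B * a.
Proof.
move=> phiP HB B0 mf a0 fa.
have if_ := Nle_integrable (lexx 1) mO Ooo mf fa.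
have mphi : measurable_fun setT phi.
  by apply: continuous_measurable_cV; exact: test_continuous phiP.
have ifp := integrable_mul_bounded mO if_ mphi HB.
rewrite -lee_fin EFin_normr_Rintegral//.
apply: le_trans (le_abse_integral mu mO (measurable_int _ ifp)) _.
apply: (@le_trans _ _ (\int[mu]_(x in Omega) (B%:E * (`|f x| `^ 1)%:E))%E).
  apply: ge0_le_integral => //.
  - by apply: measurableT_comp => //; exact: measurable_int ifp.
  - apply: measurable_funeM; exact: measurable_normpowS.
  - by move=> x _; rewrite -EFinM lee_fin powRr1// normrM mulrC ler_wpM2r.
rewrite ge0_integralZl//; last exact: measurable_normpowS.
by rewrite EFinM; apply: lee_wpmul2l; [rewrite lee_fin|move: fa; rewrite /Nle powRr1].
Qed.

(* Decreasing in n and closed under midpoints, unlike the tail of the sequence g. *)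
Let K (n : nat) : set ('cV[R]_d -> R) := [set f | [/\ measurable_fun setT f,
  Nle mu p Omega f Ct & forall phi, test_function Omega phi -> forall eta,
    (forall m, (n <= m)%N -> `|\int[mu]_(x in Omega) (g m x * phi x) + L phi| <= eta) ->
    `|\int[mu]_(x in Omega) (f x * phi x) + L phi| <= eta]].

(** Members of [K n] act on a test function as well as the tail of the quotients does. [weak_limit]
    selects members that converge in L^1, which suffices against a bounded [phi], and its limit
    keeps the L^p bound [Ct]. *)
Lemma weak_partial : exists2 G : 'cV[R]_d -> R, measurable_fun setT G /\ Nle mu p Omega G Ct &
  forall phi, test_function Omega phi ->
    \int[mu]_(x in Omega) (w x * 'D_e phi x) = - \int[mu]_(x in Omega) (G x * phi x).
Proof.
have [f [l [Kf ml lC fl]]] : exists (f : nat -> 'cV[R]_d -> R) (l : 'cV[R]_d -> R),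
    [/\ forall n, K n (f n), measurable_fun setT l, Nle mu p Omega l Ct &
      forall n, Nle mu 1 Omega (fun x => f n x - l x) ((4^-1) ^+ n)].
  apply: (weak_limit p_gt1 mO Ooo (K := K)).
  - by move=> n; exists (g n); split; [exact: mg|exact: gC|move=> phi phiP eta H; exact: H].
  - move=> m n mn f [mf fC Hf]; split; [exact: mf|exact: fC|].
    by move=> phi phiP eta H; apply: Hf => // k nk; apply: H; exact: leq_trans nk.
  - by move=> n f [].
  - by move=> n f [].
  - move=> n f h [mf fC Hf] [mh hC Hh].
    have mf2 : measurable_fun setT (fun x => 2^-1 * f x) by apply: measurable_funM.
    have mh2 : measurable_fun setT (fun x => 2^-1 * h x) by apply: measurable_funM.
    have E : (fun x => (f x + h x) / 2) = (fun x => 2^-1 * f x + 2^-1 * h x).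
      by apply/funext => x; rewrite -mulrDr mulrC.
    rewrite E; split.
    + exact: measurable_funD.
    + have half0 : 0 <= `|2^-1 : R| * Ct by rewrite mulr_ge0.
      have -> : Ct = `|2^-1| * Ct + `|2^-1| * Ct.
        by rewrite ger0_norm ?invr_ge0//; field.
      apply: (NleD p_ge1 mO mf2 mh2 (measurable_funD mf2 mh2) _ half0 half0).
      * by move=> x _; exact: ler_normD.
      * exact: NleZ.
      * exact: NleZ.
    + move=> phi phiP eta H.
      have Hf' := Hf _ phiP _ H; have Hh' := Hh _ phiP _ H.
      have if_ := iphi mf fC phiP; have ih := iphi mh hC phiP.
      have if2 := iphi mf2 (NleZ 2^-1 mO mf Ct0 fC) phiP.
      have ih2 := iphi mh2 (NleZ 2^-1 mO mh Ct0 hC) phiP.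
      under eq_Rintegral do rewrite mulrDl.
      rewrite RintegralD//.
      under eq_Rintegral do rewrite -mulrA.
      under [X in _ + X + _]eq_Rintegral do rewrite -mulrA.
      rewrite !RintegralZl//.
      set a := Rintegral _ _ _ in Hf' *; set b := Rintegral _ _ _ in Hh' *.
      move: Hf' Hh'; rewrite !ler_norml => /andP[? ?] /andP[? ?]; apply/andP; split; lra.
exists l; first by split.
move=> phi phiP; apply/eqP; rewrite -subr_eq0 opprK addrC; apply/eqP.
apply: normr0_eq0; apply/eqP; rewrite eq_le normr_ge0 andbT.
apply/ler_addgt0Pr => eta eta0; rewrite add0r.
have [B B0 HB] := test_bounded phiP.
have [N _ HN] : \forall n \near \oo, `|\int[mu]_(x in Omega) (g n x * phi x) + L phi| <= eta / 2.
  have /cvgrPdist_le/(_ _ (divr_gt0 eta0 (ltr0n _ 2))) := g_cvg phiP.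
  by apply: filterS => n; rewrite -normrN opprB opprK.
have [n [Nn HnB]] : exists n, (N <= n)%N /\ B * (4^-1) ^+ n <= eta / 2.
  have : (fun n => B * (4^-1) ^+ n) @ \oo --> (0 : R).
    rewrite -(mulr0 B); apply: cvgMr; apply: cvg_expr.
    by rewrite ger0_norm ?invr_ge0// invf_lt1// ltr1n.
  move=> /cvgrPdist_le/(_ _ (divr_gt0 eta0 (ltr0n _ 2)))[N' _ HN'].
  exists (maxn N N'); split; first exact: leq_maxl.
  have := HN' (maxn N N') (leq_maxr _ _).
  by rewrite sub0r normrN ger0_norm// mulr_ge0// exprn_ge0// invr_ge0.
have [mf fC Hf] := Kf n.
have H1 := Hf _ phiP (eta / 2) (fun m nm => HN m (leq_trans Nn nm)).
have H2 := bound phiP HB B0 (measurable_funB mf ml) (exprn_ge0 _ _) (fl n).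
have if_ := iphi mf fC phiP; have il := iphi ml lC phiP.
have E : \int[mu]_(x in Omega) ((f n x - l x) * phi x) =
    \int[mu]_(x in Omega) (f n x * phi x) - \int[mu]_(x in Omega) (l x * phi x).
  by rewrite -RintegralB//; apply: eq_Rintegral => x _; rewrite mulrBl.
rewrite E in H2; rewrite -/(L phi).
set a := Rintegral _ _ (fun x => f n x * phi x) in H1 H2.
set b := Rintegral _ _ (fun x => l x * phi x) in H2 *.
have H3 : `|a - b| <= eta / 2 by apply: le_trans HnB; apply: H2; rewrite invr_ge0.
have -> : b + L phi = (a + L phi) - (a - b) by ring.
by rewrite (le_trans (ler_normB _ _))// [leRHS]splitr lerD.
Qed.

End weak_partial.

(** * From integral bounds to membership in L^p and W^{1,p} *)

Section Lp_membership.
Context {R : realType} (d : nat) (p : R) (p_ge1 : 1 <= p).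
Notation mu := (@lebesgue_cV R d).
Implicit Types (V U Omega : set 'cV[R]_d).

Lemma measurable_enorm m n (F : 'cV[R]_d -> 'M[R]_(m, n)) : measurable_fun setT F ->
  measurable_fun setT (fun x => enorm (F x)).
Proof.
move=> mF; apply: (@measurableT_comp _ _ _ _ _ _ (@Num.sqrt R)).
  by apply: continuous_measurable_fun => x; exact: sqrt_continuous.
apply: measurable_sum => i; apply: measurable_sum => j.
have mij : measurable_fun setT (fun x => F x i j).
  exact: (measurableT_comp (measurable_coord i j) mF).
exact: measurable_funX.
Qed.

Lemma Nle_bounded V (g : 'cV[R]_d -> R) B : measurable V -> (mu V < +oo)%E ->
  measurable_fun setT g -> (forall x, V x -> `|g x| <= B) ->
  exists2 M, 0 <= M & Nle mu p V g M.
Proof.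
move=> mV Voo mg gB.
have p0 : p != 0 by rewrite gt_eqF// (lt_le_trans ltr01).
have muE : mu V = (fine (mu V))%:E by rewrite fineK// ge0_fin_numE.
have m0 : 0 <= fine (mu V) by rewrite fine_ge0.
exists ((`|B| `^ p * fine (mu V)) `^ p^-1); first exact: powR_ge0.
rewrite /Nle powR_invK//; last by rewrite mulr_ge0// powR_ge0.
apply: (@le_trans _ _ (\int[mu]_(x in V) (`|B| `^ p)%:E)%E).
  apply: ge0_le_integral => //.
  - exact: measurable_normpowS.
  - move=> x Vx; rewrite lee_fin ge0_ler_powR ?nnegrE//; last first.
      by rewrite (le_trans (gB _ Vx))// ler_norm.
    exact: le_trans p_ge1.
by apply: Nle_cst => //; rewrite -muE.
Qed.

Lemma Nle_sum V (I : Type) (s : seq I) (f : I -> 'cV[R]_d -> R) a : measurable V ->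
  (forall i, measurable_fun setT (f i)) -> 0 <= a -> (forall i, Nle mu p V (f i) a) ->
  Nle mu p V (fun x => \sum_(i <- s) `|f i x|) ((size s)%:R * a).
Proof.
move=> mV mf a0 fa; elim: s => [|i s IH].
  rewrite /Nle (eq_integral (cst 0%E)) ?integral0 ?lee_fin ?powR_ge0//.
  by move=> x _; rewrite big_nil normr0 powR0// gt_eqF// (lt_le_trans ltr01).
have ms l : measurable_fun setT (fun x => \sum_(i <- l) `|f i x|).
  by apply: measurable_sum => k; exact: measurableT_comp.
rewrite /= mulrSr mulrDl mul1r [_ * a + a]addrC.
apply: (NleD p_ge1 mV (mf i) (ms s) (ms (i :: s)) _ a0 _ (fa i) IH).
- by move=> x _; rewrite big_cons (le_trans (ler_normD _ _))// normr_id.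
- by rewrite mulr_ge0.
Qed.

(** The square root is the price of passing from the sup norm of the entries to the Frobenius
    norm. *)
Lemma Lp_norm_le U m n (F : 'cV[R]_d -> 'M[R]_(m, n)) (g : 'cV[R]_d -> R) a :
  measurable U -> measurable_fun setT F -> measurable_fun setT g -> 0 <= a ->
  (forall x, `|F x| <= g x) -> Nle mu p U g a ->
  (Lp_norm p U F <= (Num.sqrt (m * n)%:R * a)%:E)%E.
Proof.
move=> mU mF mg a0 Fg Fa.
have -> : Lp_norm p U F = 'N[mu]_p%:E[EFin \o ((fun x => enorm (F x)) \_ U)]%E.
  by rewrite /Lp_norm -restrict_EFin.
have k0 : 0 <= Num.sqrt (m * n)%:R * a by rewrite mulr_ge0.
apply/(NleP mu p_ge1 mU (measurable_enorm mF) k0).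
have H := NleZ (Num.sqrt (m * n)%:R) mU mg a0 Fa.
have mkg : measurable_fun setT (fun x => Num.sqrt (m * n)%:R * g x) by apply: measurable_funM.
apply: (Nle_mono p_ge1 mU mU (measurable_enorm mF) mkg _ _ _ H).
- exact: subset_refl.
- move=> x _; rewrite ger0_norm ?enorm_ge0// (le_trans (enorm_le_norm _))//.
  rewrite normrM (ger0_norm (sqrtr_ge0 _)) ler_wpM2l// (le_trans (Fg x))//.
  exact: ler_norm.
- by rewrite mulr_ge0//= (ger0_norm (sqrtr_ge0 _)).
Qed.

Lemma eq_Lp_norm U m n (F G : 'cV[R]_d -> 'M[R]_(m, n)) :
  (forall x, U x -> F x = G x) -> Lp_norm p U F = Lp_norm p U G.
Proof.
move=> FG; rewrite /Lp_norm; congr Lnorm; apply/funext => x; rewrite !patchE.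
by case: ifPn => // /set_mem /FG ->.
Qed.

Lemma memLp_le U m n (F : 'cV[R]_d -> 'M[R]_(m, n)) (g : 'cV[R]_d -> R) a :
  measurable U -> measurable_fun setT F -> measurable_fun setT g -> 0 <= a ->
  (forall x, `|F x| <= g x) -> Nle mu p U g a -> memLp p U F.
Proof.
move=> mU mF mg a0 Fg Fa; split; first exact: measurable_funTS.
by rewrite (le_lt_trans (Lp_norm_le mU mF mg a0 Fg Fa))// ltry.
Qed.

Lemma eq_memLp U m n (F G : 'cV[R]_d -> 'M[R]_(m, n)) :
  (forall x, U x -> F x = G x) -> memLp p U F -> memLp p U G.
Proof.
move=> FG [mF Foo]; split; last by rewrite -(eq_Lp_norm FG).
by apply: eq_measurable_fun mF => x /set_mem; exact: FG.
Qed.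

End Lp_membership.

Section sobolev.
Context {R : realType} (d m : nat) (p : R) (p_gt1 : 1 < p).
Notation mu := (@lebesgue_cV R d).

(** Each pair of a component and a direction is a scalar problem for [weak_partial]; the gradient is
    assembled from the solutions and bounded by the sum of its entries. *)
Lemma memW1p_translations (Omega : set 'cV[R]_d) (u : 'cV[R]_d -> 'cV[R]_m) (M C K : R) :
  open Omega -> bounded_set Omega -> measurable_fun setT u ->
  0 <= M -> Nle mu p Omega (fun x => `|u x|) M -> 0 <= C -> 1 <= K ->
  (forall (V : set 'cV[R]_d) r (h : 'cV[R]_d), measurable V -> V `<=` inner_part Omega r ->
    K * `|h| < r -> Nle mu p V (fun x => `|u (x + h) - u x|) (C * `|h|)) ->
  memW1p p Omega u.
Proof.
move=> oO bO mu_u M0 uM C0 K1 utr.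
have p1 : 1 <= p := ltW p_gt1.
have mO : measurable Omega by exact: open_measurable_cV.
have mnu : measurable_fun setT (fun x : 'cV[R]_d => `|u x|).
  exact: (measurableT_comp (@measurable_norm_cV R m) mu_u).
have mui i : measurable_fun setT (fun x : 'cV[R]_d => u x i ord0).
  exact: (measurableT_comp (measurable_coord i ord0) mu_u).
have basis_le (j : 'I_d) : `|@basis_cV R d j| <= 1.
  by apply/mx_norm_leP => // a b; rewrite mxE; case: (_ && _); rewrite ?normr0 ?normr1.
split; first by exact: (memLp_le p1 mO mu_u mnu M0 (fun x => lexx _) uM).
have /choice[Gf HG] : forall ij : 'I_m * 'I_d, exists G : 'cV[R]_d -> R,
    [/\ measurable_fun setT G, Nle mu p Omega G C &
    forall phi, test_function Omega phi ->
      \int[mu]_(x in Omega) (u x ij.1 ord0 * 'D_(basis_cV ij.2) phi x) =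
      - \int[mu]_(x in Omega) (G x * phi x)].
  move=> [i j] /=.
  have wM : Nle mu p Omega (fun x => u x i ord0) M.
    apply: (Nle_mono p1 mO mO (mui i) mnu _ _ _ uM).
    - exact: subset_refl.
    - by move=> x _; rewrite normr_id; exact: ler_mx_norm.
    - by rewrite M0 lexx.
  have wtr (V : set 'cV[R]_d) r t : measurable V -> V `<=` inner_part Omega r ->
      0 < t -> K * t < r ->
      Nle mu p V (fun x => u (x + t *: basis_cV j) i ord0 - u x i ord0) (C * t).
    move=> mV Vr t0 Kt.
    have hle : `|t *: @basis_cV R d j| <= t.
      by rewrite normrZ gtr0_norm// ler_piMr// ltW.
    have Kh : K * `|t *: @basis_cV R d j| < r.
      by apply: le_lt_trans Kt; rewrite ler_wpM2l// (le_trans ler01).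
    have H := utr V r _ mV Vr Kh.
    apply: (Nle_mono p1 mV mV _ (measurable_diff0 _ mu_u) _ _ _ H).
    - apply: measurable_funB; last exact: mui.
      exact: (measurableT_comp (mui i) (measurable_addr_cV _)).
    - exact: subset_refl.
    - move=> x _; rewrite normr_id.
      have := @ler_mx_norm _ _ _ (u (x + t *: basis_cV j) - u x) i ord0.
      by rewrite !mxE.
    - by rewrite mulr_ge0//= ler_wpM2l.
  have [G [mG GC] H] := weak_partial p_gt1 oO bO (mui i) wM C0 K1 wtr.
  by exists G; split.
exists (fun x => \matrix_(i, j) Gf (i, j) x); split; last first.
  move=> phi phiP i j; have [_ _ ->//] := HG (i, j).
  by congr (- _); apply: eq_Rintegral => x _; rewrite mxE.
have mGf ij : measurable_fun setT (Gf ij) by have [] := HG ij.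
apply: (memLp_le p1 mO (g := fun x => \sum_(ij : 'I_m * 'I_d) `|Gf ij x|)
  (a := (size (index_enum ('I_m * 'I_d)%type))%:R * C)).
- apply: measurable_fun_mx => // i j.
  by under eq_fun do rewrite mxE; exact: mGf.
- by apply: measurable_sum => k; exact: measurableT_comp.
- by rewrite mulr_ge0.
- move=> x; apply/mx_norm_leP; first exact: sumr_ge0.
  by move=> i j; rewrite mxE (bigD1 (i, j))//= lerDl sumr_ge0.
- by apply: Nle_sum => // ij; have [] := HG ij.
Qed.

End sobolev.

Lemma energy_ge0 {R : realType} d (A : 'M[R]_d) eps z (Wcell : 'M[R]_(d, 2 ^ d) -> R) y U :
  0 < eps -> (forall F, 0 <= Wcell F) -> (0 <= energy A eps z Wcell y U)%E.
Proof.
move=> eps0 W0; rewrite /energy; case: ifP => _ //.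
by rewrite mule_ge0 ?lee_fin ?exprn_ge0 ?(ltW eps0)//; apply: esum_ge0 => x _; rewrite lee_fin.
Qed.

Lemma translation_reach_ge1 {R : realType} d (A : 'M[R]_d) : 1 <= translation_reach A.
Proof.
have a0 : 0 <= d%:R * `|A| by rewrite mulr_ge0.
have b0 : 0 <= d%:R * `|invmx A| by rewrite mulr_ge0.
have c1 : 1 <= d.+1%:R :> R by rewrite ler1n.
rewrite /translation_reach -[leLHS]mulr1; apply: ler_pM => //; last lra.
by rewrite -[leLHS]mulr1; apply: ler_pM => //; lra.
Qed.

Theorem theorem1p2 (R : realType) (d : nat) (d_gt0 : (0 < d)%N)
    (p : R) (p_gt1 : 1 < p)
    (Omega : set 'cV[R]_d)
    (Omega_bounded : bounded_set Omega) (Omega_open : open Omega)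
    (Omega_lip : lipschitz_boundary Omega) (Omega_connected : connected Omega)
    (A : 'M[R]_d) (A_inv : A \in unitmx)
    (z : 'I_(2 ^ d) -> 'cV[R]_d) (z_corners : enumerates_corners A z)
    (Wcell : 'M[R]_(d, 2 ^ d) -> R) (Wcell_ge0 : forall F, 0 <= Wcell F)
    (c c' c'' : R) (c_gt0 : 0 < c) (c'_gt0 : 0 < c') (c''_gt0 : 0 < c'')
    (Wcell_growth : forall F, zero_row_sums F ->
       c * enorm F `^ p - c' <= Wcell F <= c'' * (enorm F `^ p + 1))
    (eps : nat -> R) (eps_gt0 : forall n, 0 < eps n)
    (eps_cvg0 : eps n @[n --> \oo] --> 0)
    (y : nat -> 'cV[R]_d -> 'cV[R]_d)
    (y_equibounded :
       (ereal_sup (range (fun n => energy A (eps n) z Wcell (y n) Omega))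
        < +oo)%E) :
  exists (k : nat -> nat) (u : 'cV[R]_d -> 'cV[R]_d),
    [/\ {homo k : m n / (m < n)%N},
        memW1p p Omega u &
        Lploc_cvg_mod_cst p Omega (fun n => y (k n)) u].
Proof.
have p1 : 1 <= p := ltW p_gt1.
have mO : measurable Omega by exact: open_measurable_cV.
set S := ereal_sup _ in y_equibounded.
have S_ub n : (energy A (eps n) z Wcell (y n) Omega <= S)%E.
  by apply: ereal_sup_ubound; exists n.
have S0 : (0 <= S)%E by apply: le_trans (S_ub 0%N); exact: energy_ge0.
have SE : S = (fine S)%:E by rewrite fineK// ge0_fin_numE.
have E0 : 0 <= fine S by exact: fine_ge0.
have ycst n : cellwise_constant A (eps n) Omega (y n).
  apply: contrapT => ncst; have := le_lt_trans (S_ub n) y_equibounded.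
  by rewrite /energy asboolF// ltxx.
pose C := gradient_bound A Omega p c c' (fine S).
have C0 : 0 <= C by exact: powR_ge0.
have gradC n : Nle (lebesgue_cV d) p (inside_cells A (eps n) Omega)
    (fun x => enorm (cell_gradient A (eps n) z (y n) x)) C.
  have Wc F : zero_row_sums F -> c * enorm F `^ p - c' <= Wcell F.
    by move=> /Wcell_growth /andP[].
  apply: (energy_gradient_bound A_inv Omega_bounded Omega_open p_gt1 Wcell_ge0 c_gt0 c'_gt0
    E0 Wc (eps_gt0 n)).
  by rewrite -SE; exact: S_ub.
(* Nothing is known of [y n] outside [Omega], not even measurability; the extension by zero is
   measurable on the whole space and agrees with [y n] on [Omega]. *)
pose f n (x : 'cV[R]_d) : 'cV[R]_d := if x \in Omega then y n x else 0.
have fE n x : Omega x -> f n x = y n x by move=> Ox; rewrite /f mem_set.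
have mf n : measurable_fun setT (f n).
  apply: (measurable_cell_ext (eps_gt0 n) mO).
  exact: (cellwise_constantP A_inv (eps_gt0 n) (ycst n)).
have fB n : exists B, forall x, Omega x -> `|f n x| <= B.
  have [B HB] := cell_fun_bounded A_inv (eps_gt0 n) Omega_bounded
    (cellwise_constantP A_inv (eps_gt0 n) (ycst n)).
  by exists B => x Ox; rewrite fE//; exact: HB.
have ftr n (V : set 'cV[R]_d) r (h : 'cV[R]_d) : measurable V -> V `<=` inner_part Omega r ->
    translation_reach A * (`|h| + eps n) < r ->
    Nle (lebesgue_cV d) p V (fun x => `|f n (x + h) - f n x|)
      (translation_factor A * C * (`|h| + eps n)).
  exact: (discrete_translation p1 A_inv (eps_gt0 n) Omega_open z_corners (ycst n) C0 (gradC n)).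
have K1 := translation_reach_ge1 A.
have C1 : 0 <= translation_factor A * C.
  by rewrite mulr_ge0// !mulr_ge0// addr_ge0// mulr_ge0.
have [k [cst [u [kmono mu_u uae ucvg]]]] := compactness p1 Omega_open Omega_bounded
  Omega_connected mf eps_gt0 eps_cvg0 K1 C1 ftr.
have mnu : measurable_fun setT (fun x : 'cV[R]_d => `|u x|).
  exact: (measurableT_comp (@measurable_norm_cV R d) mu_u).
have C2 : 0 <= 2 * (translation_factor A * C) by rewrite mulr_ge0.
have mcst n : measurable_fun setT (fun=> cst n : 'cV[R]_d) by exact: measurable_cst.
have mfc n : measurable_fun setT (fun x : 'cV[R]_d => f (k n) x - cst n).
  exact: measurable_funB_cV.
have mnfc n : measurable_fun setT (fun x : 'cV[R]_d => `|f (k n) x - cst n|).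
  exact: measurable_norm_funB.
(* This bound may depend on [n]: it comes from the finitely many values of a cellwise constant
   function and gives membership in L^p. *)
have fc_bound n (V : set 'cV[R]_d) : measurable V -> V `<=` Omega ->
    exists2 M, 0 <= M & Nle (lebesgue_cV d) p V (fun x => `|f (k n) x - cst n|) M.
  move=> mV VO; have [B HB] := fB (k n).
  apply: (Nle_bounded p1 mV _ (mnfc n) (B := B + `|cst n|)).
    apply: le_lt_trans (lebesgue_cV_bounded mO Omega_bounded).
    by apply: le_measure => //; rewrite inE.
  move=> x Vx; rewrite normr_id; apply: (le_trans (ler_normB _ _)).
  by rewrite lerD2r; apply: HB; exact: VO.
have quarter j : 0 <= (4^-1) ^+ j :> R by rewrite exprn_ge0.
(* One index is enough: [f (k j) - cst j] is bounded in L^p, and [u] differs from it by at most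
   [4 ^- j] on [exhaust Omega j]. *)
have u_loc j : exists2 M, 0 <= M & Nle (lebesgue_cV d) p (exhaust Omega j) (fun x => `|u x|) M.
  have mE := measurable_exhaust Omega j.
  have [M M0 HM] := fc_bound j _ mE (@exhaust_sub _ _ Omega j).
  exists (M + (4^-1) ^+ j); first by rewrite addr_ge0.
  apply: (NleD p1 mE (mnfc j) _ mnu _ M0 (quarter j) HM (ucvg j j (leqnn j))).
    exact: measurable_norm_funB.
  move=> x _; rewrite !normr_id -{1}(subKr (f (k j) x - cst j) (u x)).
  exact: ler_normB.
have [M M0 uM] := global_Lp p1 Omega_open Omega_bounded Omega_lip mu_u C2
  (long_translation p1 mf eps_gt0 eps_cvg0 K1 C1 ftr kmono mu_u uae) u_loc.
exists k, u; split; first exact: kmono.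
  apply: (memW1p_translations p_gt1 Omega_open Omega_bounded mu_u M0 uM C2 K1).
  exact: (limit_translation p1 mf eps_gt0 eps_cvg0 K1 C1 ftr kmono mu_u uae).
exists cst => U oU [cU UO].
have mU : measurable U by exact: open_measurable_cV.
have UOm : U `<=` Omega := subset_trans (@subset_closure _ U) UO.
have [j0 Uj] := compact_sub_exhaust Omega_open cU UO.
have fyE n x : U x -> f (k n) x - cst n = y (k n) x - cst n by move=> /UOm /fE ->.
split.
- move=> n; apply: (eq_memLp (fyE n)).
  have [B B0 HB] := fc_bound n U mU UOm.
  exact: (memLp_le p1 mU (mfc n) (mnfc n) B0 (fun x => lexx _) HB).
- apply: (memLp_le p1 mU mu_u mnu M0 (fun x => lexx _)).
  apply: (Nle_mono p1 mU mO mnu mnu UOm _ _ uM); first by move=> x _; exact: lexx.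
  by rewrite M0 lexx.
- pose kap := Num.sqrt (d * 1)%:R : R.
  apply: (@squeeze_cvge _ _ _ _ (fun=> 0%E) _ (fun n => (kap * (4^-1) ^+ n)%:E)).
  + near=> n; apply/andP; split; first exact: Lnorm_ge0.
    have jn : (j0 <= n)%N by near: n; exact: nbhs_infty_ge.
    have fyE' x : U x -> y (k n) x - cst n - u x = f (k n) x - cst n - u x.
      by move=> Ux; rewrite fyE.
    rewrite (eq_Lp_norm p fyE').
    have mD : measurable_fun setT (fun x : 'cV[R]_d => f (k n) x - cst n - u x).
      exact: measurable_funB_cV.
    have mnD : measurable_fun setT (fun x : 'cV[R]_d => `|f (k n) x - cst n - u x|).
      exact: measurable_norm_funB.
    apply: (Lp_norm_le p1 mU mD mnD (quarter n) (fun x => lexx _)).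
    apply: (Nle_mono p1 mU (measurable_exhaust Omega n) mnD mnD _ _ _ (ucvg n n (leqnn n))).
    * move=> x Ux; apply: (exhaust_nd jn); apply: Uj; exact: subset_closure.
    * by move=> x _; exact: lexx.
    * by rewrite quarter lexx.
  + exact: cvg_cst.
  + apply: cvg_EFin; first exact: nearW.
    rewrite -(mulr0 kap); apply: cvgMr; apply: cvg_expr.
    by rewrite ger0_norm ?invr_ge0// invf_lt1// ltr1n.
Unshelve. all: by end_near.
Qed.
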